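(* Let $\alpha\ge0$, $\gamma>0$, $0\le\xi\le1$, let $\mu\ge1$ and $\nu>0$ satisfy $\mu+\nu=\alpha-\gamma$ and $\mu\nu=\gamma$. Let $-1<c<0$ and $p>2$, and let $\beta<1$ be given by $$\frac{\beta-1/2}{1-\beta}=-\frac{(1+c)^p}{\Gamma(p)}\int_0^1t^c\left(\log\frac1t\right)^{p-1}q(t)\,dt .$$ Then for $f\in W_\beta(\alpha,\gamma)$ the function $$V_\lambda(f)(z)=\frac{(1+c)^p}{\Gamma(p)}\int_0^1\left(\log\frac1t\right)^{p-1}t^{c-1}f(tz)\,dt$$ belongs to $M(\xi)$.
   Context: $\mathbb{D}=\{z\in\mathbb{C}:|z|<1\}$. $\mathcal{A}$ is the class of analytic functions $f$ in $\mathbb{D}$ with $f(0)=f'(0)-1=0$. For $0\le\xi\le1$, the Pascu class $M(\xi)$ consists of the $f\in\mathcal{A}$ with $\mathrm{Re}\,\dfrac{\xi z(zf'(z))'+(1-\xi)zf'(z)}{\xi zf'(z)+(1-\xi)f(z)}>0$ in $\mathbb{D}$, i.e. $\xi zf'+(1-\xi)f$ is starlike with respect to the origin. For $\alpha\ge0,\gamma\ge0,\beta<1$, $W_\beta(\alpha,\gamma)$ is the class of $f\in\mathcal{A}$ for which there is $\phi\in\mathbb{R}$ with $\mathrm{Re}\left(e^{i\phi}\left((1-\alpha+2\gamma)\frac{f(z)}{z}+(\alpha-2\gamma)f'(z)+\gamma zf''(z)-\beta\right)\right)>0$ for all $z\in\mathbb{D}$. $q$ is the solution of $\frac{d}{dt}\left[t^{1/\nu}q(t)\right]=\frac{1}{\mu\nu}t^{1/\nu-1}\int_0^1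 s^{1/\mu-1}\frac{1-st}{(1+st)^3}\,ds$ with $q(0)=1$, with series $q(t)=\sum_{n=0}^\infty\frac{(n+1)^2(-1)^nt^n}{(1+\mu n)(1+\nu n)}$. *)

(* Defs.v *)
From Stdlib Require Import Reals ClassicalEpsilon.
From Coquelicot Require Import Coquelicot.

Open Scope R_scope.

Definition unit_disc (z : C) : Prop := Cmod z < 1.

Definition analytic_at (f : C -> C) (z0 : C) : Prop :=
  exists a : nat -> C, locally z0 (fun z : C => is_pseries a (z - z0)%C (f z)).

(* The class of functions analytic in the unit disc with f(0) = f'(0) - 1 = 0.
   Functions are total on C; only their values in the disc are ever constrained.
   Coquelicot's C_derive is a limit along a horizontal line; it is the complex derivative
   wherever f is analytic. *)
Definition class_A (f : C -> C) : Prop :=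
  (forall z : C, unit_disc z -> analytic_at f z) /\
  f 0%C = 0%C /\ C_derive f 0%C = 1%C.

(* f(z)/z, extended at the removable singularity z = 0 by f'(0)
   (meaningful when f(0) = 0). *)
Definition quot_z (f : C -> C) (z : C) : C :=
  if excluded_middle_informative (z = 0%C) then C_derive f 0%C else (f z / z)%C.

Definition z_deriv (f : C -> C) (z : C) : C := (z * C_derive f z)%C.

(* At z = 0 both numerator and denominator vanish and the quotient extends by 1,
   so the inequality is only asked for z <> 0.  A point where the denominator
   vanishes is ruled out, since division by 0 in C returns 0. *)
Definition pascu (xi : R) (f : C -> C) : Prop :=
  class_A f /\
  forall z : C, unit_disc z -> z <> 0%C ->
    0 < Re ((xi * (z * C_derive (z_deriv f) z) + (1 - xi) * (z * C_derive f z))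
            / (xi * (z * C_derive f z) + (1 - xi) * f z))%C.

Definition cis (phi : R) : C := (cos phi, sin phi).

Definition class_W (beta alpha gamma : R) (f : C -> C) : Prop :=
  class_A f /\
  exists phi : R, forall z : C, unit_disc z ->
    0 < Re (cis phi *
            ((1 - alpha + 2 * gamma) * quot_z f z
             + (alpha - 2 * gamma) * C_derive f z
             + gamma * z * C_derive (C_derive f) z
             - beta))%C.

(* Rpower is only defined as a power for a positive base, and the integrands may be
   singular at the endpoints, hence improper integrals over the open interval. *)
Definition int01 (g : R -> R) : R := RInt_gen g (at_right 0) (at_left 1).

Definition int01_C (g : R -> C) : C :=
  @RInt_gen C_R_CompleteNormedModule g (at_right 0) (at_left 1).

Definition Gamma (p : R) : R :=
  RInt_gen (fun t : R => Rpower t (p - 1) * exp (- t))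
    (at_right 0) (Rbar_locally p_infty).

(* The differential equation is singular at t = 0; the initial value is attained
   continuously, which excludes adding multiples of t^(-1/nu). *)
Definition is_q (mu nu : R) (q : R -> R) : Prop :=
  (forall t : R, 0 < t < 1 ->
     is_derive (fun u : R => Rpower u (1 / nu) * q u) t
       (1 / (mu * nu) * Rpower t (1 / nu - 1) *
        int01 (fun s : R =>
          Rpower s (1 / mu - 1) * ((1 - s * t) / (1 + s * t) ^ 3)))) /\
  q 0 = 1 /\
  filterlim q (at_right 0) (locally 1).

Definition V_lambda (c p : R) (f : C -> C) (z : C) : C :=
  (RtoC (Rpower (1 + c) p / Gamma p) *
   int01_C (fun t : R =>
     RtoC (Rpower (ln (1 / t)) (p - 1) * Rpower t (c - 1)) * f (t * z)))%C.

(* Main.v *)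
Require Import Defs.
From Stdlib Require Import Reals.
From Coquelicot Require Import Coquelicot.
From Stdlib Require Import Lra Lia.
Open Scope R_scope.

(** Write a_n for the Taylor coefficients of f and put
      D_m = (1 + mu m) (1 + nu m),   H_m = D_m a_(m+1),   lam_m = ((1+c) / (1+c+m))^p.
    The relations between mu, nu, alpha and gamma say that the expression constrained in the
    class W is the sum of H_m z^m ([W_series]); the Gamma integral shows that the transform F has
    the coefficients lam_m a_(m+1) ([V_series]).

    Let P = xi z F' + (1-xi) F. The real part of z P'/P is positive at z as soon as
    P + eps (z P' - P) is nonzero at z for every eps in the closed disc |eps - 1/2| <= 1/2
    ([starlike_test]). Divided by z, this expression is the convolution of H with the series of
      t_m = (1 + m eps) (1 + m xi) kappa_m,   kappa_m = lam_m / D_m.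
    A function of value 1 at 0 whose real part exceeds 1/2 preserves half-planes under convolution
    ([convolution_half_plane]). Applied to 1 + (1-beta) (t_1 y + t_2 y^2 + ...) and to H - beta,
    this leaves the inequality  Re (sum of t_m y^m) > Q  to prove, where Q is the constant in the
    definition of beta. Formally Q is the sum of (-1)^m (m+1)^2 kappa_m, that is, the value for
    xi = eps = 1 at y = -1: the claim is that this is the extreme case.

    The inequality ([test_mult_lower_bound]) rests on two facts.
    - Call m a positive multiplier if it preserves nonnegativity on (0,1) of power series
      ([PosMult]). The sequences (n+a)^(-s) with a, s > 0 are positive multipliers, because they
      are moments of t^(a-1) log(1/t)^(s-1); so are the ratios (n+b)/(n+a) with b >= a > 0.
    - For |z| = 1, the series with coefficients  Re ((1 + n eps) z^n) - (-1)^n (n+1)  becomes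
      nonnegative on (0,1) after division of its coefficients by (n+1)(n+2)
      ([double_primitive_nonneg]).
    What is left of t_n after splitting off 1/((n+1)(n+2)) is a positive multiplier
    ([PosMult_residual]), and this is where c < 0, mu >= 1 and p > 2 enter. Hence Re (sum of
    t_m (rho z)^m) is at least the alternating sum at eps = 1 and radius rho. Averaging passes from
    xi to 1, and the alternating sum decreases strictly in rho since (1-t)/(1+t)^3 does, which
    also gives the strict inequality; its values dominate Q because q is decreasing
    ([q_integral_le]).

    Analyticity is given by local power series, so the coefficients a_n are first shown to exist in
    the whole disc: contracting a circle to a point yields Cauchy's formula, and expanding the
    Cauchy kernel yields the Taylor series ([taylor_disc]). Conversely a convergent power series can be
    recentred at any point of its disc, which gives its derivative and the analyticity of F. *)

(** * Complex series and recentring of power series *)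

(** Fixes the structure in which real partial sums are taken, so that linear arithmetic recognises
    equal sums. *)
Notation rsum := (@sum_n R_AbelianMonoid).

Definition is_Cseries (u : nat -> C) (l : C) : Prop := @is_series C_AbsRing C_NormedModule u l.

(** The first N terms, so that the empty sum is available; this is one term less than in [sum_n].
    *)
Fixpoint Csum (u : nat -> C) (N : nat) : C :=
  match N with O => 0%C | S n => (Csum u n + u n)%C end.

Lemma Csum_sum_n u N : Csum u (S N) = @sum_n C_AbelianMonoid u N.
Proof.
  induction N as [|N IH].
  - rewrite sum_O. simpl. ring.
  - rewrite sum_Sn, <- IH. reflexivity.
Qed.

Lemma is_Cseries_eps u l :
  is_Cseries u l <-> forall eps, 0 < eps -> exists N0, forall N, (N0 <= N)%nat -> Cmod (Csum u N -
    l) < eps.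
Proof.
  unfold is_Cseries, is_series. split.
  - intros H eps He.
    assert (HB : locally (T := C_UniformSpace) l (fun y => Cmod (y - l) < eps)).
    { apply locally_C. exists (mkposreal eps He). intros y Hy. exact Hy. }
    destruct (H _ HB) as [N HN].
    exists (S N). intros M HM. destruct M as [|M]; [lia|].
    rewrite Csum_sum_n. apply HN. lia.
  - intros H P HP. apply locally_C in HP. destruct HP as [eps HP].
    destruct (H eps (cond_pos eps)) as [N HN].
    exists N. intros n Hn. apply HP.
    change (Cmod (@sum_n C_AbelianMonoid u n - l) < eps). rewrite <- Csum_sum_n. apply HN. lia.
Qed.

Lemma is_Cseries_unique u l m : is_Cseries u l -> is_Cseries u m -> l = m.
Proof.
  intros H1 H2. rewrite is_Cseries_eps in H1, H2.
  destruct (Ceq_dec l m) as [E|E]; [exact E|exfalso].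
  assert (Hp : 0 < Cmod (l - m)).
  { apply Cmod_gt_0. intro H. apply E. replace l with (l - m + m)%C by ring. rewrite H. ring. }
  destruct (H1 (Cmod (l - m) / 2)) as [N1 K1]; [lra|].
  destruct (H2 (Cmod (l - m) / 2)) as [N2 K2]; [lra|].
  specialize (K1 (N1 + N2)%nat ltac:(lia)). specialize (K2 (N1 + N2)%nat ltac:(lia)).
  set (s := Csum u (N1 + N2)) in *.
  assert (T := Cmod_triangle (-(s - l)) (s - m)).
  rewrite Cmod_opp in T. replace (- (s - l) + (s - m))%C with (l - m)%C in T by ring. lra.
Qed.

Lemma is_Cseries_ext u v l : (forall n, u n = v n) -> is_Cseries u l -> is_Cseries v l.
Proof. intros; eapply is_series_ext; eauto. Qed.

Lemma is_Cseries_plus u v l m : is_Cseries u l -> is_Cseries v m -> is_Cseries (fun n => u n + v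
  n)%C (l + m)%C.
Proof. intros; now apply (is_series_plus u v l m). Qed.

Lemma is_Cseries_scal c u l : is_Cseries u l -> is_Cseries (fun n => c * u n)%C (c * l)%C.
Proof. intros; now apply (is_series_scal (K := C_AbsRing) c u l). Qed.

Lemma is_Cseries_minus u v l m : is_Cseries u l -> is_Cseries v m -> is_Cseries (fun n => u n - v
  n)%C (l - m)%C.
Proof. intros; now apply (is_series_minus u v l m). Qed.

Lemma Re_Csum u N : Re (Csum u (S N)) = rsum (fun n => Re (u n)) N.
Proof.
  induction N as [|N IH]; [rewrite sum_O; apply Rplus_0_l|].
  rewrite sum_Sn, <- IH. reflexivity.
Qed.

Lemma Im_Csum u N : Im (Csum u (S N)) = rsum (fun n => Im (u n)) N.
Proof.
  induction N as [|N IH]; [rewrite sum_O; apply Rplus_0_l|].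
  rewrite sum_Sn, <- IH. reflexivity.
Qed.

Lemma im_le_Cmod z : Rabs (Im z) <= Cmod z.
Proof. eapply Rle_trans; [apply Rmax_r|apply (Rmax_Cmod z)]. Qed.

Lemma Cmod_le_ReIm z : Cmod z <= Rabs (Re z) + Rabs (Im z).
Proof.
  replace z with (RtoC (Re z) + Ci * RtoC (Im z))%C at 1.
  - eapply Rle_trans; [apply Cmod_triangle|]. rewrite Cmod_mult, Cmod_Ci, !Cmod_R. lra.
  - destruct z; unfold RtoC, Ci, Cplus, Cmult, Re, Im; simpl; f_equal; ring.
Qed.

Lemma is_series_eps u (l : R) :
  is_series u l <-> forall eps, 0 < eps -> exists N0, forall N, (N0 <= N)%nat -> Rabs (rsum u N -
    l) < eps.
Proof.
  split.
  - intros H eps He. apply is_series_Reals in H. destruct (H eps He) as [N HN].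
    exists N. intros n Hn. rewrite sum_n_Reals. apply HN. lia.
  - intros H. apply is_series_Reals. intros eps He. destruct (H eps He) as [N HN].
    exists N. intros n Hn. unfold Rdist. rewrite <- sum_n_Reals. apply HN. lia.
Qed.

Lemma is_Cseries_comp u l : is_Cseries u l <-> is_series (fun n => Re (u n)) (Re l) /\ is_series
  (fun n => Im (u n)) (Im l).
Proof.
  rewrite is_Cseries_eps, !is_series_eps. split.
  - intros H; split; intros eps He; destruct (H eps He) as [N HN]; exists N; intros n Hn;
      (eapply Rle_lt_trans; [|apply (HN (S n)); lia]).
    + rewrite <- Re_Csum. eapply Rle_trans; [|apply re_le_Cmod]. right. f_equal.
    + rewrite <- Im_Csum. eapply Rle_trans; [|apply im_le_Cmod]. right. f_equal.
  - intros [H1 H2] eps He. destruct (H1 (eps/2)) as [N1 K1]; [lra|].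
      destruct (H2 (eps/2)) as [N2 K2]; [lra|].
    exists (S (N1 + N2)). intros N HN. destruct N as [|N]; [lia|].
    specialize (K1 N ltac:(lia)). specialize (K2 N ltac:(lia)).
    rewrite <- Re_Csum in K1. rewrite <- Im_Csum in K2.
    eapply Rle_lt_trans; [apply Cmod_le_ReIm|].
    replace (Re (Csum u (S N) - l)) with (Re (Csum u (S N)) - Re l) by reflexivity.
    replace (Im (Csum u (S N) - l)) with (Im (Csum u (S N)) - Im l) by reflexivity. lra.
Qed.

(** A total sum, as for [Series]; it is meaningful for convergent series. *)
Definition Cseries (u : nat -> C) : C := (Series (fun n => Re (u n)), Series (fun n => Im (u n))).

Lemma is_Cseries_abs u : ex_series (fun n => Cmod (u n)) -> is_Cseries u (Cseries u).
Proof.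
  intros H. apply is_Cseries_comp. split; apply Series_correct.
  - apply ex_series_Rabs. apply (ex_series_le (V := R_CompleteNormedModule) _ (fun n => Cmod (u
      n))); auto.
    intros n. change (Rabs (Rabs (Re (u n))) <= Cmod (u n)). rewrite Rabs_Rabsolu. apply re_le_Cmod.
  - apply ex_series_Rabs. apply (ex_series_le (V := R_CompleteNormedModule) _ (fun n => Cmod (u
      n))); auto.
    intros n. change (Rabs (Rabs (Im (u n))) <= Cmod (u n)). rewrite Rabs_Rabsolu. apply im_le_Cmod.
Qed.

Lemma Cseries_unique u l : is_Cseries u l -> Cseries u = l.
Proof.
  intros H. apply is_Cseries_comp in H. destruct H as [H1 H2]. unfold Cseries.
  rewrite (is_series_unique _ _ H1), (is_series_unique _ _ H2). destruct l; reflexivity.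
Qed.

Lemma Csum_Cmod u N : Cmod (Csum u (S N)) <= rsum (fun n => Cmod (u n)) N.
Proof.
  induction N as [|N IH].
  - rewrite sum_O. simpl. rewrite Cplus_0_l. lra.
  - rewrite sum_Sn. eapply Rle_trans; [apply Cmod_triangle|].
    apply Rplus_le_compat_r. exact IH.
Qed.

Lemma sum_n_le_Series u s N : (forall n, 0 <= u n) -> is_series u s -> rsum u N <= s.
Proof.
  intros Hp Hs. rewrite is_series_eps in Hs.
  destruct (Rle_lt_dec (rsum u N) s) as [L|L]; [exact L|exfalso].
  destruct (Hs (rsum u N - s)) as [M HM]; [lra|].
  specialize (HM (N + M)%nat ltac:(lia)).
  assert (Hmono : rsum u N <= rsum u (N + M)).
  { clear HM. induction M as [|M IH]; [rewrite Nat.add_0_r; lra|].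
    rewrite Nat.add_succ_r, sum_Sn. specialize (Hp (S (N+M))). eapply Rle_trans; [exact IH|].
      rewrite <- (Rplus_0_r (rsum u (N + M))) at 1. apply Rplus_le_compat_l. exact Hp. }
  apply Rabs_def2 in HM. destruct HM. lra.
Qed.

Lemma term_le_Series u s n : (forall n, 0 <= u n) -> is_series u s -> u n <= s.
Proof.
  intros Hp Hs. apply Rle_trans with (rsum u n); [|now apply sum_n_le_Series].
  assert (P : forall k, 0 <= rsum u k).
  { induction k as [|k IH]; [rewrite sum_O; apply Hp|]. rewrite sum_Sn. apply Rplus_le_le_0_compat;
      auto. }
  destruct n as [|n]; [rewrite sum_O; apply Rle_refl|].
  rewrite sum_Sn. rewrite <- (Rplus_0_l (u (S n))) at 1. apply Rplus_le_compat_r, P.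
Qed.

Lemma ratio_lt_1 r x : 0 <= r < x -> 0 <= r / x < 1.
Proof.
  intros H. split; [apply Rmult_le_pos; [lra|left; apply Rinv_0_lt_compat; lra]|].
  apply (Rmult_lt_reg_r x); [lra|]. unfold Rdiv. rewrite Rmult_assoc, Rinv_l; lra.
Qed.

Lemma geom_small q M eps : 0 <= q < 1 -> 0 <= M -> 0 < eps -> exists N, forall n, (N <= n)%nat -> q
  ^ n * M < eps.
Proof.
  intros Hq HM He.
  destruct (pow_lt_1_zero q ltac:(rewrite Rabs_pos_eq; lra) (eps / (M + 1))) as [N HN];
    [apply Rdiv_lt_0_compat; lra|].
  exists N. intros n Hn. specialize (HN n ltac:(lia)). pose proof (pow_le q n ltac:(lra)) as P.
  rewrite Rabs_pos_eq in HN by exact P. apply (Rmult_lt_compat_r (M + 1)) in HN; [|lra].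
  unfold Rdiv in HN. rewrite Rmult_assoc, Rinv_l in HN; lra.
Qed.

Lemma is_Cseries_norm u l s : is_Cseries u l -> is_series (fun n => Cmod (u n)) s -> Cmod l <= s.
Proof.
  intros H Hs. rewrite is_Cseries_eps in H.
  destruct (Rle_lt_dec (Cmod l) s) as [L|L]; [exact L|exfalso].
  destruct (H (Cmod l - s)) as [N HN]; [lra|]. specialize (HN (S N) ltac:(lia)).
  pose proof (Csum_Cmod u N) as H1.
  pose proof (sum_n_le_Series _ _ N (fun n => Cmod_ge_0 (u n)) Hs) as H2.
  assert (T := Cmod_triangle (-(Csum u (S N) - l)) (Csum u (S N))). rewrite Cmod_opp in T.
  replace (- (Csum u (S N) - l) + Csum u (S N))%C with l in T by ring. lra.
Qed.

Lemma ex_series_dom (u v : nat -> R) : (forall n, 0 <= u n <= v n) -> ex_series v -> ex_series u.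
Proof.
  intros H Hv. apply (ex_series_le (V := R_CompleteNormedModule) u v); auto.
  intros n. change (Rabs (u n) <= v n). rewrite Rabs_pos_eq; apply H.
Qed.

(** Absolute convergence in the open disc of radius Rd around 0. *)
Definition disc_summable (Rd : R) (a : nat -> C) := forall r, 0 <= r < Rd -> ex_series (fun n =>
  Cmod (a n) * r ^ n).
Definition is_Cpseries (a : nat -> C) (z l : C) := is_Cseries (fun n => a n * z ^ n)%C l.
Definition CPSeries (a : nat -> C) (z : C) : C := Cseries (fun n => a n * z ^ n)%C.

Lemma pow_n_Cpow (z : C) n : @pow_n C_Ring z n = (z ^ n)%C.
Proof. induction n as [|n IH]; [reflexivity|]. simpl. rewrite IH. reflexivity. Qed.

Lemma is_pseries_Cpseries a (z l : C) : @is_pseries C_AbsRing C_NormedModule a z l <-> is_Cpseries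
  a z l.
Proof.
  unfold is_Cpseries, is_Cseries, is_pseries.
  assert (E : forall n, (pow_n (K := C_Ring) z n * a n = a n * z ^ n)%C)
    by (intros n; rewrite pow_n_Cpow; apply Cmult_comm).
  split; apply is_series_ext; intros n; [exact (E n)|symmetry; exact (E n)].
Qed.

Lemma disc_summable_term Rd a z : disc_summable Rd a -> Cmod z < Rd -> ex_series (fun n => Cmod (a
  n * z ^ n)%C).
Proof.
  intros H Hz. eapply ex_series_ext; [|apply (H (Cmod z))].
  - intros n. simpl. now rewrite Cmod_mult, Cmod_pow.
  - split; [apply Cmod_ge_0|exact Hz].
Qed.

Lemma CPSeries_correct Rd a z : disc_summable Rd a -> Cmod z < Rd -> is_Cpseries a z (CPSeries a z).
Proof. intros H Hz. apply is_Cseries_abs. eapply disc_summable_term; eauto. Qed.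

(** The coefficient of w^k in (z0 + w)^n, by Pascal's rule, so that no binomial coefficients
    appear. *)
Fixpoint shift_binom (z0 : C) (n k : nat) : C :=
  match n with
  | O => match k with O => 1%C | _ => 0%C end
  | S m => (z0 * shift_binom z0 m k + match k with O => 0 | S j => shift_binom z0 m j end)%C
  end.

Lemma shift_binom_bound z0 eta n : 0 <= eta -> forall k, Cmod (shift_binom z0 n k) * eta ^ k <=
  (Cmod z0 + eta) ^ n.
Proof.
  intros He. induction n as [|n IH]; intros k.
  - destruct k; simpl; [rewrite Cmod_1; lra|rewrite Cmod_0; lra].
  - assert (P : 0 <= eta ^ k) by now apply pow_le.
    assert (Z : 0 <= Cmod z0) by apply Cmod_ge_0.
    destruct k as [|k].
    + cbn [shift_binom]. rewrite Cplus_0_r, Cmod_mult. specialize (IH 0%nat). simpl in *.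
      pose proof (Cmod_ge_0 (shift_binom z0 n 0)).
      assert (0 <= (Cmod z0 + eta) ^ n) by (apply pow_le; lra). nra.
    + cbn [shift_binom]. pose proof (Cmod_triangle (z0 * shift_binom z0 n (S k)) (shift_binom z0 n
        k)) as T.
      rewrite Cmod_mult in T.
      pose proof (IH (S k)) as I1. pose proof (IH k) as I2.
      apply Rle_trans with ((Cmod z0 * Cmod (shift_binom z0 n (S k)) + Cmod (shift_binom z0 n k)) *
        eta ^ S k).
      { apply Rmult_le_compat_r; auto. }
      simpl in *.
      apply Rle_trans with (Cmod z0 * (Cmod (shift_binom z0 n (S k)) * (eta * eta ^ k)) + eta *
        (Cmod (shift_binom z0 n k) * eta ^ k)); [right; ring|].
      apply Rle_trans with (Cmod z0 * (Cmod z0 + eta) ^ n + eta * (Cmod z0 + eta) ^ n); [|right;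
        ring].
      apply Rplus_le_compat; apply Rmult_le_compat_l; auto.
Qed.

(** The remainder of the binomial expansion of (z0 + w)^n after K terms. *)
Definition shift_rem z0 w K n : C := ((z0 + w) ^ n - Csum (fun k => shift_binom z0 n k * w ^ k)
  K)%C.

Lemma shift_rem_S z0 w J n : shift_rem z0 w (S J) (S n) = (z0 * shift_rem z0 w (S J) n + w *
  shift_rem z0 w J n)%C.
Proof.
  unfold shift_rem.
  assert (H : forall J, Csum (fun k => shift_binom z0 (S n) k * w ^ k)%C (S J) =
    (z0 * Csum (fun k => shift_binom z0 n k * w ^ k) (S J) + w * Csum (fun k => shift_binom z0 n k
      * w ^ k) J)%C).
  { clear J. intros J. induction J as [|J IH].
    - cbn [Csum shift_binom]. simpl. ring.
    - change (Csum (fun k => shift_binom z0 (S n) k * w ^ k)%C (S (S J))) with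
        (Csum (fun k => shift_binom z0 (S n) k * w ^ k)%C (S J) + shift_binom z0 (S n) (S J) * w ^
          (S J))%C.
      rewrite IH. cbn [Csum shift_binom]. simpl Cpow. ring. }
  rewrite H. simpl Cpow. ring.
Qed.

(** Pascal's rule for the remainders ([shift_rem_S]) propagates the bound by induction on n. The
    factor (|w|/eta)^K makes one estimate serve both the convergence of the recentred series (K
    tends to infinity) and its derivative (K = 2). *)
Lemma shift_rem_bound z0 w eta n : Cmod w <= eta ->
  forall K, Cmod (shift_rem z0 w K n) * eta ^ K <= Cmod w ^ K * (Cmod z0 + eta) ^ n.
Proof.
  intros Hw. pose proof (Cmod_ge_0 w) as W. pose proof (Cmod_ge_0 z0) as Z.
  assert (E0 : 0 <= eta) by lra.
  assert (K0 : forall n, Cmod (shift_rem z0 w 0 n) <= (Cmod z0 + eta) ^ n).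
  { intros m. unfold shift_rem. simpl Csum. replace ((z0 + w) ^ m - 0)%C with ((z0 + w)^m)%C by
      ring.
    rewrite Cmod_pow. apply pow_incr. split; [apply Cmod_ge_0|].
    eapply Rle_trans; [apply Cmod_triangle|lra]. }
  induction n as [|n IH]; intros K.
  - destruct K as [|K].
    + specialize (K0 O). simpl in *. lra.
    + replace (shift_rem z0 w (S K) 0) with (RtoC 0).
      { rewrite Cmod_0. assert (0 <= Cmod w ^ S K) by (now apply pow_le). simpl ((_ + _)^0). lra. }
      unfold shift_rem. induction K as [|K IH]; [simpl; ring|].
      rewrite IH. cbn [Csum shift_binom]. simpl Cpow. ring.
  - destruct K as [|K].
    + specialize (K0 (S n)). change (Cmod w ^ 0) with 1. change (eta ^ 0) with 1. lra.
    + rewrite shift_rem_S.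
      pose proof (Cmod_triangle (z0 * shift_rem z0 w (S K) n) (w * shift_rem z0 w K n)) as T.
      rewrite !Cmod_mult in T. pose proof (IH (S K)) as I1. pose proof (IH K) as I2.
      assert (P : 0 <= eta ^ S K) by now apply pow_le.
      eapply Rle_trans; [apply Rmult_le_compat_r; [exact P|exact T]|].
      simpl in *.
      apply Rle_trans with (Cmod z0 * (Cmod (shift_rem z0 w (S K) n) * (eta * eta ^ K)) + eta *
        Cmod w * (Cmod (shift_rem z0 w K n) * eta ^ K)); [right; ring|].
      apply Rle_trans with (Cmod z0 * (Cmod w * Cmod w ^ K * (Cmod z0 + eta) ^ n) + eta * Cmod w *
        (Cmod w ^ K * (Cmod z0 + eta) ^ n)); [|right; ring].
      apply Rplus_le_compat; apply Rmult_le_compat_l; auto. apply Rmult_le_pos; lra.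
Qed.

Definition recenter (a : nat -> C) (z0 : C) (k : nat) : C := Cseries (fun n => a n * shift_binom z0
  n k)%C.

Lemma recenter_correct Rd a z0 k : disc_summable Rd a -> Cmod z0 < Rd ->
  is_Cseries (fun n => a n * shift_binom z0 n k)%C (recenter a z0 k).
Proof.
  intros H Hz. apply is_Cseries_abs.
  set (eta := (Rd - Cmod z0) / 2). assert (He : 0 < eta) by (unfold eta; lra).
  pose proof (Cmod_ge_0 z0) as Z.
  apply ex_series_dom with (fun n => (/ eta ^ k) * (Cmod (a n) * (Cmod z0 + eta) ^ n)).
  - intros n. split; [apply Cmod_ge_0|]. rewrite Cmod_mult.
    pose proof (shift_binom_bound z0 eta n (Rlt_le _ _ He) k) as B.
    assert (P : 0 < eta ^ k) by now apply pow_lt.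
    apply (Rmult_le_reg_r (eta ^ k)); [exact P|].
    apply Rle_trans with (Cmod (a n) * (Cmod z0 + eta) ^ n); [|right; field; lra].
    rewrite Rmult_assoc. apply Rmult_le_compat_l; [apply Cmod_ge_0|exact B].
  - apply (ex_series_scal (V := R_NormedModule)). apply H. unfold eta in *. lra.
Qed.

Lemma is_Cseries_Csum (F : nat -> nat -> C) (L : nat -> C) K :
  (forall k, is_Cseries (F k) (L k)) -> is_Cseries (fun n => Csum (fun k => F k n) K) (Csum L K).
Proof.
  intros H. induction K as [|K IH].
  - simpl. apply is_Cseries_eps. intros eps He. exists O. intros N _.
    replace (Csum (fun _ => 0%C) N) with (RtoC 0).
    + replace (0 - 0)%C with (RtoC 0) by ring. now rewrite Cmod_0.
    + induction N as [|N IH]; [reflexivity|]. simpl. rewrite <- IH. ring.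
  - simpl. apply is_Cseries_plus; auto.
Qed.

Lemma Csum_ext u v N : (forall n, (n < N)%nat -> u n = v n) -> Csum u N = Csum v N.
Proof.
  induction N as [|N IH]; intros H; [reflexivity|]. simpl. rewrite IH; [|intros; apply H; lia].
  rewrite H; [reflexivity|lia].
Qed.

Lemma Csum_mult_l c u N : Csum (fun n => c * u n)%C N = (c * Csum u N)%C.
Proof. induction N as [|N IH]; simpl; [ring|]. rewrite IH. ring. Qed.

(** Each term of the remainder of the recentred series is a remainder [shift_rem], so summing
    [shift_rem_bound] over n needs no rearrangement of a double series. *)
Lemma recenter_bound Rd a z0 eta : disc_summable Rd a -> 0 < eta -> Cmod z0 + eta < Rd ->
  exists M, 0 <= M /\ forall w K, Cmod w <= eta ->
    Cmod (CPSeries a (z0 + w) - Csum (fun k => recenter a z0 k * w ^ k)%C K)%C <= (Cmod w / eta) ^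
      K * M.
Proof.
  intros H He Hz. pose proof (Cmod_ge_0 z0) as Z.
  assert (Hs : ex_series (fun n => Cmod (a n) * (Cmod z0 + eta) ^ n)) by (apply H; lra).
  destruct Hs as [M HM]. exists M. split.
  { assert (P : forall n, 0 <= Cmod (a n) * (Cmod z0 + eta) ^ n)
      by (intros n; apply Rmult_le_pos; [apply Cmod_ge_0|apply pow_le; lra]).
    exact (Rle_trans _ _ _ (P O) (term_le_Series _ _ O P HM)). }
  intros w K Hw. pose proof (Cmod_ge_0 w) as W.
  assert (D1 : is_Cseries (fun n => a n * shift_rem z0 w K n)%C (CPSeries a (z0 + w) - Csum (fun k
    => recenter a z0 k * w ^ k)%C K)%C).
  { eapply is_Cseries_ext; [|apply is_Cseries_minus;
      [apply (CPSeries_correct Rd a (z0 + w) H)|apply (is_Cseries_Csum (fun k n => a n *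
      shift_binom z0 n k * w ^ k)%C)]].
    - intros n. unfold shift_rem. simpl.
      rewrite (Csum_ext _ (fun k => a n * (shift_binom z0 n k * w ^ k))%C); [rewrite Csum_mult_l;
        ring|intros; ring].
    - eapply Rle_lt_trans; [apply Cmod_triangle|lra].
    - intros k. eapply is_Cseries_ext; [|rewrite Cmult_comm; apply (is_Cseries_scal (w ^ k)%C);
        apply (recenter_correct Rd); auto; lra].
      intros n. simpl. ring. }
  assert (P : 0 < eta ^ K) by now apply pow_lt.
  assert (D2 : forall n, Cmod (a n * shift_rem z0 w K n)%C <= (Cmod w / eta) ^ K * (Cmod (a n) *
    (Cmod z0 + eta) ^ n)).
  { intros n. rewrite Cmod_mult. pose proof (shift_rem_bound z0 w eta n Hw K) as B.
    unfold Rdiv. rewrite Rpow_mult_distr, pow_inv.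
    apply (Rmult_le_reg_r (eta ^ K)); [exact P|].
    apply Rle_trans with (Cmod (a n) * (Cmod w ^ K * (Cmod z0 + eta) ^ n)); [|right; field; lra].
    rewrite Rmult_assoc. apply Rmult_le_compat_l; [apply Cmod_ge_0|exact B]. }
  assert (D3 : is_series (fun n => (Cmod w / eta) ^ K * (Cmod (a n) * (Cmod z0 + eta) ^ n)) ((Cmod
    w / eta) ^ K * M)).
  { exact (is_series_scal (V := R_NormedModule) _ _ _ HM). }
  assert (D4 : ex_series (fun n => Cmod (a n * shift_rem z0 w K n)%C)).
  { eapply ex_series_dom; [|eexists; apply D3]. intros n; split; [apply Cmod_ge_0|apply D2]. }
  eapply Rle_trans; [apply (is_Cseries_norm _ _ _ D1 (Series_correct _ D4))|].
  rewrite <- (is_series_unique _ _ D3). apply Series_le; [|eexists; apply D3].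
  intros n; split; [apply Cmod_ge_0|apply D2].
Qed.

Lemma recenter_is_Cpseries Rd a z0 w : disc_summable Rd a -> Cmod z0 + Cmod w < Rd ->
  is_Cpseries (recenter a z0) w (CPSeries a (z0 + w)).
Proof.
  intros H Hw. pose proof (Cmod_ge_0 w) as W. pose proof (Cmod_ge_0 z0) as Z.
  set (eta := (Cmod w + (Rd - Cmod z0)) / 2).
  assert (E1 : Cmod w < eta) by (unfold eta; lra). assert (E2 : Cmod z0 + eta < Rd) by (unfold eta;
    lra).
  destruct (recenter_bound Rd a z0 eta H ltac:(lra) E2) as [M [M0 HM]].
  apply is_Cseries_eps. intros eps He.
  destruct (geom_small (Cmod w / eta) M eps (ratio_lt_1 _ _ (conj W E1)) M0 He) as [N HN].
  exists N. intros n Hn. eapply Rle_lt_trans; [|apply (HN n Hn)].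
  rewrite <- Cmod_opp, Copp_minus_distr. apply HM. lra.
Qed.

Definition derive_coef (a : nat -> C) (n : nat) : C := (RtoC (INR (S n)) * a (S n))%C.

Lemma shift_binom_0 z0 n : shift_binom z0 n 0 = (z0 ^ n)%C.
Proof. induction n as [|n IH]; [reflexivity|]. cbn [shift_binom]. rewrite IH. simpl. ring. Qed.

Lemma shift_binom_1 z0 n : shift_binom z0 (S n) 1 = (RtoC (INR (S n)) * z0 ^ n)%C.
Proof.
  induction n as [|n IH]; [simpl; ring|].
  change (shift_binom z0 (S (S n)) 1) with (z0 * shift_binom z0 (S n) 1 + shift_binom z0 (S n) 0)%C.
  rewrite IH, shift_binom_0. rewrite (S_INR (S n)), RtoC_plus. simpl Cpow. ring.
Qed.

Lemma is_Cseries_shift_1 u l : is_Cseries (fun n => u (S n)) l -> u O = 0%C -> is_Cseries u l.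
Proof.
  intros H H0. apply (is_series_decr_1 (K := C_AbsRing) (V := C_NormedModule) u l).
  replace (@plus C_NormedModule l (@opp C_NormedModule (u O))) with l; [exact H|].
  rewrite H0. change (l = l + - 0)%C. ring.
Qed.

Lemma is_Cseries_incr_1 u l : is_Cseries u l -> is_Cseries (fun n => u (S n)) (l - u O)%C.
Proof.
  intros H. apply (is_series_incr_1 (K := C_AbsRing) (V := C_NormedModule) u).
  replace (@plus C_NormedModule (l - u O)%C (u O)) with l; [exact H|].
  change (l = l - u O + u O)%C. ring.
Qed.

Lemma disc_summable_derive_coef Rd a : disc_summable Rd a -> disc_summable Rd (derive_coef a).
Proof.
  intros H r Hr. set (eta := (Rd - r) / 2). assert (He : 0 < eta) by (unfold eta; lra).
  assert (Hs : ex_series (fun n => Cmod (a n) * (r + eta) ^ n)) by (apply H; unfold eta in *; lra).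
  apply ex_series_incr_1 in Hs.
  apply ex_series_dom with (fun n => / eta * (Cmod (a (S n)) * (r + eta) ^ (S n))).
  2: now apply (ex_series_scal (V := R_NormedModule)).
  intros n. split; [apply Rmult_le_pos; [apply Cmod_ge_0|apply pow_le; lra]|].
  unfold derive_coef. rewrite Cmod_mult, Cmod_R, Rabs_pos_eq by apply pos_INR.
  pose proof (shift_binom_bound r eta (S n) ltac:(lra) 1) as B. rewrite shift_binom_1 in B.
  rewrite Cmod_mult, Cmod_pow, !Cmod_R, (Rabs_pos_eq (INR _)), (Rabs_pos_eq r) in B by (try apply
    pos_INR; lra).
  rewrite pow_1 in B.
  apply (Rmult_le_reg_r eta); [exact He|].
  apply Rle_trans with (Cmod (a (S n)) * (r + eta) ^ S n); [|right; field; lra].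
  apply Rle_trans with (Cmod (a (S n)) * (INR (S n) * r ^ n * eta)); [right; ring|].
  apply Rmult_le_compat_l; [apply Cmod_ge_0|exact B].
Qed.

Lemma recenter_0 a z0 : recenter a z0 0 = CPSeries a z0.
Proof. unfold recenter, CPSeries, Cseries. f_equal; apply Series_ext; intros n;
  now rewrite shift_binom_0. Qed.

Lemma recenter_1 Rd a z0 : disc_summable Rd a -> Cmod z0 < Rd -> recenter a z0 1 = CPSeries
  (derive_coef a) z0.
Proof.
  intros H Hz. apply Cseries_unique. apply is_Cseries_shift_1; [|simpl; ring].
  eapply is_Cseries_ext; [|apply (CPSeries_correct Rd (derive_coef a) z0);
    auto using disc_summable_derive_coef].
  intros n. cbv beta. unfold derive_coef. rewrite shift_binom_1. ring.
Qed.

(** The case K = 2 of [recenter_bound] is a Taylor remainder of second order. *)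
Lemma CPSeries_derive Rd a z0 : disc_summable Rd a -> Cmod z0 < Rd ->
  @is_derive C_AbsRing C_NormedModule (CPSeries a) z0 (CPSeries (derive_coef a) z0).
Proof.
  intros H Hz. pose proof (Cmod_ge_0 z0) as Z.
  set (eta := (Rd - Cmod z0) / 2). assert (He : 0 < eta) by (unfold eta; lra).
  destruct (recenter_bound Rd a z0 eta H He ltac:(unfold eta in *; lra)) as [M [M0 HM]].
  split; [apply is_linear_scal_l|].
  intros x Hx.
  assert (x = z0) as -> by (symmetry; apply (is_filter_lim_locally_unique (V :=
    AbsRing_NormedModule C_AbsRing) z0 x Hx)).
  intros eps.
  set (d := Rmin eta (eps * eta ^ 2 / (M + 1))).
  assert (Hd : 0 < d).
  { apply Rmin_case; [exact He|]. apply Rdiv_lt_0_compat; [|lra]. apply Rmult_lt_0_compat;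
      [apply cond_pos|apply pow_lt; lra]. }
  assert (HY : forall y : C, Cmod (y - z0) < d ->
    Cmod (CPSeries a y - CPSeries a z0 - (y - z0) * CPSeries (derive_coef a) z0) <= eps * Cmod (y -
      z0)).
  2: { exists (mkposreal d Hd). exact HY. }
  intros y Hy.
  set (w := (y - z0)%C) in *.
  assert (W := Cmod_ge_0 w).
  assert (Hw1 : Cmod w <= eta) by (eapply Rle_trans; [left; exact Hy|apply Rmin_l]).
  specialize (HM w 2%nat Hw1).
  replace (z0 + w)%C with y in HM by (unfold w; ring).
  cbn [Csum] in HM. rewrite recenter_0, (recenter_1 Rd) in HM by auto.
  replace (CPSeries a y - CPSeries a z0 - w * CPSeries (derive_coef a) z0)%C with
    (CPSeries a y - (0 + CPSeries a z0 * w ^ 0 + CPSeries (derive_coef a) z0 * w ^ 1))%C by (simpl;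
      ring).
  eapply Rle_trans; [exact HM|].
  assert (Hw2 : Cmod w <= eps * eta ^ 2 / (M + 1)) by (eapply Rle_trans; [left;
    exact Hy|apply Rmin_r]).
  assert (K : Cmod w * (M + 1) <= eps * eta ^ 2).
  { apply (Rmult_le_compat_r (M + 1)) in Hw2; [|lra]. unfold Rdiv in Hw2.
      rewrite Rmult_assoc, Rinv_l in Hw2; lra. }
  assert (P : 0 < eta ^ 2) by (apply pow_lt; lra).
  apply (Rmult_le_reg_r (eta ^ 2)); [exact P|].
  replace ((Cmod w / eta) ^ 2 * M * eta ^ 2) with (Cmod w * (Cmod w * M)) by (field; lra).
  nra.
Qed.

Lemma CPSeries_analytic Rd a z0 : disc_summable Rd a -> Cmod z0 < Rd -> analytic_at (CPSeries a) z0.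
Proof.
  intros H Hz. exists (recenter a z0). apply locally_C.
  exists (mkposreal (Rd - Cmod z0) ltac:(lra)). intros y Hy.
  change (Cmod (y - z0) < Rd - Cmod z0) in Hy.
  apply is_pseries_Cpseries.
  replace y with (z0 + (y - z0))%C at 2 by ring. apply (recenter_is_Cpseries Rd); auto. lra.
Qed.

(** * Complex derivatives along real curves *)

(** Fixes the normed structures in the complex derivative. *)
Definition is_Cderive (f : C -> C) (z l : C) : Prop := @is_derive C_AbsRing C_NormedModule f z l.

Lemma is_Cderive_eps f z l : is_Cderive f z l <-> forall eps, 0 < eps -> exists d, 0 < d /\ forall
  y, Cmod (y - z) < d ->
  Cmod (f y - f z - (y - z) * l) <= eps * Cmod (y - z).
Proof.
  split.
  - intros [_ H] eps He.
    destruct (H z (fun P HP => HP) (mkposreal eps He)) as [d Hd].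
    exists d. split; [apply cond_pos|]. exact Hd.
  - intros H. split; [apply is_linear_scal_l|].
    intros x Hx.
    assert (x = z) as -> by (symmetry; apply (is_filter_lim_locally_unique (V :=
      AbsRing_NormedModule C_AbsRing) z x Hx)).
    intros eps. destruct (H eps (cond_pos eps)) as [d [Hd HH]].
    exists (mkposreal d Hd). exact HH.
Qed.

Lemma is_derive_eps f z l : @is_derive R_AbsRing R_NormedModule f z l <-> forall eps, 0 < eps ->
  exists d, 0 < d /\ forall y, Rabs (y - z) < d ->
  Rabs (f y - f z - (y - z) * l) <= eps * Rabs (y - z).
Proof.
  split.
  - intros [_ H] eps He.
    destruct (H z (fun P HP => HP) (mkposreal eps He)) as [d Hd].
    exists d. split; [apply cond_pos|]. exact Hd.
  - intros H. split; [apply is_linear_scal_l|].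
    intros x Hx.
    assert (x = z) as -> by (symmetry; apply (is_filter_lim_locally_unique (V := R_NormedModule) z
      x Hx)).
    intros eps. destruct (H eps (cond_pos eps)) as [d [Hd HH]].
    exists (mkposreal d Hd). exact HH.
Qed.

(** Links complex derivatives with the horizontal limit [C_derive]. *)
Lemma is_Cderive_unique f z l : is_Cderive f z l -> C_derive f z = l.
Proof. apply is_C_derive_unique. Qed.

Lemma is_Cderive_ext_loc f g z l d : 0 < d -> (forall y, Cmod (y - z) < d -> f y = g y) ->
  is_Cderive f z l -> is_Cderive g z l.
Proof.
  intros Hd H. apply is_derive_ext_loc. exists (mkposreal d Hd). exact H.
Qed.

(** Derivative of a curve in the plane, by components. *)
Definition is_curve_derive (g : R -> C) (t : R) (l : C) : Prop :=
  is_derive (fun s => Re (g s)) t (Re l) /\ is_derive (fun s => Im (g s)) t (Im l).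

Lemma is_curve_derive_chain f g t f' l : is_Cderive f (g t) f' -> is_curve_derive g t l ->
  is_curve_derive (fun s => f (g s)) t (f' * l)%C.
Proof.
  intros Hf [H1 H2]. rewrite is_Cderive_eps in Hf. rewrite is_derive_eps in H1, H2.
  assert (K : forall eps, 0 < eps -> exists d, 0 < d /\ forall y, Rabs (y - t) < d ->
     Cmod (f (g y) - f (g t) - RtoC (y - t) * (f' * l)) <= eps * Rabs (y - t)).
  { intros eps He.
    pose proof (Cmod_ge_0 l) as L0. pose proof (Cmod_ge_0 f') as F0.
    set (e1 := eps / (2 * (Cmod l + 1))).
    set (e2 := Rmin 1 (eps / (2 * (Cmod f' + 1)))).
    assert (E1 : 0 < e1) by (apply Rdiv_lt_0_compat; lra).
    assert (E2 : 0 < e2) by (apply Rmin_case; [lra|apply Rdiv_lt_0_compat; lra]).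
    destruct (Hf e1 E1) as [d1 [D1 Hd1]].
    destruct (H1 (e2 / 2)) as [d2 [D2 Hd2]]; [lra|].
    destruct (H2 (e2 / 2)) as [d3 [D3 Hd3]]; [lra|].
    exists (Rmin (Rmin d2 d3) (d1 / (Cmod l + 1))). split.
    { repeat apply Rmin_case; auto. apply Rdiv_lt_0_compat; lra. }
    intros y Hy.
    assert (Y2 : Rabs (y - t) < d2) by (eapply Rlt_le_trans; [exact Hy|eapply Rle_trans;
      [apply Rmin_l|apply Rmin_l]]).
    assert (Y3 : Rabs (y - t) < d3) by (eapply Rlt_le_trans; [exact Hy|eapply Rle_trans;
      [apply Rmin_l|apply Rmin_r]]).
    assert (Y1 : Rabs (y - t) < d1 / (Cmod l + 1)) by (eapply Rlt_le_trans;
      [exact Hy|apply Rmin_r]).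
    specialize (Hd2 y Y2). specialize (Hd3 y Y3).
    pose proof (Rabs_pos (y - t)) as P.
    assert (G : Cmod (g y - g t - RtoC (y - t) * l) <= e2 * Rabs (y - t)).
    { eapply Rle_trans; [apply Cmod_le_ReIm|].
      replace (Re (g y - g t - RtoC (y - t) * l)) with (Re (g y) - Re (g t) - (y - t) * Re l)
        by (unfold Re, Cminus, Cplus, Copp, Cmult, RtoC; simpl; ring).
      replace (Im (g y - g t - RtoC (y - t) * l)) with (Im (g y) - Im (g t) - (y - t) * Im l)
        by (unfold Re, Im, Cminus, Cplus, Copp, Cmult, RtoC; simpl; ring).
      lra. }
    assert (G2 : Cmod (g y - g t) <= (Cmod l + 1) * Rabs (y - t)).
    { replace (g y - g t)%C with ((g y - g t - RtoC (y - t) * l) + RtoC (y - t) * l)%C by ring.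
      eapply Rle_trans; [apply Cmod_triangle|]. rewrite Cmod_mult, Cmod_R.
      assert (e2 <= 1) by apply Rmin_l. nra. }
    assert (G3 : Cmod (g y - g t) < d1).
    { eapply Rle_lt_trans; [exact G2|]. apply (Rmult_lt_compat_l (Cmod l + 1)) in Y1; [|lra].
      unfold Rdiv in Y1. replace ((Cmod l + 1) * (d1 * / (Cmod l + 1))) with d1 in Y1 by (field;
        lra). exact Y1. }
    specialize (Hd1 _ G3).
    replace (f (g y) - f (g t) - RtoC (y - t) * (f' * l))%C with
      ((f (g y) - f (g t) - (g y - g t) * f') + f' * (g y - g t - RtoC (y - t) * l))%C by ring.
    eapply Rle_trans; [apply Cmod_triangle|]. rewrite Cmod_mult.
    assert (A1 : e1 * Cmod (g y - g t) <= eps / 2 * Rabs (y - t)).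
    { apply Rle_trans with (e1 * ((Cmod l + 1) * Rabs (y - t))); [apply Rmult_le_compat_l; lra|].
      right. unfold e1. field. lra. }
    assert (A2 : Cmod f' * (e2 * Rabs (y - t)) <= eps / 2 * Rabs (y - t)).
    { rewrite <- Rmult_assoc. apply Rmult_le_compat_r; [exact P|].
      assert (e2 <= eps / (2 * (Cmod f' + 1))) by apply Rmin_r.
      apply Rle_trans with (Cmod f' * (eps / (2 * (Cmod f' + 1)))); [apply Rmult_le_compat_l;
        auto|].
      apply Rle_trans with ((Cmod f' + 1) * (eps / (2 * (Cmod f' + 1)))).
      - apply Rmult_le_compat_r; [|lra]. left. apply Rdiv_lt_0_compat; lra.
      - right. field. lra. }
    assert (A3 := Rmult_le_compat_l _ _ _ F0 G). lra. }
  split; apply is_derive_eps; intros eps He; destruct (K eps He) as [d [Hd HH]]; exists d; split;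
    auto;
    intros y Hy; eapply Rle_trans; [|exact (HH y Hy)| |exact (HH y Hy)].
  - eapply Rle_trans; [|apply re_le_Cmod]. right. f_equal.
    unfold Re, Im, Cminus, Cplus, Copp, Cmult, RtoC; simpl; ring.
  - eapply Rle_trans; [|apply im_le_Cmod]. right. f_equal.
    unfold Re, Im, Cminus, Cplus, Copp, Cmult, RtoC; simpl; ring.
Qed.

(** Continuity by components, for maps from any uniform space; with a product as source it is the
    joint continuity needed for differentiation under the integral sign. *)
Definition C_cont {U : UniformSpace} (g : U -> C) (x : U) : Prop :=
  continuous (fun y => Re (g y)) x /\ continuous (fun y => Im (g y)) x.

Section ComplexContinuity.
Context {U : UniformSpace}.
Implicit Types g h : U -> C.
Lemma C_cont_const (c : C) x : C_cont (fun _ : U => c) x.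
Proof. split; apply continuous_const. Qed.

Lemma C_cont_plus g h x : C_cont g x -> C_cont h x -> C_cont (fun y => g y + h y)%C x.
Proof. intros [A1 A2] [B1 B2]; split; [exact (continuous_plus (V := R_NormedModule) _ _ x A1
  B1)|exact (continuous_plus (V := R_NormedModule) _ _ x A2 B2)]. Qed.

Lemma C_cont_minus g h x : C_cont g x -> C_cont h x -> C_cont (fun y => g y - h y)%C x.
Proof. intros [A1 A2] [B1 B2]; split; [exact (continuous_minus (V := R_NormedModule) _ _ x A1
  B1)|exact (continuous_minus (V := R_NormedModule) _ _ x A2 B2)]. Qed.

Lemma C_cont_mult g h x : C_cont g x -> C_cont h x -> C_cont (fun y => g y * h y)%C x.
Proof.
  intros [A1 A2] [B1 B2]; split.
  - exact (continuous_minus (V := R_NormedModule) _ _ x (continuous_mult (K := R_AbsRing) _ _ x A1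
      B1) (continuous_mult (K := R_AbsRing) _ _ x A2 B2)).
  - exact (continuous_plus (V := R_NormedModule) _ _ x (continuous_mult (K := R_AbsRing) _ _ x A1
      B2) (continuous_mult (K := R_AbsRing) _ _ x A2 B1)).
Qed.

Lemma C_cont_inv g x : C_cont g x -> g x <> 0%C -> C_cont (fun y => / g y)%C x.
Proof.
  intros [A1 A2] H.
  assert (N : Re (g x) ^ 2 + Im (g x) ^ 2 <> 0).
  { rewrite <- Cmod2_alt. apply Cmod_gt_0 in H. apply pow_nonzero. lra. }
  assert (M1 : continuous (fun y => Re (g y) ^ 2 + Im (g y) ^ 2) x).
  { assert (Sq : forall k : U -> R, continuous k x -> continuous (fun y => k y ^ 2) x).
    { intros k Hk. exact (continuous_mult (K := R_AbsRing) k (fun y => k y * 1) x Hk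
        (continuous_mult (K := R_AbsRing) k (fun _ => 1) x Hk (continuous_const 1 x))). }
    exact (continuous_plus (V := R_NormedModule) _ _ x (Sq _ A1) (Sq _ A2)). }
  assert (M2 : continuous (fun y => / (Re (g y) ^ 2 + Im (g y) ^ 2)) x).
  { apply (continuous_comp (fun y => Re (g y) ^ 2 + Im (g y) ^ 2) Rinv x M1).
      apply continuous_Rinv. exact N. }
  split.
  - exact (continuous_mult (K := R_AbsRing) _ _ x A1 M2).
  - exact (continuous_mult (K := R_AbsRing) _ _ x (continuous_opp (V := R_NormedModule) _ x A2) M2).
Qed.

Lemma C_cont_RtoC (g : U -> R) x : continuous g x -> C_cont (fun y => RtoC (g y)) x.
Proof. intros H; split; [exact H|apply continuous_const]. Qed.

Lemma C_cont_comp (f : C -> C) g x : C_cont (U := C_UniformSpace) f (g x) -> C_cont g x -> C_cont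
  (fun y => f (g y)) x.
Proof.
  intros [F1 F2] [A1 A2].
  assert (E : forall y, g y = (Re (g y), Im (g y))) by (intros y; destruct (g y); reflexivity).
  rewrite E in F1, F2.
  split.
  - apply (continuous_ext (fun y => Re (f (Re (g y), Im (g y))))); [intros y; now rewrite <- E|].
    apply (continuous_comp_2 (fun y => Re (g y)) (fun y => Im (g y)) (fun a b => Re (f (a, b))));
      auto.
    eapply (continuous_ext (fun p : C => Re (f p))); [|exact F1]. intros [a b]; reflexivity.
  - apply (continuous_ext (fun y => Im (f (Re (g y), Im (g y))))); [intros y; now rewrite <- E|].
    apply (continuous_comp_2 (fun y => Re (g y)) (fun y => Im (g y)) (fun a b => Im (f (a, b))));
      auto.
    eapply (continuous_ext (fun p : C => Im (f p))); [|exact F2]. intros [a b]; reflexivity.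
Qed.

End ComplexContinuity.

Lemma C_cont_eps (f : C -> C) z :
  (forall eps, 0 < eps -> exists d, 0 < d /\ forall y, Cmod (y - z) < d -> Cmod (f y - f z) < eps)
    ->
  C_cont (U := C_UniformSpace) f z.
Proof.
  intros H; split; apply (filterlim_locally (U := R_UniformSpace)); intros eps;
    destruct (H eps (cond_pos eps)) as [d [Hd HH]]; apply locally_C; exists (mkposreal d Hd);
    intros y Hy; eapply Rle_lt_trans; [|exact (HH y Hy)| |exact (HH y Hy)].
  - apply (re_le_Cmod (f y - f z)%C).
  - apply (im_le_Cmod (f y - f z)%C).
Qed.

Lemma is_Cderive_cont f z l : is_Cderive f z l -> C_cont (U := C_UniformSpace) f z.
Proof.
  rewrite is_Cderive_eps. intros H. apply C_cont_eps. intros eps He.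
  destruct (H 1 ltac:(lra)) as [d [Hd HH]]. pose proof (Cmod_ge_0 l) as L.
  exists (Rmin d (eps / (Cmod l + 2))). split; [apply Rmin_case; auto; apply Rdiv_lt_0_compat;
    lra|].
  intros y Hy.
  assert (Y1 : Cmod (y - z) < d) by (eapply Rlt_le_trans; [exact Hy|apply Rmin_l]).
  assert (Y2 : Cmod (y - z) < eps / (Cmod l + 2)) by (eapply Rlt_le_trans; [exact Hy|apply Rmin_r]).
  specialize (HH y Y1).
  apply (Rmult_lt_compat_r (Cmod l + 2)) in Y2; [|lra].
  unfold Rdiv in Y2. rewrite Rmult_assoc, Rinv_l in Y2 by lra.
  replace (f y - f z)%C with ((f y - f z - (y - z) * l) + (y - z) * l)%C by ring.
  eapply Rle_lt_trans; [apply Cmod_triangle|]. rewrite Cmod_mult.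
  pose proof (Cmod_ge_0 (y - z)). nra.
Qed.

(** Comparison with a geometric series: terms bounded at one radius are summable at every smaller
    one. *)
Lemma geom_summable (a : nat -> C) x r : 0 <= r < x -> (exists M, forall n, Cmod (a n) * x ^ n <=
  M) ->
  ex_series (fun n => Cmod (a n) * r ^ n).
Proof.
  intros Hr [M HM].
  apply ex_series_dom with (fun n => M * (r / x) ^ n).
  - intros n. split; [apply Rmult_le_pos; [apply Cmod_ge_0|apply pow_le; lra]|].
    unfold Rdiv. rewrite Rpow_mult_distr, pow_inv.
    assert (P : 0 < x ^ n) by (apply pow_lt; lra). assert (Q : 0 <= r ^ n) by (apply pow_le; lra).
    apply Rle_trans with (Cmod (a n) * x ^ n * (r ^ n * / x ^ n)); [right; field; lra|].
    apply Rmult_le_compat_r; [|apply HM]. apply Rmult_le_pos; [exact Q|]. left.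
      now apply Rinv_0_lt_compat.
  - apply (ex_series_scal (V := R_NormedModule)). apply ex_series_geom.
    destruct (ratio_lt_1 r x Hr). rewrite Rabs_pos_eq; lra.
Qed.

Lemma is_Cseries_bounded u l : is_Cseries u l -> exists M, forall n, Cmod (u n) <= M.
Proof.
  intros H. rewrite is_Cseries_eps in H. destruct (H 1 ltac:(lra)) as [N HN].
  assert (B : forall K, exists M, forall n, (n < K)%nat -> Cmod (u n) <= M).
  { induction K as [|K [M HM]]; [exists 0; intros; lia|].
    exists (Rmax M (Cmod (u K))). intros n Hn. destruct (Nat.eq_dec n K) as [->|]; [apply Rmax_r|].
    eapply Rle_trans; [apply HM; lia|apply Rmax_l]. }
  destruct (B N) as [M HM]. exists (Rmax M 2). intros n.
  destruct (Nat.lt_ge_cases n N) as [L|L]; [eapply Rle_trans; [apply HM; auto|apply Rmax_l]|].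
  pose proof (HN n L) as H1. pose proof (HN (S n) ltac:(lia)) as H2. simpl in H2.
  replace (u n) with ((Csum u n + u n - l) + - (Csum u n - l))%C by ring.
  eapply Rle_trans; [apply Cmod_triangle|]. rewrite Cmod_opp.
  apply Rle_trans with 2; [lra|apply Rmax_r].
Qed.

Lemma is_Cpseries_disc_summable Rd a : (forall r, 0 <= r < Rd -> exists l, is_Cpseries a (RtoC r)
  l) -> disc_summable Rd a.
Proof.
  intros H r Hr. destruct (H ((r + Rd) / 2)) as [l Hl]; [lra|].
  apply (geom_summable a ((r + Rd) / 2)); [lra|].
  destruct (is_Cseries_bounded _ _ Hl) as [M HM]. exists M. intros n. specialize (HM n).
  rewrite Cmod_mult, Cmod_pow, Cmod_R, Rabs_pos_eq in HM by lra. exact HM.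
Qed.

Lemma analytic_local f z : analytic_at f z ->
  exists d a, 0 < d /\ disc_summable d a /\ forall y, Cmod (y - z) < d -> f y = CPSeries a (y -
    z)%C.
Proof.
  intros [a H]. apply locally_C in H. destruct H as [d Hd]. exists d, a. split; [apply cond_pos|].
  assert (HH : forall y : C, Cmod (y - z) < d -> is_Cpseries a (y - z)%C (f y)).
  { intros y Hy. exact (proj1 (is_pseries_Cpseries _ _ _) (Hd y Hy)). }
  split.
  - apply is_Cpseries_disc_summable. intros r Hr. exists (f (z + r)%C).
    replace (RtoC r) with (z + r - z)%C at 1 by ring. apply HH.
    replace (z + r - z)%C with (RtoC r) by ring. rewrite Cmod_R, Rabs_pos_eq; lra.
  - intros y Hy. symmetry. apply Cseries_unique. apply (HH y Hy).
Qed.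

Lemma is_Cderive_shift f z0 y l : is_Cderive f (y - z0)%C l -> is_Cderive (fun x => f (x - z0)%C) y
  l.
Proof.
  rewrite !is_Cderive_eps. intros H eps He. destruct (H eps He) as [d [Hd HH]]. exists d. split;
    auto.
  intros x Hx. specialize (HH (x - z0)%C). replace (x - z0 - (y - z0))%C with (x - y)%C in HH by
    ring. auto.
Qed.

Definition analytic_disc (f : C -> C) := forall z, Cmod z < 1 -> analytic_at f z.

(** Near each point both the function and its derivative are power series; this makes [C_derive]
    of an analytic function continuous, in fact differentiable. *)
Lemma analytic_derive_local f z : analytic_at f z ->
  exists d a, 0 < d /\ disc_summable d a /\ (forall y, Cmod (y - z) < d -> f y = CPSeries a (y -
    z)%C) /\
    forall y, Cmod (y - z) < d -> is_Cderive f y (CPSeries (derive_coef a) (y - z)%C).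
Proof.
  intros H. destruct (analytic_local f z H) as [d [a [Hd [Ha Hf]]]]. exists d, a. split;
    [auto|split; [auto|split; [auto|]]]. intros y Hy.
  apply is_Cderive_ext_loc with (fun x => CPSeries a (x - z)%C) (d - Cmod (y - z)); [lra| |].
  - intros x Hx. symmetry. apply Hf. replace (x - z)%C with ((x - y) + (y - z))%C by ring.
    eapply Rle_lt_trans; [apply Cmod_triangle|lra].
  - apply is_Cderive_shift. apply (CPSeries_derive d); auto.
Qed.

Lemma analytic_is_Cderive f z : analytic_at f z -> is_Cderive f z (C_derive f z).
Proof.
  intros H. destruct (analytic_derive_local f z H) as [d [a [Hd [Ha [Hf Hf']]]]].
  assert (Hz : Cmod (z - z) < d) by (replace (z - z)%C with (RtoC 0) by ring; rewrite Cmod_0; auto).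
  specialize (Hf' z Hz). rewrite (is_Cderive_unique _ _ _ Hf'). exact Hf'.
Qed.

Lemma analytic_C_derive_cont f z : analytic_at f z -> C_cont (U := C_UniformSpace) (C_derive f) z.
Proof.
  intros H. destruct (analytic_derive_local f z H) as [d [a [Hd [Ha [Hf Hf']]]]].
  assert (Hz : Cmod (z - z) < d) by (replace (z - z)%C with (RtoC 0) by ring; rewrite Cmod_0; auto).
  apply (is_Cderive_cont _ _ (CPSeries (derive_coef (derive_coef a)) (z - z)%C)).
  apply is_Cderive_ext_loc with (fun x => CPSeries (derive_coef a) (x - z)%C) d; [auto| |].
  - intros y Hy. symmetry. apply is_Cderive_unique. auto.
  - apply is_Cderive_shift. apply (CPSeries_derive d); auto using disc_summable_derive_coef.
Qed.

(** * Cauchy's formula on a circle *)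

Lemma is_curve_derive_const (c : C) t : is_curve_derive (fun _ => c) t 0%C.
Proof. split; apply (is_derive_const (K := R_AbsRing) (V := R_NormedModule)). Qed.

Lemma is_curve_derive_plus g h t a b : is_curve_derive g t a -> is_curve_derive h t b ->
  is_curve_derive (fun s => g s + h s)%C t (a + b)%C.
Proof.
  intros [A1 A2] [B1 B2]; split.
  - exact (is_derive_plus (V := R_NormedModule) _ _ _ _ _ A1 B1).
  - exact (is_derive_plus (V := R_NormedModule) _ _ _ _ _ A2 B2).
Qed.

Lemma is_Cderive_scal k z : is_Cderive (fun x => k * x)%C z k.
Proof.
  apply is_Cderive_eps. intros eps He. exists 1. split; [lra|]. intros y Hy.
  replace (k * y - k * z - (y - z) * k)%C with (RtoC 0) by ring. rewrite Cmod_0.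
  apply Rmult_le_pos; [lra|apply Cmod_ge_0].
Qed.

Lemma is_curve_derive_scal k g t a : is_curve_derive g t a -> is_curve_derive (fun s => k * g s)%C
  t (k * a)%C.
Proof. intros H. apply (is_curve_derive_chain (fun x => k * x)%C g t k a); auto.
  apply is_Cderive_scal. Qed.

Lemma is_curve_derive_ext g t a b : a = b -> is_curve_derive g t a -> is_curve_derive g t b.
Proof. now intros ->. Qed.

Lemma is_curve_derive_cis t : is_curve_derive cis t (Ci * cis t)%C.
Proof.
  split; unfold Ci, cis, Cmult, Re, Im; simpl; auto_derive; auto; ring.
Qed.

Lemma is_curve_derive_cont g t l : is_curve_derive g t l -> C_cont g t.
Proof.
  intros [H1 H2]; split; apply (ex_derive_continuous (K := R_AbsRing) (V := R_NormedModule));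
    eexists; eauto.
Qed.

Lemma Cmod_cis t : Cmod (cis t) = 1.
Proof.
  unfold Cmod, cis; simpl fst; simpl snd. replace (cos t ^ 2 + sin t ^ 2) with 1; [apply sqrt_1|].
  pose proof (sin2_cos2 t). unfold Rsqr in *. simpl. lra.
Qed.

Lemma cis_plus a b : cis (a + b) = (cis a * cis b)%C.
Proof. unfold cis, Cmult; simpl. rewrite cos_plus, sin_plus. f_equal; ring. Qed.

Lemma cis_2PI : cis (2 * PI) = 1%C.
Proof. unfold cis. now rewrite cos_2PI, sin_2PI. Qed.

Lemma cis_0 : cis 0 = 1%C.
Proof. unfold cis. now rewrite cos_0, sin_0. Qed.

Lemma cis_neq0 t : cis t <> 0%C.
Proof. intro H. pose proof (Cmod_cis t) as K. rewrite H, Cmod_0 in K. lra. Qed.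

Definition circle (r t : R) : C := (RtoC r * cis t)%C.
Lemma is_curve_derive_circle r t : is_curve_derive (circle r) t (Ci * circle r t)%C.
Proof. eapply is_curve_derive_ext; [|apply (is_curve_derive_scal (RtoC r) cis t _
  (is_curve_derive_cis t))]. unfold circle. ring. Qed.

Lemma Cmod_circle r t : 0 <= r -> Cmod (circle r t) = r.
Proof. intros H. unfold circle. rewrite Cmod_mult, Cmod_cis, Cmod_R, Rabs_pos_eq; lra. Qed.

Lemma circle_2PI r : circle r (2 * PI) = circle r 0.
Proof. unfold circle. now rewrite cis_2PI, cis_0. Qed.

Lemma two_PI_pos : 0 < 2 * PI.
Proof. pose proof PI_RGT_0. lra. Qed.

(** Integral over [0, 2 pi] of a complex curve, by components. *)
Definition period_int (g : R -> C) : C := (RInt (fun t => Re (g t)) 0 (2 * PI), RInt (fun t => Im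
  (g t)) 0 (2 * PI)).
Definition cont_curve (g : R -> C) := forall t, C_cont (U := R_UniformSpace) g t.

Lemma cont_curve_ex g : cont_curve g -> ex_RInt (fun t => Re (g t)) 0 (2 * PI) /\ ex_RInt (fun t =>
  Im (g t)) 0 (2 * PI).
Proof.
  intros H; split; apply (ex_RInt_continuous (V := R_CompleteNormedModule)); intros t _;
    [exact (proj1 (H t))|exact (proj2 (H t))].
Qed.

Lemma period_int_plus g h : cont_curve g -> cont_curve h -> period_int (fun t => g t + h t)%C =
  (period_int g + period_int h)%C.
Proof.
  intros Hg Hh. destruct (cont_curve_ex g Hg), (cont_curve_ex h Hh). unfold period_int, Cplus;
    simpl. f_equal.
  - now apply (RInt_plus (V := R_CompleteNormedModule)).
  - now apply (RInt_plus (V := R_CompleteNormedModule)).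
Qed.

Lemma period_int_scal c g : cont_curve g -> period_int (fun t => c * g t)%C = (c * period_int g)%C.
Proof.
  intros Hg. destruct (cont_curve_ex g Hg) as [E1 E2]. unfold period_int, Cmult; simpl. f_equal.
  - change (RInt (fun t => Re c * Re (g t) - Im c * Im (g t)) 0 (2 * PI) =
      Re c * RInt (fun t => Re (g t)) 0 (2 * PI) - Im c * RInt (fun t => Im (g t)) 0 (2 * PI)).
    apply is_RInt_unique.
    apply (is_RInt_minus (V := R_NormedModule)); apply (is_RInt_scal (V := R_NormedModule));
      apply (RInt_correct (V := R_CompleteNormedModule)); auto.
  - change (RInt (fun t => Re c * Im (g t) + Im c * Re (g t)) 0 (2 * PI) =
      Re c * RInt (fun t => Im (g t)) 0 (2 * PI) + Im c * RInt (fun t => Re (g t)) 0 (2 * PI)).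
    apply is_RInt_unique.
    apply (is_RInt_plus (V := R_NormedModule)); apply (is_RInt_scal (V := R_NormedModule));
      apply (RInt_correct (V := R_CompleteNormedModule)); auto.
Qed.

Lemma period_int_ext g h : (forall t, g t = h t) -> period_int g = period_int h.
Proof. intros H. unfold period_int. f_equal; apply RInt_ext; intros; now rewrite H. Qed.

Lemma period_int_const c : period_int (fun _ => c) = (RtoC (2 * PI) * c)%C.
Proof.
  unfold period_int, Cmult, RtoC. rewrite !RInt_const. destruct c as [a b]. unfold Re, Im, scal;
    simpl. unfold mult; simpl.
  f_equal; ring.
Qed.

Lemma period_int_bound g M : cont_curve g -> (forall t, 0 <= t <= 2 * PI -> Cmod (g t) <= M) ->
  Cmod (period_int g) <= 4 * PI * M.
Proof.
  intros Hg HM. destruct (cont_curve_ex g Hg) as [E1 E2]. pose proof two_PI_pos.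
  eapply Rle_trans; [apply Cmod_le_ReIm|].
  assert (A1 : Rabs (Re (period_int g)) <= (2 * PI - 0) * M).
  { apply abs_RInt_le_const; [lra|exact E1|]. intros t Ht. eapply Rle_trans;
      [apply re_le_Cmod|now apply HM]. }
  assert (A2 : Rabs (Im (period_int g)) <= (2 * PI - 0) * M).
  { apply abs_RInt_le_const; [lra|exact E2|]. intros t Ht. eapply Rle_trans;
      [apply im_le_Cmod|now apply HM]. }
  lra.
Qed.

(** The integral of the derivative of a curve with equal end values vanishes. *)
Lemma period_int_periodic g g' : (forall t, is_curve_derive g t (g' t)) -> cont_curve g' -> g (2 *
  PI) = g 0 -> period_int g' = 0%C.
Proof.
  intros H Hc Hp. unfold period_int. change (RtoC 0) with (0, 0). f_equal.
  - replace 0 with (Re (g (2 * PI)) - Re (g 0)) at 2 by (rewrite Hp; ring).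
    apply is_RInt_unique. apply (is_RInt_derive (V := R_CompleteNormedModule) (fun t => Re (g t))
      (fun t => Re (g' t))); intros t _;
      [exact (proj1 (H t))|exact (proj1 (Hc t))].
  - replace 0 with (Im (g (2 * PI)) - Im (g 0)) at 2 by (rewrite Hp; ring).
    apply is_RInt_unique. apply (is_RInt_derive (V := R_CompleteNormedModule) (fun t => Im (g t))
      (fun t => Im (g' t))); intros t _;
      [exact (proj2 (H t))|exact (proj2 (Hc t))].
Qed.

Section Cauchy.
Variables (f : C -> C) (r : R) (z : C).
Hypothesis Hf : analytic_disc f.
Hypothesis Hr : 0 < r < 1.
Hypothesis Hz : Cmod z < r.

(** The circle is contracted to z: gam 0 is constant and gam 1 is the circle. *)
Let gam (s t : R) : C := (z + s * (circle r t - z))%C.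
Let W (t : R) : C := (circle r t / (circle r t - z))%C.
(** How far s may leave [0,1] while gam s stays in the unit disc: (1 + 2 eta) r < 1. *)
Let eta := (1 - r) / 4.

Lemma circle_minus t : (circle r t - z)%C <> 0%C.
Proof.
  intro H. assert (circle r t = z) by (replace (circle r t) with (circle r t - z + z)%C by ring;
    rewrite H; ring).
  pose proof (Cmod_circle r t). rewrite H0 in H1. lra.
Qed.

Lemma cont_curve_W : cont_curve W.
Proof.
  intros t. apply C_cont_mult; [exact (is_curve_derive_cont _ _ _ (is_curve_derive_circle r t))|].
  apply C_cont_inv; [|apply circle_minus]. apply C_cont_minus;
    [exact (is_curve_derive_cont _ _ _ (is_curve_derive_circle r t))|apply C_cont_const].
Qed.

Lemma gam_in_disc s t : - eta < s < 1 + eta -> Cmod (gam s t) < 1.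
Proof.
  intros Hs. unfold gam.
  replace (z + s * (circle r t - z))%C with (RtoC (1 - s) * z + RtoC s * circle r t)%C by (rewrite
    RtoC_minus; ring).
  eapply Rle_lt_trans; [apply Cmod_triangle|]. rewrite !Cmod_mult, !Cmod_R, Cmod_circle by lra.
  pose proof (Cmod_ge_0 z).
  apply Rle_lt_trans with (Rabs (1 - s) * r + Rabs s * r).
  { apply Rplus_le_compat_r. apply Rmult_le_compat_l; [apply Rabs_pos|lra]. }
  rewrite <- Rmult_plus_distr_r.
  apply Rle_lt_trans with ((1 + 2 * eta) * r).
  { assert (0 < eta) by (unfold eta; lra). apply Rmult_le_compat_r; [lra|]. unfold Rabs.
      destruct (Rcase_abs (1 - s)), (Rcase_abs s); lra. }
  unfold eta. nra.
Qed.

Lemma gam_ds s t : is_curve_derive (fun s => gam s t) s (circle r t - z)%C.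
Proof.
  unfold gam. generalize (circle r t - z)%C. intros [a b]. destruct z as [x y].
  split; unfold Re, Im, Cplus, Cmult, RtoC; simpl; auto_derive; auto; ring.
Qed.

Lemma gam_dt s t : is_curve_derive (gam s) t (s * (Ci * circle r t))%C.
Proof.
  eapply is_curve_derive_ext; [|apply is_curve_derive_plus;
    [apply is_curve_derive_const|apply is_curve_derive_scal; apply is_curve_derive_plus;
    [apply is_curve_derive_circle|apply is_curve_derive_const]]].
  ring.
Qed.

Lemma gam_2PI s : gam s (2 * PI) = gam s 0.
Proof. unfold gam. now rewrite circle_2PI. Qed.

Lemma gam_cont (s t : R) : C_cont (U := prod_UniformSpace R_UniformSpace R_UniformSpace) (fun p =>
  gam (fst p) (snd p)) (s, t).
Proof.
  apply C_cont_plus; [apply C_cont_const|]. apply C_cont_mult.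
  - apply (C_cont_RtoC (U := prod_UniformSpace R_UniformSpace R_UniformSpace) (fun p => fst p)).
      apply continuous_fst.
  - apply C_cont_minus; [|apply C_cont_const]. 
    destruct (is_curve_derive_cont _ _ _ (is_curve_derive_circle r t)) as [A1 A2]. split.
    + apply (continuous_comp (U := prod_UniformSpace R_UniformSpace R_UniformSpace) snd (fun x =>
        Re (circle r x))); [apply continuous_snd|exact A1].
    + apply (continuous_comp (U := prod_UniformSpace R_UniformSpace R_UniformSpace) snd (fun x =>
        Im (circle r x))); [apply continuous_snd|exact A2].
Qed.

(** The s-derivative of c W (f o gam s): the factor circle - z produced by the chain rule cancels
    the denominator of W. *)
Let dU (c : C) (s t : R) : C := (c * (circle r t * C_derive f (gam s t)))%C.

Lemma homotopy_ds c s t : - eta < s < 1 + eta ->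
  is_curve_derive (fun s => c * W t * f (gam s t))%C s (dU c s t).
Proof.
  intros Hs. eapply is_curve_derive_ext; [|apply is_curve_derive_scal; apply is_curve_derive_chain;
    [apply analytic_is_Cderive; apply Hf; apply gam_in_disc; auto|apply gam_ds]].
  unfold dU, W. field. apply circle_minus.
Qed.

Lemma homotopy_dcont c s t : - eta < s < 1 + eta ->
  C_cont (U := prod_UniformSpace R_UniformSpace R_UniformSpace) (fun p => dU c (fst p) (snd p)) (s,
    t).
Proof.
  intros Hs. apply C_cont_mult; [apply C_cont_const|]. apply C_cont_mult.
  - destruct (is_curve_derive_cont _ _ _ (is_curve_derive_circle r t)) as [A1 A2]. split.
    + apply (continuous_comp (U := prod_UniformSpace R_UniformSpace R_UniformSpace) snd (fun x =>
        Re (circle r x))); [apply continuous_snd|exact A1].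
    + apply (continuous_comp (U := prod_UniformSpace R_UniformSpace R_UniformSpace) snd (fun x =>
        Im (circle r x))); [apply continuous_snd|exact A2].
  - apply (C_cont_comp (C_derive f) (fun p : prod_UniformSpace R_UniformSpace R_UniformSpace => gam
      (fst p) (snd p))); [|apply gam_cont].
    apply analytic_C_derive_cont. apply Hf. apply gam_in_disc. exact Hs.
Qed.

Lemma homotopy_dcont_t c s : - eta < s < 1 + eta -> cont_curve (dU c s).
Proof.
  intros Hs t. apply C_cont_mult; [apply C_cont_const|]. apply C_cont_mult.
  - exact (is_curve_derive_cont _ _ _ (is_curve_derive_circle r t)).
  - apply (C_cont_comp (C_derive f) (gam s)); [|exact (is_curve_derive_cont _ _ _ (gam_dt s t))].
    apply analytic_C_derive_cont. apply Hf. apply gam_in_disc. exact Hs.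
Qed.

(** The integrand is 1/(i s) times the derivative in t of f (gam s t), which is periodic; at s = 0
    it is a multiple of the derivative of the circle itself. *)
Lemma homotopy_dint c s : - eta < s < 1 + eta -> period_int (dU c s) = 0%C.
Proof.
  intros Hs. destruct (Req_dec s 0) as [->|Hs0].
  - apply (period_int_periodic (fun t => (- Ci * c * C_derive f z) * circle r t)%C).
    + intros t. eapply is_curve_derive_ext; [|apply is_curve_derive_scal;
        apply is_curve_derive_circle].
      unfold dU, gam. replace (z + 0 * (circle r t - z))%C with z by ring.
      replace (- Ci * c * C_derive f z * (Ci * circle r t))%C with (- (Ci * Ci) * (c * (circle r t
        * C_derive f z)))%C by ring.
      replace (Ci * Ci)%C with (- (1))%C by (unfold Ci, Cmult, Copp, RtoC; simpl; f_equal; ring).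
      ring.
    + now apply homotopy_dcont_t.
    + now rewrite circle_2PI.
  - apply (period_int_periodic (fun t => (- Ci * c * / RtoC s) * f (gam s t))%C).
    + intros t. eapply is_curve_derive_ext; [|apply is_curve_derive_scal;
        apply is_curve_derive_chain; [apply analytic_is_Cderive; apply Hf; apply gam_in_disc;
        auto|apply gam_dt]].
      unfold dU.
      replace (- Ci * c * / RtoC s * (C_derive f (gam s t) * (RtoC s * (Ci * circle r t))))%C with
        (- (Ci * Ci) * (c * (circle r t * C_derive f (gam s t))))%C.
      2:{ field. intro E. apply Hs0. now injection E. }
      replace (Ci * Ci)%C with (- (1))%C by (unfold Ci, Cmult, Copp, RtoC; simpl; f_equal; ring).
      ring.
    + now apply homotopy_dcont_t.
    + now rewrite gam_2PI.
Qed.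

Lemma homotopy_cont_t c s : - eta < s < 1 + eta -> cont_curve (fun t => c * W t * f (gam s t))%C.
Proof.
  intros Hs t. apply C_cont_mult; [apply C_cont_mult; [apply C_cont_const|apply cont_curve_W]|].
  apply (C_cont_comp f (gam s)); [|exact (is_curve_derive_cont _ _ _ (gam_dt s t))].
  eapply is_Cderive_cont. apply analytic_is_Cderive, Hf, gam_in_disc, Hs.
Qed.

(** Differentiation under the integral sign together with [homotopy_dint]. The constant c lets one
    real statement give both components of Cauchy's formula. *)
Lemma homotopy_int_const c : RInt (fun t => Re (c * W t * f (gam 0 t))) 0 (2 * PI) =
                  RInt (fun t => Re (c * W t * f (gam 1 t))) 0 (2 * PI).
Proof.
  assert (He : 0 < eta) by (unfold eta; lra).
  apply (eq_is_derive (V := R_NormedModule) (fun s => RInt (fun t => Re (c * W t * f (gam s t))) 0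
    (2 * PI)) 0 1); [|lra].
  intros s Hs.
  assert (Hs' : - eta < s < 1 + eta) by lra.
  assert (L : locally s (fun y => - eta < y < 1 + eta)).
  { exists (mkposreal eta He). intros y Hy. change (Rabs (y - s) < eta) in Hy.
      apply Rabs_def2 in Hy. lra. }
  assert (DE : forall s t, - eta < s < 1 + eta -> Derive (fun u => Re (c * W t * f (gam u t))) s =
    Re (dU c s t)).
  { intros s' t Hs2. apply is_derive_unique. exact (proj1 (homotopy_ds c s' t Hs2)). }
  replace (@zero R_NormedModule) with (RInt (fun t => Derive (fun u => Re (c * W t * f (gam u t)))
    s) 0 (2 * PI)).
  - apply is_derive_RInt_param.
    + apply filter_imp with (2 := L). intros y Hy t _. eexists.
        exact (proj1 (homotopy_ds c y t Hy)).
    + intros t _. apply continuity_2d_pt_ext_loc with (fun u v => Re (dU c u v)).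
      * exists (mkposreal eta He). intros u v Hu _. symmetry. apply DE. simpl in Hu.
          apply Rabs_def2 in Hu.
        lra.
      * apply continuity_2d_pt_filterlim. apply (homotopy_dcont c s t Hs').
    + apply filter_imp with (2 := L). intros y Hy. apply (cont_curve_ex _ (homotopy_cont_t c y Hy)).
  - transitivity (RInt (fun t => Re (dU c s t)) 0 (2 * PI)).
    + apply RInt_ext. intros t _. apply DE; auto.
    + exact (f_equal Re (homotopy_dint c s Hs')).
Qed.

End Cauchy.

(** * Taylor expansion in the whole disc *)

Lemma RtoC_neq x : x <> 0 -> RtoC x <> 0%C.
Proof. intros H E. apply H. now injection E. Qed.

Lemma cis_pow t n : (cis t ^ n)%C = cis (INR n * t).
Proof.
  induction n as [|n IH]; [simpl; rewrite Rmult_0_l, cis_0; reflexivity|].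
  rewrite S_INR, Rmult_plus_distr_r, Rmult_1_l, Rplus_comm, cis_plus, <- IH. reflexivity.
Qed.

Lemma Cinv_cis t : (/ cis t)%C = cis (- t).
Proof.
  assert (E : (cis t * cis (- t))%C = 1%C) by (rewrite <- cis_plus, Rplus_opp_r; apply cis_0).
  replace (cis (- t)) with ((cis t * cis (-t)) * / cis t)%C by (field; apply cis_neq0). rewrite E.
    ring.
Qed.

Lemma Cinv_circle_pow r t k : r <> 0 -> ((/ circle r t) ^ k)%C = (RtoC (/ r ^ k) * cis (- (INR k *
  t)))%C.
Proof.
  intros Hr. unfold circle.
  replace (/ (RtoC r * cis t))%C with (RtoC (/ r) * cis (- t))%C.
  - rewrite Cpow_mult_l, cis_pow, <- pow_inv, RtoC_pow. do 2 f_equal. ring.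
  - rewrite <- Cinv_cis, RtoC_inv by auto. field. split; [apply cis_neq0|]. intro E. apply Hr.
      now injection E.
Qed.

Lemma is_curve_derive_cis_lin a t : is_curve_derive (fun s => cis (a * s)) t (RtoC a * (Ci * cis (a
  * t)))%C.
Proof. split; unfold Ci, cis, Cmult, Re, Im, RtoC; simpl; auto_derive; auto; ring. Qed.

Lemma cont_curve_cis_opp k : cont_curve (fun t => cis (- (INR k * t))).
Proof.
  intros t. assert (E : forall t, cis (- (INR k * t)) = cis (- INR k * t)) by (intros; f_equal;
    ring).
  destruct (is_curve_derive_cont _ _ _ (is_curve_derive_cis_lin (- INR k) t)) as [A1 A2]. split.
  - eapply continuous_ext; [|exact A1]. intros s. cbv beta. now rewrite E.
  - eapply continuous_ext; [|exact A2]. intros s. cbv beta. now rewrite E.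
Qed.

Lemma period_int_cis k : k <> O -> period_int (fun t => cis (- (INR k * t))) = 0%C.
Proof.
  intros Hk. assert (Hk' : INR k <> 0) by now apply not_0_INR.
  assert (E : forall t, cis (- (INR k * t)) = cis (- INR k * t)) by (intros; f_equal; ring).
  apply (period_int_periodic (fun t => (RtoC (/ INR k) * Ci) * cis (- INR k * t))%C).
  - intros t. eapply is_curve_derive_ext; [|apply is_curve_derive_scal, is_curve_derive_cis_lin].
      rewrite E, RtoC_opp, RtoC_inv by auto.
    transitivity (- (Ci * Ci) * cis (- INR k * t))%C.
    + field. intro H. apply Hk'. now injection H.
    + replace (Ci * Ci)%C with (- (1))%C by (unfold Ci, Cmult, Copp, RtoC; simpl; f_equal; ring).
        ring.
  - apply cont_curve_cis_opp.
  - cbv beta. f_equal. rewrite Rmult_0_r, cis_0.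
    replace (- INR k * (2 * PI)) with (- (INR k * (2 * PI))) by ring.
    rewrite <- Cinv_cis, <- cis_pow, cis_2PI.
    rewrite Cpow_1_l. field.
Qed.

Lemma geom_split (q : C) N : (1 - q)%C <> 0%C -> (/ (1 - q))%C = (Csum (fun k => q ^ k) N + q ^ N /
  (1 - q))%C.
Proof.
  intros H. induction N as [|N IH]; simpl; [field; auto|].
  rewrite IH. field. auto.
Qed.

Lemma cont_curve_bounded g : cont_curve g -> exists M, forall t, 0 <= t <= 2 * PI -> Cmod (g t) <=
  M.
Proof.
  intros Hg. pose proof two_PI_pos.
  destruct (continuity_ab_maj (fun t => Rabs (Re (g t)) + Rabs (Im (g t))) 0 (2 * PI)) as [Mx [HM
    _]]; [lra| |].
  - intros c _. apply continuity_pt_filterlim.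
    destruct (Hg c) as [A1 A2].
    apply (continuous_plus (V := R_NormedModule) (fun t => Rabs (Re (g t))) (fun t => Rabs (Im (g
      t)))).
    + apply (continuous_comp (fun t => Re (g t)) Rabs); auto. apply continuous_Rabs.
    + apply (continuous_comp (fun t => Im (g t)) Rabs); auto. apply continuous_Rabs.
  - exists (Rabs (Re (g Mx)) + Rabs (Im (g Mx))). intros t Ht. eapply Rle_trans;
      [apply Cmod_le_ReIm|]. now apply HM.
Qed.

Section Taylor.
Variables (r : R).
Hypothesis Hr : 0 < r < 1.

Definition circle_coef (g : R -> C) (k : nat) : C := period_int (fun t => g t * (/ circle r t) ^
  k)%C.

Lemma circle_neq0 t : circle r t <> 0%C.
Proof. intro H. pose proof (Cmod_circle r t ltac:(lra)) as K. rewrite H, Cmod_0 in K. lra. Qed.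

Lemma cont_curve_circle : cont_curve (circle r).
Proof. intros t. exact (is_curve_derive_cont _ _ _ (is_curve_derive_circle r t)). Qed.

Lemma cont_curve_mult g h : cont_curve g -> cont_curve h -> cont_curve (fun t => g t * h t)%C.
Proof. intros Hg Hh t. apply C_cont_mult; auto. Qed.

Lemma cont_curve_pow g n : cont_curve g -> cont_curve (fun t => g t ^ n)%C.
Proof. intros Hg. induction n as [|n IH]; [intros t; apply C_cont_const|].
  exact (cont_curve_mult _ _ Hg IH). Qed.

Lemma cont_curve_Csum (F : nat -> R -> C) N : (forall k, cont_curve (F k)) -> cont_curve (fun t =>
  Csum (fun k => F k t) N).
Proof. intros H. induction N as [|N IH]; intros t; [apply C_cont_const|]. apply C_cont_plus;
  [apply IH|apply H]. Qed.

Lemma period_int_Csum (F : nat -> R -> C) N : (forall k, cont_curve (F k)) -> period_int (fun t =>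
  Csum (fun k => F k t) N) = Csum (fun k => period_int (F k)) N.
Proof.
  intros H. induction N as [|N IH]; simpl.
  - rewrite period_int_const. ring.
  - rewrite period_int_plus; [now rewrite IH|now apply cont_curve_Csum|auto].
Qed.

Lemma cont_curve_cinv : cont_curve (fun t => / circle r t)%C.
Proof. intros t. apply C_cont_inv; [apply cont_curve_circle|apply circle_neq0]. Qed.

(** The Cauchy kernel is a geometric series in z / circle; after N terms its remainder is bounded
    by a constant times (|z|/r)^N. *)
Lemma circle_coef_series g z : cont_curve g -> Cmod z < r ->
  is_Cpseries (circle_coef g) z (period_int (fun t => g t * (circle r t / (circle r t - z)))%C).
Proof.
  intros Hg Hz. pose proof (Cmod_ge_0 z) as Z.
  set (W := fun t => (circle r t / (circle r t - z))%C).
  assert (HW : cont_curve W) by (intros t; now apply cont_curve_W).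
  destruct (cont_curve_bounded _ (cont_curve_mult _ _ Hg HW)) as [M HM].
  assert (M0 : 0 <= M).
  { eapply Rle_trans; [apply Cmod_ge_0|apply (HM 0)]. pose proof two_PI_pos; lra. }
  set (q := Cmod z / r).
  assert (Q : 0 <= q < 1) by (apply ratio_lt_1; lra).
  assert (HC : forall k, cont_curve (fun t => z ^ k * (g t * (/ circle r t) ^ k))%C).
  { intros k. apply cont_curve_mult; [intros t; apply C_cont_const|]. apply cont_curve_mult; auto.
      apply cont_curve_pow, cont_curve_cinv. }
  assert (HR : forall N, cont_curve (fun t => (z * / circle r t) ^ N * (g t * W t))%C).
  { intros N. apply cont_curve_mult; [|apply cont_curve_mult; auto].
      apply cont_curve_pow, cont_curve_mult; [intros t; apply C_cont_const|apply cont_curve_cinv]. }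
  assert (K : forall N, (period_int (fun t => g t * W t) - Csum (fun k => circle_coef g k * z ^ k)
    N)%C
      = period_int (fun t => (z * / circle r t) ^ N * (g t * W t))%C).
  { intros N.
    rewrite (period_int_ext (fun t => g t * W t)%C (fun t => Csum (fun k => z ^ k * (g t * (/
      circle r t) ^ k)) N + (z * / circle r t) ^ N * (g t * W t))%C).
    - rewrite period_int_plus; [|now apply cont_curve_Csum|apply HR].
        rewrite period_int_Csum by auto.
      rewrite (Csum_ext (fun k => period_int (fun t => z ^ k * (g t * (/ circle r t) ^ k))%C) (fun
        k => circle_coef g k * z ^ k)%C); [ring|].
      intros k _. rewrite period_int_scal; [unfold circle_coef; ring|]. apply cont_curve_mult;
        auto. apply cont_curve_pow, cont_curve_cinv.
    - intros t. pose proof (circle_neq0 t) as C0. pose proof (circle_minus r z) as C1.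
      assert (C1t : (circle r t - z)%C <> 0%C) by (apply circle_minus; auto).
      assert (N1 : (1 - z * / circle r t)%C <> 0%C).
      { intro H. apply C1t. replace (circle r t - z)%C with (circle r t * (1 - z * / circle r t))%C
          by (field; auto). rewrite H. ring. }
      assert (EW : W t = (/ (1 - z * / circle r t))%C) by (unfold W; field; auto).
      rewrite EW. rewrite (geom_split (z * / circle r t)%C N N1) at 1.
        rewrite Cmult_plus_distr_l, <- Csum_mult_l. f_equal.
      + apply Csum_ext. intros k _. rewrite Cpow_mult_l. ring.
      + field. auto. }
  apply is_Cseries_eps. intros eps He.
  destruct (geom_small q (4 * PI * M) eps Q ltac:(pose proof PI_RGT_0; apply Rmult_le_pos;
    lra) He) as [N HN].
  exists N. intros n Hn. specialize (HN n Hn).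
  assert (K' : (Csum (fun k => circle_coef g k * z ^ k) n - period_int (fun t => g t * W t))%C
      = (- period_int (fun t => (z * / circle r t) ^ n * (g t * W t)))%C) by (rewrite <- K; ring).
  eapply Rle_lt_trans; [right; exact (f_equal Cmod K')|]. rewrite Cmod_opp.
  eapply Rle_lt_trans; [apply (period_int_bound _ (q ^ n * M)); [apply HR|]|].
  - intros t Ht. rewrite Cmod_mult, Cmod_pow, Cmod_mult, Cmod_inv by apply circle_neq0.
      rewrite Cmod_circle by lra.
    fold (Rdiv (Cmod z) r). fold q. apply Rmult_le_compat_l; [apply pow_le; lra|]. now apply HM.
  - lra.
Qed.

(** Expanding the kernel as in [circle_coef_series] with g = 1, only the constant term has a
    nonzero integral. *)
Lemma period_int_W z : Cmod z < r -> period_int (fun t => circle r t / (circle r t - z))%C = RtoC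
  (2 * PI).
Proof.
  intros Hz.
  assert (H := circle_coef_series (fun _ => 1%C) z ltac:(intros t; apply C_cont_const) Hz).
  rewrite (period_int_ext _ (fun t => circle r t / (circle r t - z))%C) in H by (intros; ring).
  assert (E : forall k, (circle_coef (fun _ => 1) (S k))%C = 0%C).
  { intros k. unfold circle_coef. rewrite (period_int_ext _ (fun t => RtoC (/ r ^ S k) * cis (-
      (INR (S k) * t)))%C).
    - rewrite period_int_scal; [rewrite period_int_cis; [ring|lia]|].
      apply cont_curve_cis_opp.
    - intros t. rewrite Cinv_circle_pow by lra. ring. }
  eapply is_Cseries_unique; [exact H|].
  apply is_Cseries_eps. intros eps He. exists 1%nat. intros N HN.
  replace (Csum (fun n => circle_coef (fun _ => 1) n * z ^ n)%C N) with (RtoC (2 * PI)).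
  - replace (RtoC (2 * PI) - RtoC (2 * PI))%C with (RtoC 0) by ring. now rewrite Cmod_0.
  - induction N as [|N IH]; [lia|]. destruct N as [|N].
    + simpl. unfold circle_coef. simpl. rewrite (period_int_ext _ (fun _ => 1%C)) by (intros;
        ring). rewrite period_int_const. ring.
    + change (RtoC (2 * PI) = Csum (fun n => circle_coef (fun _ => 1) n * z ^ n)%C (S N) +
        circle_coef (fun _ => 1) (S N) * z ^ (S N))%C.
      rewrite <- IH by lia. rewrite E. ring.
Qed.

End Taylor.

Lemma cauchy_formula f r z : analytic_disc f -> 0 < r < 1 -> Cmod z < r ->
  period_int (fun t => f (circle r t) * (circle r t / (circle r t - z)))%C = (RtoC (2 * PI) * f
    z)%C.
Proof.
  intros Hf Hr Hz.
  rewrite <- (period_int_W r Hr z Hz), Cmult_comm, <- period_int_scal by now apply cont_curve_W.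
  assert (U := homotopy_int_const f r z Hf Hr Hz). cbv beta in U.
  assert (G0 : forall t, (z + 0 * (circle r t - z))%C = z) by (intros; ring).
  assert (G1 : forall t, (z + 1 * (circle r t - z))%C = circle r t) by (intros; ring).
  assert (Re_i : forall w, Re (- Ci * w)%C = Im w) by (intros [a b];
    unfold Ci, Cmult, Copp, Re, Im; simpl; ring).
  unfold period_int. f_equal.
  - specialize (U 1%C). rewrite (RInt_ext _ (fun t => Re (1 * (circle r t / (circle r t - z)) * f
      (z + 1 * (circle r t - z)))%C)).
    2:{ intros t _. rewrite G1. f_equal. ring. }
    rewrite <- U. apply RInt_ext. intros t _. rewrite G0. f_equal. ring.
  - specialize (U (- Ci)%C). rewrite (RInt_ext _ (fun t => Re (- Ci * (circle r t / (circle r t -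
      z)) * f (z + 1 * (circle r t - z)))%C)).
    2:{ intros t _. rewrite G1, <- Re_i. f_equal. ring. }
    rewrite <- U. apply RInt_ext. intros t _. rewrite G0, <- Re_i. f_equal. ring.
Qed.

Lemma taylor_radius f r : analytic_disc f -> 0 < r < 1 ->
  exists a, forall z, Cmod z < r -> is_Cpseries a z (f z).
Proof.
  intros Hf Hr. exists (fun k => (/ RtoC (2 * PI)) * circle_coef r (fun t => f (circle r t)) k)%C.
    intros z Hz.
  pose proof two_PI_pos as P.
  assert (NP : RtoC (2 * PI) <> 0%C) by (apply RtoC_neq; lra).
  assert (Hc : cont_curve (fun t => f (circle r t))).
  { intros t. apply (C_cont_comp f (circle r)); [|apply cont_curve_circle; auto].
    eapply is_Cderive_cont. apply analytic_is_Cderive, Hf. rewrite Cmod_circle; lra. }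
  pose proof (circle_coef_series r Hr _ z Hc Hz) as H. cbv beta in H.
    rewrite (cauchy_formula f r z Hf Hr Hz) in H.
  apply (is_Cseries_scal (/ RtoC (2 * PI))%C) in H.
  replace (/ RtoC (2 * PI) * (RtoC (2 * PI) * f z))%C with (f z) in H by (field; auto).
  eapply is_Cseries_ext; [|exact H]. intros n. simpl. ring.
Qed.

Lemma CPSeries_0 a : CPSeries a 0%C = a O.
Proof.
  apply Cseries_unique. apply is_Cseries_eps. intros eps He. exists 1%nat. intros N HN.
  replace (Csum (fun n => a n * 0 ^ n)%C N) with (a O).
  - replace (a O - a O)%C with (RtoC 0) by ring. now rewrite Cmod_0.
  - induction N as [|N IH]; [lia|]. destruct N as [|N]; [simpl; ring|].
    change (a O = Csum (fun n => a n * 0 ^ n)%C (S N) + a (S N) * 0 ^ (S N))%C.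
      rewrite <- IH by lia. simpl. ring.
Qed.

(** By induction on n: a series vanishing near 0 has vanishing constant term, and so does its
    derivative. *)
Lemma CPSeries_zero_unique Rd : 0 < Rd -> forall n d, disc_summable Rd d -> (forall z, Cmod z < Rd
  -> CPSeries d z = 0%C) -> d n = 0%C.
Proof.
  intros HR. induction n as [|n IH]; intros d Hd Hz.
  - rewrite <- CPSeries_0. apply Hz. rewrite Cmod_0; auto.
  - assert (K : derive_coef d n = 0%C).
    { apply IH; [now apply disc_summable_derive_coef|]. intros z Hzz.
      rewrite <- (is_Cderive_unique (CPSeries d) z _ (CPSeries_derive Rd d z Hd Hzz)).
        apply is_Cderive_unique.
      apply is_Cderive_ext_loc with (fun _ => 0%C) (Rd - Cmod z); [lra| |].
      - intros y Hy. symmetry. apply Hz. replace y with ((y - z) + z)%C by ring.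
        eapply Rle_lt_trans; [apply Cmod_triangle|]. lra.
      - apply is_Cderive_eps. intros eps He. exists 1. split; [lra|]. intros y _.
        replace (0 - 0 - (y - z) * 0)%C with (RtoC 0) by ring. rewrite Cmod_0.
        apply Rmult_le_pos; [lra|apply Cmod_ge_0]. }
    unfold derive_coef in K. 
    assert (N : RtoC (INR (S n)) <> 0%C) by (apply RtoC_neq; apply not_0_INR; lia).
    replace (d (S n)) with (/ RtoC (INR (S n)) * (RtoC (INR (S n)) * d (S n)))%C by (field; auto).
    rewrite K. ring.
Qed.

Lemma is_Cpseries_unique r a b (f : C -> C) : 0 < r -> (forall z, Cmod z < r -> is_Cpseries a z (f
  z)) ->
  (forall z, Cmod z < r -> is_Cpseries b z (f z)) -> forall n, a n = b n.
Proof.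
  intros Hr Ha Hb n.
  assert (K : forall z, Cmod z < r -> is_Cpseries (fun n => a n - b n)%C z 0%C).
  { intros z Hz. pose proof (is_Cseries_minus _ _ _ _ (Ha z Hz) (Hb z Hz)) as H.
    replace (f z - f z)%C with (RtoC 0) in H by ring.
    eapply is_Cseries_ext; [|exact H]. intros k. cbv beta. ring. }
  assert (Z : (a n - b n)%C = 0%C).
  { apply (CPSeries_zero_unique r Hr n (fun n => a n - b n)%C).
    - apply is_Cpseries_disc_summable. intros x Hx. exists 0%C. apply K.
        rewrite Cmod_R, Rabs_pos_eq; lra.
    - intros z Hz. apply Cseries_unique. apply K, Hz. }
  replace (a n) with ((a n - b n) + b n)%C by ring. rewrite Z. ring.
Qed.

(** Every radius r < 1 gives a series on |z| < r; by uniqueness of the coefficients they are all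
    the same series. *)
Lemma taylor_disc f : analytic_disc f -> exists a, disc_summable 1 a /\ forall z, Cmod z < 1 -> f z
  = CPSeries a z.
Proof.
  intros Hf. destruct (taylor_radius f (1/2) Hf ltac:(lra)) as [a Ha].
  assert (K : forall r, 1/2 < r < 1 -> forall z, Cmod z < r -> is_Cpseries a z (f z)).
  { intros r Hr. destruct (taylor_radius f r Hf ltac:(lra)) as [b Hb].
    assert (E : forall n, a n = b n).
    { apply (is_Cpseries_unique (1/2) a b f); [lra|auto|]. intros z Hz. apply Hb. lra. }
    intros z Hz. eapply is_Cseries_ext; [|apply (Hb z Hz)]. intros n. simpl. now rewrite E. }
  assert (K1 : forall z, Cmod z < 1 -> is_Cpseries a z (f z)).
  { intros z Hz. apply (K ((Rmax (1/2) (Cmod z) + 1) / 2)).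
    - pose proof (Rmax_l (1/2) (Cmod z)). assert (Rmax (1/2) (Cmod z) < 1) by (apply Rmax_case;
        lra). lra.
    - pose proof (Rmax_r (1/2) (Cmod z)). lra. }
  exists a. split.
  - apply is_Cpseries_disc_summable. intros r Hr. exists (f r). apply K1.
      rewrite Cmod_R, Rabs_pos_eq; lra.
  - intros z Hz. symmetry. apply Cseries_unique. apply K1, Hz.
Qed.

(** * The Gamma integral and logarithmic weights *)

Lemma is_RInt_gen_eps (g : R -> R) Fa Fb (l : R) :
  is_RInt_gen g Fa Fb l <->
  forall eps, 0 < eps -> exists Q S : R -> Prop, Fa Q /\ Fb S /\
    forall a b, Q a -> S b -> exists I, is_RInt g a b I /\ Rabs (I - l) < eps.
Proof.
  split.
  - intros H eps He.
    destruct (H (fun y => Rabs (y - l) < eps)) as [Q S HQ HS HH].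
    { exists (mkposreal eps He). intros y Hy. exact Hy. }
    exists Q, S. split; [exact HQ|split; [exact HS|]]. intros a b Ha Hb. exact (HH a b Ha Hb).
  - intros H P [eps HP]. destruct (H eps (cond_pos eps)) as [Q [S [HQ [HS HH]]]].
    apply Filter_prod with Q S; auto. intros a b Ha Hb. destruct (HH a b Ha Hb) as [I [HI HIl]].
    exists I. split; [exact HI|apply HP, HIl].
Qed.

Lemma ex_RInt_pos (g : R -> R) (D : R -> Prop) a b :
  (forall a b x, D a -> D b -> a <= x <= b -> D x) -> (forall x, D x -> continuous g x) ->
  D a -> D b -> ex_RInt g a b.
Proof.
  intros Hc Hg Ha Hb. apply (ex_RInt_continuous (V := R_CompleteNormedModule)). intros x Hx.
    apply Hg.
  revert Hx. unfold Rmin, Rmax. destruct (Rle_dec a b); intros; [apply (Hc a b)|apply (Hc b a)];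
    auto.
Qed.

(** The limit is the supremum of the integrals over compact subintervals of the domain D, whose
    two ends are approached along the filters Fa and Fb. *)
Lemma is_RInt_gen_of_bounded (g : R -> R) (D : R -> Prop) Fa Fb B x0 :
  (forall a b x, D a -> D b -> a <= x <= b -> D x) ->
  D x0 ->
  (forall x, D x -> Fa (fun a => D a /\ a <= x)) ->
  (forall x, D x -> Fb (fun b => D b /\ x <= b)) ->
  (forall x, D x -> continuous g x) -> (forall x, D x -> 0 <= g x) ->
  (forall a b, D a -> D b -> a <= b -> RInt g a b <= B) ->
  exists l, is_RInt_gen g Fa Fb l /\ forall a b, D a -> D b -> a <= b -> RInt g a b <= l.
Proof.
  intros Hc H0 HFa HFb Hg Hp HB.
  assert (EX : forall a b, D a -> D b -> ex_RInt g a b) by (intros; apply (ex_RInt_pos g D); auto).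
  destruct (completeness (fun y => exists a b, D a /\ D b /\ a <= b /\ y = RInt g a b)) as [l [Hl1
    Hl2]].
  { exists B. intros y [a [b [Ha [Hb [Hab ->]]]]]. now apply HB. }
  { exists (RInt g x0 x0). exists x0, x0. repeat split; auto. lra. }
  assert (Hub : forall a b, D a -> D b -> a <= b -> RInt g a b <= l).
  { intros a b Ha Hb Hab. apply Hl1. exists a, b. auto. }
  exists l. split; auto.
  apply is_RInt_gen_eps. intros eps He.
  destruct (Classical_Prop.classic (exists a b, D a /\ D b /\ a <= b /\ l - eps < RInt g a b)) as
    [[a0 [b0 [Ha0 [Hb0 [Hab0 HI]]]]]|HN].
  - exists (fun a => D a /\ a <= a0), (fun b => D b /\ b0 <= b). split; [auto|split; [auto|]].
    intros a b [Ha Haa] [Hb Hbb]. exists (RInt g a b). split;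
      [apply (RInt_correct (V := R_CompleteNormedModule)); auto|].
    assert (RInt g a b <= l) by (apply Hub; auto; lra).
    assert (C1 := RInt_Chasles (V := R_CompleteNormedModule) g a a0 b (EX _ _ Ha Ha0) (EX _ _ Ha0
      Hb)).
    assert (C2 := RInt_Chasles (V := R_CompleteNormedModule) g a0 b0 b (EX _ _ Ha0 Hb0) (EX _ _ Hb0
      Hb)).
    change plus with Rplus in C1, C2.
    assert (0 <= RInt g a a0).
    { apply RInt_ge_0; auto. intros x Hx. apply Hp. apply (Hc a a0); auto; lra. }
    assert (0 <= RInt g b0 b).
    { apply RInt_ge_0; auto. intros x Hx. apply Hp. apply (Hc b0 b); auto; lra. }
    apply Rabs_def1; simpl in *; lra.
  - exfalso. assert (l <= l - eps); [|lra]. apply Hl2. intros y [a [b [Ha [Hb [Hab ->]]]]].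
    destruct (Rle_lt_dec (RInt g a b) (l - eps)) as [L|L]; auto. exfalso. apply HN. exists a, b.
      auto.
Qed.

Lemma exp_le_compat x y : x <= y -> exp x <= exp y.
Proof. intros [H|H]; [left; now apply exp_increasing|rewrite H; lra]. Qed.

Lemma ln_le_minus_1 x : 0 < x -> ln x <= x - 1.
Proof. intros H. pose proof (exp_ineq1_le (ln x)) as K. rewrite exp_ln in K by auto. lra. Qed.

Lemma Rpower_pos x y : 0 < Rpower x y.
Proof. apply exp_pos. Qed.

Lemma Rpower_deriv y x : 0 < x -> is_derive (fun t => Rpower t y) x (y * Rpower x (y - 1)).
Proof. intros H. apply is_derive_Reals. now apply derivable_pt_lim_power. Qed.

Lemma Rpower_cont y x : 0 < x -> continuous (fun t => Rpower t y) x.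
Proof. intros H. apply (ex_derive_continuous (K := R_AbsRing) (V := R_NormedModule)). eexists.
  now apply Rpower_deriv. Qed.

Definition gamma_integrand (s t : R) : R := Rpower t (s - 1) * exp (- t).

Lemma gamma_integrand_cont s x : 0 < x -> continuous (gamma_integrand s) x.
Proof.
  intros H. apply (continuous_mult (K := R_AbsRing)); [now apply Rpower_cont|].
  apply (ex_derive_continuous (K := R_AbsRing) (V := R_NormedModule)). auto_derive. auto.
Qed.

(** The function -1/(1 + x^s) is bounded and its derivative s x^(s-1)/(1 + x^s)^2 dominates the
    integrand up to a constant, at both ends of the half-line at once. *)
Lemma gamma_bound s : 0 < s -> exists B, forall a b, 0 < a -> 0 < b -> a <= b -> RInt
  (gamma_integrand s) a b <= B.
Proof.
  (* K bounds (1 + x^s)^2 exp (-x): x^(2 s) exp (-x) is maximal at x = 2 s. *)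
  intros Hs. set (K := 2 + 2 * exp (2 * s * ln (2 * s))).
  assert (HK : forall x, 0 < x -> (1 + Rpower x s) ^ 2 * exp (- x) <= K).
  { intros x Hx. set (u := Rpower x s). assert (Hu : 0 < u) by apply Rpower_pos.
    assert (E : u ^ 2 * exp (- x) <= exp (2 * s * ln (2 * s))).
    { replace (u ^ 2) with (exp (2 * s * ln x)).
      - rewrite <- exp_plus. apply exp_le_compat.
        pose proof (ln_le_minus_1 (x / (2 * s)) ltac:(apply Rdiv_lt_0_compat; lra)) as L.
        unfold Rdiv in L. rewrite ln_mult, ln_Rinv in L; [|lra|lra|apply Rinv_0_lt_compat; lra].
        apply (Rmult_le_compat_l (2 * s)) in L; [|lra].
        replace (2 * s * (x * / (2 * s) - 1)) with (x - 2 * s) in L by (field; lra). lra.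
      - unfold u, Rpower. simpl. rewrite Rmult_1_r, <- exp_plus. f_equal. ring. }
    assert (exp (- x) <= 1) by (rewrite <- exp_0; apply exp_le_compat; lra).
    pose proof (exp_pos (- x)). unfold K.
    assert ((1 + u) ^ 2 <= 2 + 2 * u ^ 2) by (pose proof (pow2_ge_0 (1 - u)); nra).
    apply Rle_trans with ((2 + 2 * u ^ 2) * exp (- x)); [apply Rmult_le_compat_r; lra|]. lra. }
  set (h := fun x => - / (1 + Rpower x s)). set (h' := fun x => s * Rpower x (s - 1) / (1 + Rpower
    x s) ^ 2).
  assert (Hh : forall x, 0 < x -> is_derive h x (h' x)).
  { intros x Hx. unfold h, h'.
    pose proof (Rpower_pos x s) as Px.
    assert (D1 : is_derive (fun t => 1 + Rpower t s) x (0 + s * Rpower x (s - 1))).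
    { apply (is_derive_plus (V := R_NormedModule)); [apply (is_derive_const (K := R_AbsRing) (V :=
        R_NormedModule))|now apply Rpower_deriv]. }
    assert (D2 := is_derive_inv _ _ _ D1 ltac:(lra)).
    assert (D3 := is_derive_opp (V := R_NormedModule) _ _ _ D2).
    assert (E : s * Rpower x (s - 1) / (1 + Rpower x s) ^ 2 = - (- (0 + s * Rpower x (s - 1)) / (1
      + Rpower x s) ^ 2)) by (field; lra).
    rewrite E. exact D3. }
  assert (Hh'c : forall x, 0 < x -> continuous h' x).
  { intros x Hx. unfold h'. pose proof (Rpower_pos x s) as Px.
    apply (continuous_mult (K := R_AbsRing) (fun x => s * Rpower x (s-1)) (fun x => / (1 + Rpower x
      s) ^ 2)).
    - apply (continuous_mult (K := R_AbsRing) (fun _ => s));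
        [apply continuous_const|now apply Rpower_cont].
    - apply continuous_Rinv_comp; [|apply pow_nonzero; lra].
      simpl. assert (CC : continuous (fun x => 1 + Rpower x s) x).
      { apply (continuous_plus (V := R_NormedModule));
          [apply continuous_const|now apply Rpower_cont]. }
      apply (continuous_mult (K := R_AbsRing)); [exact CC|].
        apply (continuous_mult (K := R_AbsRing)); [exact CC|apply continuous_const]. }
  exists (K / s). intros a b Ha Hb Hab.
  assert (EI : is_RInt h' a b (h b - h a)).
  { apply (is_RInt_derive (V := R_CompleteNormedModule) h h'); intros x Hx;
      rewrite Rmin_left, Rmax_right in Hx by auto; [apply Hh|apply Hh'c]; lra. }
  apply Rle_trans with (RInt (fun x => (K / s) * h' x) a b).
  - apply RInt_le; auto.
    + apply (ex_RInt_pos _ (fun x => 0 < x)); auto; [intros; lra|apply gamma_integrand_cont].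
    + apply (ex_RInt_scal (V := R_NormedModule)). eexists; exact EI.
    + intros x Hx. unfold gamma_integrand, h'. pose proof (Rpower_pos x s) as Px.
        pose proof (Rpower_pos x (s-1)) as Px'.
      specialize (HK x ltac:(lra)).
      apply (Rmult_le_reg_r ((1 + Rpower x s) ^ 2)); [apply pow_lt; lra|].
      replace (K / s * (s * Rpower x (s - 1) / (1 + Rpower x s) ^ 2) * (1 + Rpower x s) ^ 2) with
        (Rpower x (s - 1) * K) by (field; lra).
      rewrite Rmult_assoc. apply Rmult_le_compat_l; lra.
  - assert (EI2 : RInt (fun x => K / s * h' x) a b = K / s * (h b - h a)).
    { apply (is_RInt_unique (V := R_CompleteNormedModule)).
        exact (is_RInt_scal (V := R_NormedModule) _ _ _ (K / s) _ EI). }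
    rewrite EI2. unfold h.
    pose proof (Rpower_pos a s). pose proof (Rpower_pos b s).
    assert (0 < K / s) by (apply Rdiv_lt_0_compat; [unfold K;
      pose proof (exp_pos (2 * s * ln (2 * s))); lra|lra]).
    assert (0 < / (1 + Rpower b s)) by (apply Rinv_0_lt_compat; lra).
    assert (/ (1 + Rpower a s) <= 1) by (rewrite <- Rinv_1 at 2; apply Rinv_le_contravar; lra).
    nra.
Qed.

Lemma at_right_pos (x : R) : 0 < x -> at_right 0 (fun a => 0 < a /\ a <= x).
Proof.
  intros Hx. exists (mkposreal x Hx). intros y Hy Hy0. change (Rabs (y - 0) < x) in Hy.
    apply Rabs_def2 in Hy. lra.
Qed.

Lemma Gamma_correct s : 0 < s -> is_RInt_gen (gamma_integrand s) (at_right 0) (Rbar_locally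
  p_infty) (Gamma s) /\ 0 < Gamma s.
Proof.
  intros Hs. destruct (gamma_bound s Hs) as [B HB].
  destruct (is_RInt_gen_of_bounded (gamma_integrand s) (fun x => 0 < x) (at_right 0) (Rbar_locally
    p_infty) B 1) as [l [Hl Hl2]]; auto.
  - intros; lra.
  - lra.
  - apply at_right_pos.
  - intros x Hx. exists x. intros y Hy. lra.
  - apply gamma_integrand_cont.
  - intros x Hx. left. apply Rmult_lt_0_compat; [apply Rpower_pos|apply exp_pos].
  - assert (E : Gamma s = l) by exact (is_RInt_gen_unique _ _ Hl).
    rewrite E. split; [exact Hl|].
    apply Rlt_le_trans with (RInt (gamma_integrand s) 1 2); [|apply Hl2; lra].
    apply RInt_gt_0; [lra| |].
    + intros x Hx. apply Rmult_lt_0_compat; [apply Rpower_pos|apply exp_pos].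
    + intros x Hx. apply gamma_integrand_cont. lra.
Qed.

(** For a = 1 + c and s = p this is the weight of the transform, up to its normalising constant.
    *)
Definition log_weight (a s t : R) : R := Rpower (ln (1 / t)) (s - 1) * Rpower t (a - 1).

Lemma ln_inv_pos t : 0 < t < 1 -> 0 < ln (1 / t).
Proof.
  intros H. unfold Rdiv. rewrite Rmult_1_l, ln_Rinv by lra.
  pose proof (ln_increasing t 1 ltac:(lra) ltac:(lra)). rewrite ln_1 in H0. lra.
Qed.

Lemma log_weight_cont a s t : 0 < t < 1 -> continuous (log_weight a s) t.
Proof.
  intros H. apply (continuous_mult (K := R_AbsRing)); [|apply Rpower_cont; lra].
  apply (continuous_comp (fun t => ln (1 / t)) (fun x => Rpower x (s - 1))).
  - apply (ex_derive_continuous (K := R_AbsRing) (V := R_NormedModule)). auto_derive.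
    split; [lra|]. split; auto. apply Rdiv_lt_0_compat; lra.
  - apply Rpower_cont. now apply ln_inv_pos.
Qed.

Lemma log_weight_pos a s t : 0 < log_weight a s t.
Proof. apply Rmult_lt_0_compat; apply Rpower_pos. Qed.

(** Substitution x = -a log t in the Gamma integral. *)
Lemma log_weight_int a s : 0 < a -> 0 < s ->
  is_RInt_gen (log_weight a s) (at_right 0) (at_left 1) (Gamma s / Rpower a s).
Proof.
  intros Ha Hs. destruct (Gamma_correct s Hs) as [HG _].
  rewrite is_RInt_gen_eps in HG. apply is_RInt_gen_eps. intros eps He.
  assert (PA := Rpower_pos a s).
  destruct (HG (eps * Rpower a s) ltac:(now apply Rmult_lt_0_compat)) as [Q [S [HQ [HS HH]]]].
  set (g := fun t => - a * ln t).
  assert (L0 : at_right 0 (fun t => 0 < t < 1 /\ S (g t))).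
  { apply filter_and.
    - exists (mkposreal 1 Rlt_0_1). intros y Hy Hy0. change (Rabs (y - 0) < 1) in Hy.
        apply Rabs_def2 in Hy. lra.
    - destruct HS as [M HM].
      assert (K := is_lim_ln_0 (fun y => y < - (Rabs M + 1) / a)).
      assert (K2 : Rbar_locally m_infty (fun y => y < - (Rabs M + 1) / a)) by (exists (- (Rabs M +
        1) / a); auto).
      specialize (K K2). unfold filtermap in K. revert K. apply filter_imp. intros t Ht.
      apply HM. unfold g. apply (Rmult_lt_compat_l a) in Ht; [|auto].
      replace (a * (- (Rabs M + 1) / a)) with (- (Rabs M + 1)) in Ht by (field; lra).
      pose proof (Rle_abs M). lra. }
  assert (L1 : at_left 1 (fun t => 0 < t < 1 /\ Q (g t))).
  { apply filter_and.
    - exists (mkposreal 1 Rlt_0_1). intros y Hy Hy0. change (Rabs (y - 1) < 1) in Hy.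
        apply Rabs_def2 in Hy. lra.
    - destruct HQ as [d Hd].
      assert (Cg : continuous g 1).
      { apply (ex_derive_continuous (K := R_AbsRing) (V := R_NormedModule)). unfold g. auto_derive.
          lra. }
      assert (G1 : g 1 = 0) by (unfold g; rewrite ln_1; ring).
      assert (Lg : locally (g 1) (ball 0 d)) by (rewrite G1; exists d; auto).
      specialize (Cg _ Lg). unfold filtermap in Cg.
      assert (L2 : locally 1 (fun y => 0 < y)).
      { exists (mkposreal 1 Rlt_0_1). intros y Hy. change (Rabs (y - 1) < 1) in Hy.
          apply Rabs_def2 in Hy. lra. }
      generalize (filter_and _ _ Cg L2). unfold at_left, within. apply filter_imp.
        intros t [Ht Ht0] Ht1.
      apply Hd; [exact Ht|]. unfold g.
      pose proof (ln_increasing t 1 Ht0 Ht1). rewrite ln_1 in H. nra. }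
  exists (fun t => 0 < t < 1 /\ S (g t)), (fun t => 0 < t < 1 /\ Q (g t)). split; [exact L0|split;
    [exact L1|]].
  intros x y [Hx HSx] [Hy HQy].
  destruct (HH _ _ HQy HSx) as [I [HI HIl]].
  assert (I2 : is_RInt (fun t => scal (- a / t) (gamma_integrand s (g t))) x y (RInt
    (gamma_integrand s) (g x) (g y))).
  { apply (is_RInt_comp (V := R_CompleteNormedModule) (gamma_integrand s) g (fun t => - a / t)).
    - intros t Ht. apply gamma_integrand_cont. unfold g.
      assert (0 < t < 1) by (revert Ht; unfold Rmin, Rmax; destruct (Rle_dec x y); lra).
      pose proof (ln_increasing t 1 ltac:(lra) ltac:(lra)). rewrite ln_1 in H0. nra.
    - intros t Ht.
      assert (0 < t < 1) by (revert Ht; unfold Rmin, Rmax; destruct (Rle_dec x y); lra).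
      split.
      + unfold g. auto_derive; [lra|]. field. lra.
      + apply (ex_derive_continuous (K := R_AbsRing) (V := R_NormedModule)). auto_derive. lra. }
  assert (EI : RInt (gamma_integrand s) (g x) (g y) = - I).
  { apply (is_RInt_unique (V := R_CompleteNormedModule)).
      apply (is_RInt_swap (V := R_NormedModule)) in HI. exact HI. }
  rewrite EI in I2.
  apply (is_RInt_scal (V := R_NormedModule) _ _ _ (- / Rpower a s)) in I2.
  exists (I / Rpower a s). split.
  - assert (EQ : I / Rpower a s = - / Rpower a s * - I) by (field; lra). rewrite EQ.
    eapply is_RInt_ext; [|exact I2]. intros t Ht.
    assert (Ht' : 0 < t < 1) by (revert Ht; unfold Rmin, Rmax; destruct (Rle_dec x y); lra).
    unfold scal; simpl; unfold mult; simpl. unfold log_weight, gamma_integrand, g.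
    assert (LP := ln_inv_pos t Ht').
    assert (LE : ln (1 / t) = - ln t) by (unfold Rdiv; rewrite Rmult_1_l, ln_Rinv; lra).
    rewrite LE in *.
    replace (- a * ln t) with (a * - ln t) by ring.
    rewrite <- Rpower_mult_distr by auto.
    assert (E1 : exp (- (a * - ln t)) = Rpower t (a - 1) * t).
    { rewrite <- (Rpower_1 t) at 3 by lra. rewrite <- Rpower_plus. unfold Rpower. f_equal. ring. }
    assert (E2 : Rpower a s = Rpower a (s - 1) * a).
    { rewrite <- (Rpower_1 a) at 3 by lra. rewrite <- Rpower_plus. f_equal. ring. }
    rewrite E1, E2. field. split; [lra|]. split; [lra|]. pose proof (Rpower_pos a (s-1)); lra.
  - replace (I / Rpower a s - Gamma s / Rpower a s) with ((I - Gamma s) / Rpower a s) by (field;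
      lra).
    unfold Rdiv. rewrite Rabs_mult, (Rabs_pos_eq (/ _)) by (left; now apply Rinv_0_lt_compat).
    apply (Rmult_lt_reg_r (Rpower a s)); auto. rewrite Rmult_assoc, Rinv_l; lra.
Qed.

(** * Termwise integration against a weight on (0,1) *)

Lemma rsum_S (u : nat -> R) N : @eq R (rsum u (S N)) (rsum u N + u (S N)).
Proof. rewrite sum_Sn. reflexivity. Qed.

Lemma rsum_0 (u : nat -> R) : @eq R (rsum u 0) (u O).
Proof. apply sum_O. Qed.

Lemma rsum_mult_l (k : R) (u : nat -> R) N : @eq R (rsum (fun n => k * u n) N) (k * rsum u N).
Proof. induction N as [|N IH]; [rewrite !rsum_0; reflexivity|]. rewrite !rsum_S, IH. symmetry.
  apply Rmult_plus_distr_l. Qed.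

Lemma rsum_ext (u v : nat -> R) N : (forall n, @eq R (u n) (v n)) -> @eq R (rsum u N) (rsum v N).
Proof. intros H. apply sum_n_ext. exact H. Qed.

(** Tails of a dominated series are dominated by the tails of the majorant. *)
Lemma series_tail (u v : nat -> R) su sv N : (forall n, Rabs (u n) <= v n) -> is_series u su ->
  is_series v sv ->
  Rabs (su - rsum u N) <= sv - rsum v N.
Proof.
  intros Huv Hu Hv.
  assert (K : forall M, Rabs (rsum u (N + M) - rsum u N) <= rsum v (N + M) - rsum v N).
  { induction M as [|M IH].
    - rewrite Nat.add_0_r, Rminus_diag, Rabs_R0. lra.
    - rewrite Nat.add_succ_r, !rsum_S. specialize (Huv (S (N + M))).
      replace (rsum u (N + M) + u (S (N + M)) - rsum u N) with ((rsum u (N + M) - rsum u N) + u (S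
        (N + M))) by ring.
      eapply Rle_trans; [apply Rabs_triang|lra]. }
  assert (Hv0 : forall n, 0 <= v n) by (intros n; eapply Rle_trans; [apply Rabs_pos|apply Huv]).
  apply Rnot_lt_le. intros L. rewrite is_series_eps in Hu.
  destruct (Hu (Rabs (su - rsum u N) - (sv - rsum v N))) as [M HM]; [lra|].
  specialize (HM (N + M)%nat ltac:(lia)). specialize (K M).
  pose proof (sum_n_le_Series v sv (N + M) Hv0 Hv).
  replace (su - rsum u N) with (- (rsum u (N + M) - su) + (rsum u (N + M) - rsum u N)) in HM at 1
    by ring.
  replace (su - rsum u N) with (- (rsum u (N + M) - su) + (rsum u (N + M) - rsum u N)) in L by ring.
  pose proof (Rabs_triang (- (rsum u (N + M) - su)) (rsum u (N + M) - rsum u N)) as T.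
    rewrite Rabs_Ropp in T. lra.
Qed.

Definition rsummable (c : nat -> R) := forall r, 0 <= r < 1 -> ex_series (fun n => Rabs (c n) * r ^
  n).

Lemma rsummable_abs c x : rsummable c -> Rabs x < 1 -> ex_series (fun n => Rabs (c n * x ^ n)).
Proof.
  intros H Hx. eapply ex_series_ext; [|apply (H (Rabs x))]; [|split; [apply Rabs_pos|auto]].
  intros n. cbv beta. now rewrite Rabs_mult, RPow_abs.
Qed.

Lemma rsummable_is c x : rsummable c -> Rabs x < 1 -> is_series (fun n => c n * x ^ n) (PSeries c
  x).
Proof. intros H Hx. apply Series_correct, ex_series_Rabs. now apply rsummable_abs. Qed.

Lemma rsummable_CV c x : rsummable c -> Rabs x < 1 -> Rbar_lt (Rabs x) (CV_radius c).
Proof.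
  intros H Hx. pose proof (Rabs_pos x).
  set (r := (Rabs x + 1) / 2).
  apply Rbar_lt_le_trans with r; [simpl; unfold r; lra|].
  apply (CV_radius_bounded c). destruct (H r) as [l Hl]; [unfold r; lra|].
  exists l. intros n. rewrite Rabs_mult, (Rabs_pos_eq (r ^ n)) by (apply pow_le; unfold r; lra).
  assert (P : forall k, 0 <= Rabs (c k) * r ^ k) by (intros; apply Rmult_le_pos;
    [apply Rabs_pos|apply pow_le; unfold r; lra]).
  exact (term_le_Series _ _ n P Hl).
Qed.

Lemma rsummable_cont c x : rsummable c -> Rabs x < 1 -> continuous (PSeries c) x.
Proof. intros H Hx. apply continuity_pt_filterlim. apply PSeries_continuity.
  now apply rsummable_CV. Qed.

Lemma rsummable_of_abs c : ex_series (fun n => Rabs (c n)) -> rsummable c.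
Proof.
  intros H r Hr. apply ex_series_dom with (fun n => Rabs (c n)); auto. intros n.
    pose proof (Rabs_pos (c n)).
  assert (0 <= r ^ n <= 1).
  { split; [apply pow_le; lra|]. rewrite <- (pow1 n). apply pow_incr. lra. }
  split; [apply Rmult_le_pos; lra|]. nra.
Qed.

Lemma RInt_gen_rsum (F : nat -> R -> R) (m : nat -> R) N :
  (forall n, is_RInt_gen (F n) (at_right 0) (at_left 1) (m n)) ->
  is_RInt_gen (fun t => rsum (fun n => F n t) N) (at_right 0) (at_left 1) (rsum m N).
Proof.
  intros H. induction N as [|N IH].
  - rewrite rsum_0. eapply is_RInt_gen_ext; [|apply (H O)].
    apply filter_forall. intros ab x _. now rewrite rsum_0.
  - rewrite rsum_S. eapply is_RInt_gen_ext; [|apply (is_RInt_gen_plus (V := R_NormedModule) _ _ _ _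
      IH (H (S N)))].
    apply filter_forall. intros ab x _. rewrite rsum_S. reflexivity.
Qed.

Lemma at_right_01 : at_right 0 (fun t => 0 < t < 1).
Proof.
  exists (mkposreal 1 Rlt_0_1). intros y Hy Hy0. change (Rabs (y - 0) < 1) in Hy.
    apply Rabs_def2 in Hy. lra.
Qed.

Lemma at_left_01 : at_left 1 (fun t => 0 < t < 1).
Proof.
  exists (mkposreal 1 Rlt_0_1). intros y Hy Hy0. change (Rabs (y - 1) < 1) in Hy.
    apply Rabs_def2 in Hy. lra.
Qed.

Lemma at_right_le x : 0 < x -> at_right 0 (fun t => 0 < t <= x).
Proof.
  intros Hx. exists (mkposreal x Hx). intros y Hy Hy0. change (Rabs (y - 0) < x) in Hy.
    apply Rabs_def2 in Hy. lra.
Qed.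

Lemma at_left_ge x : x < 1 -> at_left 1 (fun t => x <= t < 1).
Proof.
  intros Hx. exists (mkposreal (1 - x) ltac:(lra)). intros y Hy Hy0.
    change (Rabs (y - 1) < 1 - x) in Hy. apply Rabs_def2 in Hy. lra.
Qed.

Lemma int01_le (f g : R -> R) lf lg : (forall t, 0 < t < 1 -> f t <= g t) ->
  is_RInt_gen f (at_right 0) (at_left 1) lf -> is_RInt_gen g (at_right 0) (at_left 1) lg -> lf <=
    lg.
Proof.
  intros H Hf Hg. rewrite is_RInt_gen_eps in Hf, Hg. apply Rnot_lt_le. intros L.
  destruct (Hf ((lf - lg) / 2)) as [Q1 [S1 [HQ1 [HS1 H1]]]]; [lra|].
  destruct (Hg ((lf - lg) / 2)) as [Q2 [S2 [HQ2 [HS2 H2]]]]; [lra|].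
  assert (A1 := filter_and _ _ HQ1 (filter_and _ _ HQ2 (at_right_le (1/2) ltac:(lra)))).
  assert (A2 := filter_and _ _ HS1 (filter_and _ _ HS2 (at_left_ge (1/2) ltac:(lra)))).
  apply filter_ex in A1. apply filter_ex in A2.
  destruct A1 as [a [B1 [B2 B3]]]. destruct A2 as [b [C1 [C2 C3]]].
  destruct (H1 a b B1 C1) as [I1 [D1 E1]]. destruct (H2 a b B2 C2) as [I2 [D2 E2]].
  assert (I1 <= I2).
  { apply (is_RInt_le f g a b I1 I2); auto; [lra|]. intros; apply H; lra. }
  apply Rabs_def2 in E1. apply Rabs_def2 in E2. lra.
Qed.

Lemma int01_ge0 (f : R -> R) l : (forall t, 0 < t < 1 -> 0 <= f t) ->
  is_RInt_gen f (at_right 0) (at_left 1) l -> 0 <= l.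
Proof.
  intros H Hf. apply (int01_le (fun _ => 0) f); auto.
  apply is_RInt_gen_eps. intros eps He. exists (fun _ => True), (fun _ => True).
  split; [apply filter_true|split; [apply filter_true|]].
  intros a b _ _. exists ((b - a) * 0). split; [|rewrite Rmult_0_r, Rminus_diag, Rabs_R0; auto].
  exact (is_RInt_const (V := R_NormedModule) a b 0).
Qed.

Lemma int01_ext (f g : R -> R) l : (forall t, 0 < t < 1 -> f t = g t) ->
  is_RInt_gen f (at_right 0) (at_left 1) l -> is_RInt_gen g (at_right 0) (at_left 1) l.
Proof.
  intros H. apply is_RInt_gen_ext. apply Filter_prod with (fun t => 0 < t < 1) (fun t => 0 < t < 1).
  - apply at_right_01.
  - apply at_left_01.
  - intros x y Hx Hy t Ht. apply H. simpl in Ht. revert Ht. unfold Rmin, Rmax.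
      destruct (Rle_dec x y); lra.
Qed.

Lemma int01_unique (f : R -> R) l : is_RInt_gen f (at_right 0) (at_left 1) l -> int01 f = l.
Proof. intros H. exact (is_RInt_gen_unique (V := R_CompleteNormedModule) _ _ H). Qed.

Lemma int01_scal (f : R -> R) k l : is_RInt_gen f (at_right 0) (at_left 1) l -> is_RInt_gen (fun t
  => k * f t) (at_right 0) (at_left 1) (k * l).
Proof. exact (is_RInt_gen_scal (V := R_NormedModule) f k l). Qed.

(** On the unit interval the tails of the series are uniformly small, and the weight has finite
    mass; so the partial sums can be integrated term by term. *)
Lemma weight_series (W : R -> R) (m g : nat -> R) :
  (forall t, 0 < t < 1 -> continuous W t) -> (forall t, 0 < t < 1 -> 0 <= W t) ->
  (forall n, is_RInt_gen (fun t => W t * t ^ n) (at_right 0) (at_left 1) (m n)) ->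
  (forall n, 0 <= m n <= m O) ->
  ex_series (fun n => Rabs (g n)) ->
  is_RInt_gen (fun t => W t * PSeries g t) (at_right 0) (at_left 1) (Series (fun n => g n * m n)).
Proof.
  intros HWc HW0 HW Hm Hg.
  assert (Rg := rsummable_of_abs g Hg).
  destruct Hg as [G HG].
  assert (M0 : 0 <= m O) by apply (Hm O).
  assert (Hgm : is_series (fun n => g n * m n) (Series (fun n => g n * m n))).
  { apply Series_correct, ex_series_Rabs. apply ex_series_dom with (fun n => m O * Rabs (g n)).
    - intros n. split; [apply Rabs_pos|]. rewrite Rabs_mult, (Rabs_pos_eq (m n)) by apply Hm.
      pose proof (Rabs_pos (g n)). specialize (Hm n). nra.
    - apply (ex_series_scal (V := R_NormedModule)). eexists; exact HG. }
  set (S0 := Series (fun n => g n * m n)) in *.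
  apply is_RInt_gen_eps. intros eps He.
  set (e := eps / (2 * m O + 3)). assert (He' : 0 < e) by (apply Rdiv_lt_0_compat; lra).
  rewrite is_series_eps in HG. destruct (HG e He') as [N HN]. specialize (HN N (le_n _)).
  rewrite <- is_series_eps in HG. apply Rabs_def2 in HN.
  assert (F1 := RInt_gen_rsum (fun n t => g n * (W t * t ^ n)) (fun n => g n * m n) N (fun n =>
    int01_scal _ (g n) _ (HW n))).
  assert (F2 := HW O).
  rewrite is_RInt_gen_eps in F1, F2.
  destruct (F1 e He') as [Q1 [S1 [HQ1 [HS1 H1]]]]. destruct (F2 1 Rlt_0_1) as [Q2 [S2 [HQ2 [HS2
    H2]]]].
  exists (fun a => Q1 a /\ Q2 a /\ 0 < a <= 1/2), (fun b => S1 b /\ S2 b /\ 1/2 <= b < 1).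
  split; [|split].
  - apply filter_and; auto. apply filter_and; auto. apply at_right_le; lra.
  - apply filter_and; auto. apply filter_and; auto. apply at_left_ge; lra.
  - intros a b [A1 [A2 A3]] [B1 [B2 B3]].
    destruct (H1 a b A1 B1) as [I1 [D1 E1]]. destruct (H2 a b A2 B2) as [I2 [D2 E2]].
    assert (EX : ex_RInt (fun t => W t * PSeries g t) a b).
    { apply (ex_RInt_pos _ (fun x => 0 < x < 1)); [intros; lra| |lra|lra].
      intros x Hx. apply (continuous_mult (K := R_AbsRing)); [now apply HWc|apply rsummable_cont;
        auto].
      rewrite Rabs_pos_eq; lra. }
    destruct EX as [I HI]. exists I. split; [exact HI|].
    assert (K1 : Rabs (I - I1) <= e * I2).
    { assert (L := norm_RInt_le (V := R_NormedModule) (fun t => minus (W t * PSeries g t) (rsum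
        (fun n => g n * (W t * t ^ n)) N))
        (fun t => e * (W t * t ^ 0)) a b (minus I I1) (e * I2) ltac:(lra)).
      apply L; clear L.
      - intros x Hx. change (Rabs (W x * PSeries g x - rsum (fun n => g n * (W x * x ^ n)) N) <= e
          * (W x * x ^ 0)).
        assert (E : @eq R (rsum (fun n => g n * (W x * x ^ n)) N) (W x * rsum (fun n => g n * x ^
          n) N)).
        { rewrite <- rsum_mult_l. apply rsum_ext. intros n. ring. }
        rewrite E, <- Rmult_minus_distr_l, Rabs_mult, (Rabs_pos_eq (W x)) by (apply HW0; lra).
        simpl. rewrite Rmult_1_r, Rmult_comm. apply Rmult_le_compat_r; [apply HW0; lra|].
        eapply Rle_trans.
        + apply (series_tail (fun n => g n * x ^ n) (fun n => Rabs (g n)) (PSeries g x) G N).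
          * intros n. rewrite Rabs_mult. rewrite <- (Rmult_1_r (Rabs (g n))) at 2.
            apply Rmult_le_compat_l; [apply Rabs_pos|]. rewrite Rabs_pos_eq by (apply pow_le; lra).
            rewrite <- (pow1 n). apply pow_incr. lra.
          * apply rsummable_is; auto. rewrite Rabs_pos_eq; lra.
          * exact HG.
        + lra.
      - apply (is_RInt_minus (V := R_NormedModule)); auto.
      - apply (is_RInt_scal (V := R_NormedModule)); auto. }
    assert (K2 : Rabs (S0 - rsum (fun n => g n * m n) N) <= m O * e).
    { eapply Rle_trans.
      - apply (series_tail (fun n => g n * m n) (fun n => m O * Rabs (g n)) S0 (m O * G) N).
        + intros n. rewrite Rabs_mult, (Rabs_pos_eq (m n)) by apply Hm.
          pose proof (Rabs_pos (g n)). specialize (Hm n). nra.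
        + exact Hgm.
        + exact (is_series_scal (V := R_NormedModule) (m O) _ _ HG).
      - rewrite rsum_mult_l. rewrite <- Rmult_minus_distr_l. apply Rmult_le_compat_l; lra. }
    apply Rabs_def2 in E2. simpl in *.
    replace (I - S0) with ((I - I1) + (I1 - rsum (fun n => g n * m n) N) + - (S0 - rsum (fun n => g
      n * m n) N)) by ring.
    eapply Rle_lt_trans; [eapply Rle_trans; [apply Rabs_triang|apply Rplus_le_compat_r,
      Rabs_triang]|].
    rewrite Rabs_Ropp.
    assert (EE : eps = e * (2 * m O + 3)) by (unfold e; field; lra).
    assert (e * I2 <= e * (m O + 1)) by (apply Rmult_le_compat_l; lra).
    rewrite EE. nra.
Qed.

(** * Multipliers preserving nonnegativity on (0,1) *)

Definition log_moment (a s : R) (n : nat) : R := Gamma s / Rpower (a + INR n) s.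

Lemma log_weight_moment a s n : 0 < a -> 0 < s ->
  is_RInt_gen (fun t => log_weight a s t * t ^ n) (at_right 0) (at_left 1) (log_moment a s n).
Proof.
  intros Ha Hs. pose proof (pos_INR n).
  eapply int01_ext; [|apply (log_weight_int (a + INR n) s); lra].
  intros t Ht. unfold log_weight. rewrite <- Rpower_pow by lra.
    rewrite Rmult_assoc, <- Rpower_plus. do 2 f_equal. ring.
Qed.

Lemma Rpower_shift_le a s n : 0 < a -> 0 < s -> Rpower a s <= Rpower (a + INR n) s.
Proof. intros Ha Hs. pose proof (pos_INR n). apply Rle_Rpower_l; lra. Qed.

Lemma log_moment_bounds a s n : 0 < a -> 0 < s -> 0 <= log_moment a s n <= log_moment a s 0.
Proof.
  intros Ha Hs. destruct (Gamma_correct s Hs) as [_ G]. unfold log_moment.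
  pose proof (Rpower_pos (a + INR n) s). pose proof (Rpower_pos a s).
  simpl (INR 0). rewrite Rplus_0_r. split.
  - left. now apply Rdiv_lt_0_compat.
  - apply Rmult_le_compat_l; [lra|]. apply Rinv_le_contravar; auto. now apply Rpower_shift_le.
Qed.

Lemma rsummable_mult (m c : nat -> R) M : (forall n, Rabs (m n) <= M) -> rsummable c -> rsummable
  (fun n => m n * c n).
Proof.
  intros Hm Hc r Hr. apply ex_series_dom with (fun n => M * (Rabs (c n) * r ^ n)).
  - intros n. assert (0 <= r ^ n) by (apply pow_le; lra). pose proof (Rabs_pos (c n)).
      pose proof (Rabs_pos (m n)).
    rewrite Rabs_mult. split; [repeat apply Rmult_le_pos; auto|].
    rewrite Rmult_assoc. apply Rmult_le_compat_r; [now apply Rmult_le_pos|apply Hm].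
  - apply (ex_series_scal (V := R_NormedModule)). now apply Hc.
Qed.

Definition nonneg01 (c : nat -> R) := rsummable c /\ forall t, 0 < t < 1 -> 0 <= PSeries c t.
(** Sequences acting on power series by multiplication of coefficients. The moments of a positive
    measure on [0,1] are of this kind: multiplying coefficients by the integral of x^n averages t
    -> c (t x) over x. *)
Definition PosMult (m : nat -> R) := forall c, nonneg01 c -> nonneg01 (fun n => m n * c n).

Lemma nonneg01_ext c d : (forall n, c n = d n) -> nonneg01 c -> nonneg01 d.
Proof.
  intros E [H1 H2]. split.
  - intros r Hr. eapply ex_series_ext; [|apply (H1 r Hr)]. intros n. cbv beta. now rewrite E.
  - intros t Ht. rewrite <- (PSeries_ext c d t E). auto.
Qed.

Lemma PosMult_ext m k : (forall n, m n = k n) -> PosMult m -> PosMult k.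
Proof. intros E H c Hc. eapply nonneg01_ext; [|apply (H c Hc)]. intros n. cbv beta. now rewrite E.
  Qed.

Lemma PosMult_mult m k : PosMult m -> PosMult k -> PosMult (fun n => m n * k n).
Proof.
  intros H K c Hc. eapply nonneg01_ext; [|apply (H _ (K c Hc))]. intros n. cbv beta. ring.
Qed.

Lemma abs01 t : 0 < t < 1 -> Rabs t < 1.
Proof. intros H. rewrite Rabs_pos_eq; lra. Qed.

Lemma rsummable_plus c d : rsummable c -> rsummable d -> rsummable (fun n => c n + d n).
Proof.
  intros H1 H2 r Hr. apply ex_series_dom with (fun n => Rabs (c n) * r ^ n + Rabs (d n) * r ^ n).
  - intros n. assert (0 <= r ^ n) by (apply pow_le; lra). split; [apply Rmult_le_pos; auto;
      apply Rabs_pos|].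
    rewrite <- Rmult_plus_distr_r. apply Rmult_le_compat_r; auto. apply Rabs_triang.
  - apply (ex_series_plus (V := R_NormedModule)); auto.
Qed.

Lemma PS_plus_eq c d t : rsummable c -> rsummable d -> Rabs t < 1 ->
  PSeries (fun n => c n + d n) t = PSeries c t + PSeries d t.
Proof.
  intros H1 H2 Ht. apply is_series_unique.
  eapply is_series_ext; [|apply (is_series_plus (V := R_NormedModule));
    [apply (rsummable_is c t H1 Ht)|apply (rsummable_is d t H2 Ht)]].
  intros n. change plus with Rplus. cbv beta. simpl. ring.
Qed.

Lemma PS_scal_eq k c t : PSeries (fun n => k * c n) t = k * PSeries c t.
Proof. apply PSeries_scal. Qed.

Lemma PosMult_plus m k : PosMult m -> PosMult k -> PosMult (fun n => m n + k n).
Proof.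
  intros H K c Hc. destruct (H c Hc) as [A1 A2]. destruct (K c Hc) as [B1 B2].
  apply nonneg01_ext with (fun n => m n * c n + k n * c n); [intros; ring|]. split.
  - now apply rsummable_plus.
  - intros t Ht. rewrite PS_plus_eq; auto using abs01. specialize (A2 t Ht). specialize (B2 t Ht).
      lra.
Qed.

Lemma PosMult_const k : 0 <= k -> PosMult (fun _ => k).
Proof.
  intros Hk c [H1 H2]. split.
  - apply rsummable_mult with (Rabs k); auto. intros; lra.
  - intros t Ht. rewrite PS_scal_eq. apply Rmult_le_pos; auto.
Qed.

Lemma log_weight_series a s c t : 0 < a -> 0 < s -> rsummable c -> 0 < t < 1 ->
  is_RInt_gen (fun x => log_weight a s x * PSeries c (t * x)) (at_right 0) (at_left 1)
    (Gamma s * PSeries (fun n => / Rpower (a + INR n) s * c n) t).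
Proof.
  intros Ha Hs Hc Ht.
  assert (H := weight_series (log_weight a s) (log_moment a s) (fun n => c n * t ^ n)
    (log_weight_cont a s) (fun x _ => Rlt_le _ _ (log_weight_pos a s x)) (fun n =>
      log_weight_moment a s n Ha Hs)
    (fun n => log_moment_bounds a s n Ha Hs) (rsummable_abs c t Hc (abs01 t Ht))).
  replace (Gamma s * PSeries (fun n => / Rpower (a + INR n) s * c n) t) with
    (Series (fun n => c n * t ^ n * log_moment a s n)).
  - eapply int01_ext; [|exact H]. intros x Hx. cbv beta. f_equal. unfold PSeries. apply Series_ext.
      intros n.
    rewrite Rpow_mult_distr. ring.
  - unfold PSeries. rewrite <- Series_scal_l. apply Series_ext. intros n. unfold log_moment. 
    pose proof (Rpower_pos (a + INR n) s). field. lra.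
Qed.

(** These are, up to the factor Gamma s, the moments of [log_weight]. *)
Lemma PosMult_power a s : 0 < a -> 0 < s -> PosMult (fun n => / Rpower (a + INR n) s).
Proof.
  intros Ha Hs c [H1 H2]. destruct (Gamma_correct s Hs) as [_ G]. split.
  - apply rsummable_mult with (/ Rpower a s); auto. intros n.
    pose proof (Rpower_pos (a + INR n) s). pose proof (Rpower_pos a s).
    rewrite Rabs_pos_eq by (left; now apply Rinv_0_lt_compat). apply Rinv_le_contravar; auto.
      now apply Rpower_shift_le.
  - intros t Ht. assert (K := log_weight_series a s c t Ha Hs H1 Ht).
    assert (0 <= Gamma s * PSeries (fun n => / Rpower (a + INR n) s * c n) t).
    { refine (int01_ge0 _ _ _ K). intros x Hx. apply Rmult_le_pos; [left; apply log_weight_pos|].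
        apply H2. nra. }
    apply (Rmult_le_reg_l (Gamma s)); auto. lra.
Qed.

Lemma PosMult_inv a : 0 < a -> PosMult (fun n => / (a + INR n)).
Proof.
  intros Ha. apply PosMult_ext with (fun n => / Rpower (a + INR n) 1); [|apply PosMult_power; lra].
  intros n. rewrite Rpower_1; auto. pose proof (pos_INR n). lra.
Qed.

(** (b + n)/(a + n) = 1 + (b - a)/(a + n). *)
Lemma PosMult_ratio a b : 0 < a <= b -> PosMult (fun n => (b + INR n) / (a + INR n)).
Proof.
  intros H. apply PosMult_ext with (fun n => 1 + (b - a) * / (a + INR n)).
  - intros n. pose proof (pos_INR n). field. lra.
  - apply PosMult_plus; [apply PosMult_const; lra|]. apply PosMult_mult; [apply PosMult_const;
      lra|apply PosMult_inv; lra].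
Qed.

Lemma disc_summable_1 : disc_summable 1 (fun _ => 1%C).
Proof.
  intros r Hr. eapply ex_series_ext; [|apply ex_series_geom; rewrite Rabs_pos_eq; [apply Hr|lra]].
  intros n. change (@eq R (r ^ n) (Cmod 1 * r ^ n)). rewrite Cmod_1. ring.
Qed.

Lemma one_minus_neq0 w : Cmod w < 1 -> (1 - w)%C <> 0%C.
Proof.
  intros H E. assert (w = 1%C) by (replace w with (1 - (1 - w))%C by ring; rewrite E; ring).
  rewrite H0, Cmod_1 in H. lra.
Qed.

Lemma CPSeries_step a w : disc_summable 1 a -> Cmod w < 1 -> CPSeries a w = (a O + w * CPSeries
  (fun n => a (S n)) w)%C.
Proof.
  intros Ha Hw.
  assert (H := is_Cseries_incr_1 _ _ (CPSeries_correct 1 a w Ha Hw)). cbv beta in H.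
  destruct (Ceq_dec w 0) as [->|Hw0].
  { rewrite CPSeries_0. ring. }
  assert (K : CPSeries (fun n => a (S n)) w = ((CPSeries a w - a O * w ^ 0) / w)%C).
  { apply Cseries_unique. eapply is_Cseries_ext; [|replace ((CPSeries a w - a 0%nat * w ^ 0) / w)%C
      with (/ w * (CPSeries a w - a 0%nat * w ^ 0))%C by (field; auto); apply is_Cseries_scal;
      exact H].
    intros n. simpl. field. auto. }
  rewrite K. simpl. field. auto.
Qed.

Lemma CPSeries_geom w : Cmod w < 1 -> CPSeries (fun _ => 1%C) w = (/ (1 - w))%C.
Proof.
  intros H. pose proof (one_minus_neq0 w H) as N.
  pose proof (CPSeries_step _ w disc_summable_1 H) as K.
  set (G := CPSeries (fun _ => 1%C) w) in *.
  replace G with ((G - w * G) / (1 - w))%C by (field; auto).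
  rewrite K at 1. field. auto.
Qed.

Lemma disc_summable_plus Rd a b : disc_summable Rd a -> disc_summable Rd b -> disc_summable Rd (fun
  n => a n + b n)%C.
Proof.
  intros H1 H2 r Hr. apply ex_series_dom with (fun n => Cmod (a n) * r ^ n + Cmod (b n) * r ^ n).
  - intros n. assert (0 <= r ^ n) by (apply pow_le; lra). split; [apply Rmult_le_pos; auto;
      apply Cmod_ge_0|].
    rewrite <- Rmult_plus_distr_r. apply Rmult_le_compat_r; auto. apply Cmod_triangle.
  - apply (ex_series_plus (V := R_NormedModule)); auto.
Qed.

Lemma disc_summable_scal Rd k a : disc_summable Rd a -> disc_summable Rd (fun n => k * a n)%C.
Proof.
  intros H r Hr. eapply ex_series_ext; [|apply (ex_series_scal (V := R_NormedModule) (Cmod k) _ (H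
    r Hr))].
  intros n. cbv beta. rewrite Cmod_mult. change (@eq R (Cmod k * (Cmod (a n) * r ^ n)) (Cmod k *
    Cmod (a n) * r ^ n)). ring.
Qed.

Lemma disc_summable_ext Rd a b : (forall n, a n = b n) -> disc_summable Rd a -> disc_summable Rd b.
Proof. intros E H r Hr. eapply ex_series_ext; [|apply (H r Hr)]. intros n. cbv beta. now rewrite E.
  Qed.

Lemma CPSeries_plus Rd a b w : disc_summable Rd a -> disc_summable Rd b -> Cmod w < Rd -> CPSeries
  (fun n => a n + b n)%C w = (CPSeries a w + CPSeries b w)%C.
Proof.
  intros H1 H2 Hw. apply Cseries_unique. eapply is_Cseries_ext; [|apply is_Cseries_plus;
    [apply (CPSeries_correct Rd a w)|apply (CPSeries_correct Rd b w)]]; auto.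
  intros n. cbv beta. ring.
Qed.

Lemma CPSeries_scal Rd k a w : disc_summable Rd a -> Cmod w < Rd -> CPSeries (fun n => k * a n)%C w
  = (k * CPSeries a w)%C.
Proof.
  intros H1 Hw. apply Cseries_unique. eapply is_Cseries_ext; [|apply is_Cseries_scal;
    apply (CPSeries_correct Rd a w)]; auto.
  intros n. cbv beta. ring.
Qed.

Lemma CPSeries_ext a b w : (forall n, a n = b n) -> CPSeries a w = CPSeries b w.
Proof. intros E. unfold CPSeries, Cseries. f_equal; apply Series_ext; intros n; now rewrite E. Qed.

Lemma disc_summable_succ : disc_summable 1 (fun n => RtoC (INR (S n))).
Proof.
  eapply disc_summable_ext; [|apply disc_summable_derive_coef, disc_summable_1]. intros n.
    unfold derive_coef. ring.
Qed.

Lemma disc_summable_nat : disc_summable 1 (fun n => RtoC (INR n)).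
Proof.
  apply disc_summable_ext with (fun n => RtoC (INR (S n)) + (-(1)) * 1)%C.
  - intros n. rewrite S_INR, RtoC_plus. ring.
  - apply disc_summable_plus; [apply disc_summable_succ|apply disc_summable_scal, disc_summable_1].
Qed.

Lemma CPSeries_succ w : Cmod w < 1 -> CPSeries (fun n => RtoC (INR (S n))) w = (/ (1 - w) ^ 2)%C.
Proof.
  intros H. pose proof (one_minus_neq0 w H) as N.
  assert (E : CPSeries (fun n => RtoC (INR (S n))) w = (CPSeries (fun n => RtoC (INR n)) w +
    CPSeries (fun _ => 1%C) w)%C).
  { rewrite <- (CPSeries_plus 1) by auto using disc_summable_nat, disc_summable_1.
      apply CPSeries_ext. intros n. now rewrite S_INR, RtoC_plus. }
  rewrite (CPSeries_step (fun n => RtoC (INR n))), CPSeries_geom in E by auto using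
    disc_summable_nat.
  set (T := CPSeries (fun n => RtoC (INR (S n))) w) in *.
  replace T with ((T - w * T) / (1 - w))%C by (field; auto).
  rewrite E at 1. simpl INR. field. auto.
Qed.

Lemma CPSeries_nat w : Cmod w < 1 -> CPSeries (fun n => RtoC (INR n)) w = (w / (1 - w) ^ 2)%C.
Proof.
  intros H. rewrite (CPSeries_step (fun n => RtoC (INR n))), CPSeries_succ by auto using
    disc_summable_nat.
  simpl INR. unfold Cdiv. ring.
Qed.

(** * The double primitive inequality *)

(** The difference between the coefficients of a test function for starlikeness, evaluated in the
    direction z, and those of the extremal case z = -1, eps = 1. Its constant coefficient is 0. *)
Definition test_coef (eps z : C) (n : nat) : R := Re ((1 + RtoC (INR n) * eps) * z ^ n)%C - (-1) ^
  n * INR (S n).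

Lemma disc_summable_test eps : disc_summable 1 (fun n => 1 + RtoC (INR n) * eps)%C.
Proof.
  apply disc_summable_plus; [apply disc_summable_1|].
  apply disc_summable_ext with (fun n => eps * RtoC (INR n))%C; [intros; ring|].
  apply disc_summable_scal, disc_summable_nat.
Qed.

Lemma CPSeries_test eps w : Cmod w < 1 -> CPSeries (fun n => 1 + RtoC (INR n) * eps)%C w = (/ (1 -
  w) + eps * (w / (1 - w) ^ 2))%C.
Proof.
  intros H. rewrite (CPSeries_plus 1); auto using disc_summable_1.
  2:{ apply disc_summable_ext with (fun n => eps * RtoC (INR n))%C; [intros; ring|].
    apply disc_summable_scal, disc_summable_nat. }
  rewrite CPSeries_geom by auto. f_equal.
  rewrite (CPSeries_ext _ (fun n => eps * RtoC (INR n))%C) by (intros; ring).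
  rewrite (CPSeries_scal 1), CPSeries_nat by auto using disc_summable_nat. reflexivity.
Qed.

Lemma is_series_Re_CPSeries a z t : disc_summable 1 a -> Cmod z <= 1 -> Rabs t < 1 ->
  is_series (fun n => Re (a n * z ^ n)%C * t ^ n) (Re (CPSeries a (RtoC t * z))).
Proof.
  intros Ha Hz Ht.
  assert (Hw : Cmod (RtoC t * z) < 1).
  { rewrite Cmod_mult, Cmod_R. pose proof (Rabs_pos t). pose proof (Cmod_ge_0 z). nra. }
  pose proof (CPSeries_correct 1 a _ Ha Hw) as K. apply is_Cseries_comp in K. destruct K as [K _].
  eapply is_series_ext; [|exact K]. intros n. cbv beta.
  rewrite Cpow_mult_l, <- RtoC_pow.
  replace (a n * (RtoC (t ^ n) * z ^ n))%C with (RtoC (t ^ n) * (a n * z ^ n))%C by ring.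
    rewrite re_scal_l.
  apply Rmult_comm.
Qed.

Lemma rsummable_Re a z : disc_summable 1 a -> Cmod z <= 1 -> rsummable (fun n => Re (a n * z ^
  n)%C).
Proof.
  intros Ha Hz r Hr. apply ex_series_dom with (fun n => Cmod (a n) * r ^ n); auto.
  intros n. assert (0 <= r ^ n) by (apply pow_le; lra). split; [apply Rmult_le_pos; auto;
    apply Rabs_pos|].
  apply Rmult_le_compat_r; auto. eapply Rle_trans; [apply re_le_Cmod|]. rewrite Cmod_mult, Cmod_pow.
  rewrite <- (Rmult_1_r (Cmod (a n))) at 2. apply Rmult_le_compat_l; [apply Cmod_ge_0|].
  rewrite <- (pow1 n). apply pow_incr. split; [apply Cmod_ge_0|auto].
Qed.

Lemma Cmod_minus1_le : Cmod (RtoC (-1)) <= 1.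
Proof. rewrite Cmod_R. rewrite Rabs_left; lra. Qed.

Lemma test_coef_alt_eq n : Re (RtoC (INR (S n)) * (RtoC (-1)) ^ n)%C = (-1) ^ n * INR (S n).
Proof. rewrite <- RtoC_pow, re_scal_l. unfold Re, RtoC; simpl fst. ring. Qed.

Lemma test_coef_rsummable eps z : Cmod z <= 1 -> rsummable (test_coef eps z).
Proof.
  intros Hz.
  assert (H1 := rsummable_Re _ z (disc_summable_test eps) Hz).
  assert (H2 := rsummable_Re _ _ disc_summable_succ Cmod_minus1_le).
  assert (H3 := rsummable_mult (fun _ => -1) _ 1 ltac:(intros; rewrite Rabs_left; lra) H2).
  intros r Hr. eapply ex_series_ext; [|apply (rsummable_plus _ _ H1 H3 r Hr)].
  intros n. cbv beta. unfold test_coef. rewrite test_coef_alt_eq. do 2 f_equal. ring.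
Qed.

Lemma test_coef_sum eps z t : Cmod z <= 1 -> 0 <= t < 1 ->
  PSeries (test_coef eps z) t = Re (/ (1 - RtoC t * z) + eps * (RtoC t * z / (1 - RtoC t * z) ^
    2))%C - / (1 + t) ^ 2.
Proof.
  intros Hz Ht. assert (At : Rabs t < 1) by (rewrite Rabs_pos_eq; lra).
  assert (Hw : Cmod (RtoC t * z) < 1).
  { rewrite Cmod_mult, Cmod_R. pose proof (Rabs_pos t). pose proof (Cmod_ge_0 z). nra. }
  apply is_series_unique.
  assert (K1 := is_series_Re_CPSeries _ z t (disc_summable_test eps) Hz At).
  assert (K2 := is_series_Re_CPSeries _ _ t disc_summable_succ Cmod_minus1_le At).
  rewrite CPSeries_test in K1 by auto.
  rewrite CPSeries_succ in K2.
  2:{ rewrite <- RtoC_mult, Cmod_R. replace (t * -1) with (- t) by ring. rewrite Rabs_Ropp. auto. }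
  replace (Re (/ (1 - RtoC t * RtoC (-1)) ^ 2)%C) with (/ (1 + t) ^ 2) in K2.
  2:{ replace (1 - RtoC t * RtoC (-1))%C with (RtoC (1 + t)) by (rewrite <- RtoC_mult, <-
    RtoC_minus; f_equal; ring).
      rewrite <- RtoC_pow, <- RtoC_inv; [reflexivity|]. apply pow_nonzero. lra. }
  eapply is_series_ext; [|exact (is_series_minus (V := R_NormedModule) _ _ _ _ K1 K2)].
  intros n. unfold test_coef.
  change (@eq R (Re ((1 + RtoC (INR n) * eps) * z ^ n)%C * t ^ n + - (Re (RtoC (INR (S n)) * RtoC
    (-1) ^ n)%C * t ^ n))
    ((Re ((1 + RtoC (INR n) * eps) * z ^ n)%C - (-1) ^ n * INR (S n)) * t ^ n)).
  rewrite test_coef_alt_eq. ring.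
Qed.

(** Write eps = 1/2 + eta with |eta| <= 1/2: the term with 1/2 is computed exactly and the one
    with eta is bounded by its modulus. Here Rr = |1 - t z|^2 and p is the real part of 1 - t z,
    so the square of the imaginary part is Rr - p^2. *)
Lemma test_coef_pointwise eps z t : Cmod z = 1 -> Cmod (eps - RtoC (1/2)) <= 1/2 -> 0 <= t < 1 ->
  let p := 1 - t * Re z in let Rr := 1 - 2 * t * Re z + t ^ 2 in
  0 < Rr /\
  p / (2 * Rr) + p ^ 2 / Rr ^ 2 - 1 / (2 * Rr) - t / (2 * Rr) <=
  Re (/ (1 - RtoC t * z) + eps * (RtoC t * z / (1 - RtoC t * z) ^ 2))%C.
Proof.
  intros Hz He Ht p Rr.
  assert (Hxy : Re z ^ 2 + Im z ^ 2 = 1) by (rewrite <- Cmod2_alt, Hz; ring).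
  assert (ER : Rr = p ^ 2 + (t * Im z) ^ 2) by (unfold Rr, p; rewrite Rpow_mult_distr; nra).
  assert (Hx : Re z <= 1) by (pose proof (pow2_ge_0 (Im z)); nra).
  assert (Pp : 0 < p) by (unfold p; nra).
  assert (PR : 0 < Rr) by (rewrite ER; pose proof (pow2_ge_0 (t * Im z)); nra).
  split; [exact PR|].
  set (w := (RtoC t * z)%C).
  assert (Ew : (1 - w)%C = (p, - (t * Im z))).
  { unfold w, p. destruct z as [x y]. unfold Cminus, Cplus, Copp, Cmult, RtoC, Re, Im; simpl.
      f_equal; ring. }
  assert (Nw : (1 - w)%C <> 0%C) by (rewrite Ew; intro E; injection E; lra).
  assert (M2 : Cmod (1 - w) ^ 2 = Rr).
  { rewrite Cmod2_alt, Ew. simpl Re. simpl Im. rewrite ER. simpl. ring. }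
  assert (EI : (/ (1 - w))%C = (p / Rr, t * Im z / Rr)).
  { rewrite Ew. unfold Cinv. simpl fst. simpl snd. rewrite ER. f_equal; field; rewrite <- ?ER;
      try lra;
      replace (p ^ 2 + (- (t * Im z)) ^ 2) with Rr by (rewrite ER; ring); lra. }
  assert (EK : (w / (1 - w) ^ 2)%C = (/ (1 - w) * / (1 - w) - / (1 - w))%C).
  { field. auto. }
  assert (RK : Re (w / (1 - w) ^ 2)%C = (2 * p ^ 2 - Rr) / Rr ^ 2 - p / Rr).
  { rewrite EK, EI. unfold Cminus, Cplus, Copp, Cmult, Re; simpl fst; simpl snd.
    replace (2 * p ^ 2 - Rr) with (p ^ 2 - (t * Im z) ^ 2) by (rewrite ER; ring). field. lra. }
  assert (RI : Re (/ (1 - w))%C = p / Rr) by (rewrite EI; reflexivity).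
  assert (MK : Cmod (w / (1 - w) ^ 2)%C = t / Rr).
  { rewrite Cmod_div by (apply Cpow_nz; auto). rewrite Cmod_pow, M2. unfold w.
      rewrite Cmod_mult, Hz, Cmod_R, Rabs_pos_eq; lra. }
  replace eps with (RtoC (1/2) + (eps - RtoC (1/2)))%C by ring.
  rewrite Cmult_plus_distr_r, !re_plus, re_scal_l, RI, RK.
  assert (B : - (t / (2 * Rr)) <= Re ((eps - RtoC (1 / 2)) * (w / (1 - w) ^ 2))%C).
  { pose proof (re_le_Cmod ((eps - RtoC (1 / 2)) * (w / (1 - w) ^ 2))%C) as L.
    rewrite Cmod_mult, MK in L.
    assert (0 <= t / Rr) by (apply Rmult_le_pos; [lra|left; now apply Rinv_0_lt_compat]).
    assert (L2 : Cmod (eps - RtoC (1/2)) * (t / Rr) <= 1/2 * (t / Rr)) by (apply Rmult_le_compat_r;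
      auto).
    replace (t / (2 * Rr)) with (1/2 * (t / Rr)) by (field; lra).
    pose proof (Rabs_maj2 (Re ((eps - RtoC (1 / 2)) * (w / (1 - w) ^ 2))%C)). lra. }
  apply Rle_trans with (p / Rr + (1 / 2 * ((2 * p ^ 2 - Rr) / Rr ^ 2 - p / Rr) + - (t / (2 * Rr)))).
  - right. field. lra.
  - lra.
Qed.

Lemma derive_nonneg_le (f df : R -> R) a b : a <= b -> (forall x, a <= x <= b -> is_derive f x (df
  x)) ->
  (forall x, a <= x <= b -> 0 <= df x) -> f a <= f b.
Proof.
  intros Hab Hd Hp. destruct (MVT_gen f a b df) as [c [Hc E]].
  - intros x Hx. apply Hd. rewrite Rmin_left, Rmax_right in Hx; lra.
  - intros x Hx. rewrite Rmin_left, Rmax_right in Hx by lra. apply continuity_pt_filterlim.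
    apply (ex_derive_continuous (K := R_AbsRing) (V := R_NormedModule)). eexists. apply Hd. lra.
  - rewrite Rmin_left, Rmax_right in Hc by lra. specialize (Hp c Hc). nra.
Qed.

Lemma rsummable_Int c : rsummable c -> rsummable (PS_Int c).
Proof.
  intros H r Hr. apply ex_series_incr_1.
  apply ex_series_dom with (fun n => Rabs (c n) * r ^ n); auto.
  intros n. change (PS_Int c (S n)) with (c n / INR (S n)).
    assert (P : 0 <= r ^ n) by (apply pow_le; lra).
  assert (I : 1 <= INR (S n)) by (apply (le_INR 1); lia).
  split; [apply Rmult_le_pos; [apply Rabs_pos|apply pow_le; lra]|].
  unfold Rdiv. rewrite Rabs_mult, (Rabs_pos_eq (/ _)) by (left; apply Rinv_0_lt_compat; lra).
  pose proof (Rabs_pos (c n)). simpl pow.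
  assert (/ INR (S n) <= 1) by (rewrite <- Rinv_1; apply Rinv_le_contravar; lra).
  assert (0 < / INR (S n)) by (apply Rinv_0_lt_compat; lra).
  assert (A1 : Rabs (c n) * / INR (S n) <= Rabs (c n)) by nra.
  assert (A2 : r * r ^ n <= r ^ n) by nra.
  assert (A3 : 0 <= r * r ^ n) by (apply Rmult_le_pos; [apply Hr|exact P]).
  assert (A4 : 0 <= Rabs (c n) * / INR (S n)) by (apply Rmult_le_pos; lra).
  exact (Rmult_le_compat _ _ _ _ A4 A3 A1 A2).
Qed.

Lemma PS_Int_deriv c x : rsummable c -> Rabs x < 1 -> is_derive (PSeries (PS_Int c)) x (PSeries c
  x).
Proof.
  intros H Hx. replace (PSeries c x) with (PSeries (PS_derive (PS_Int c)) x).
  - apply is_derive_PSeries. apply rsummable_CV; auto. now apply rsummable_Int.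
  - apply PSeries_ext. intros n. unfold PS_derive. change (PS_Int c (S n)) with (c n / INR (S n)).
      field. apply not_0_INR. lia.
Qed.

Lemma PS_Int_0 c : PSeries (PS_Int c) 0 = 0.
Proof. rewrite PSeries_0. reflexivity. Qed.

(** Let A be the sum of the series, U and W its first two primitives, D the lower bound for A given
    by [test_coef_pointwise], and w0 (t) = t (1-t)/(1+t). The bound D changes sign, but it is explicitly
    integrable: w0 D is the derivative of w0 G, where G (t) = (1+c) t^2 (1-t) / (2 (1+t) R (t)) >= 0,
    c = Re z and R (t) = |1 - t z|^2. Since (a-t)/w0 (t) decreases, the derivative of (a-t) G is at
    most (a-t) D, hence at most (a-t) A, which is the derivative of (a-t) U + W. Integrating from 0
    to a gives W (a) >= 0. *)
Lemma double_primitive_nonneg eps z a : Cmod z = 1 -> Cmod (eps - RtoC (1/2)) <= 1/2 -> 0 < a < 1 ->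
  0 <= PSeries (PS_Int (PS_Int (test_coef eps z))) a.
Proof.
  intros Hz He Ha. set (A := test_coef eps z). set (c := Re z).
  assert (HA : rsummable A) by (apply test_coef_rsummable; lra).
  assert (HA1 := rsummable_Int _ HA).
  set (U := PSeries (PS_Int A)). set (W := PSeries (PS_Int (PS_Int A))).
  assert (Hc : -1 <= c <= 1).
  { pose proof (re_le_Cmod z) as K. rewrite Hz in K. apply Rabs_le_between in K. exact K. }
  set (Rr := fun t => 1 - 2 * t * c + t ^ 2).
  set (G := fun t => (1 + c) * t ^ 2 * (1 - t) / (2 * (1 + t) * Rr t)).
  set (G' := fun t => (1 + c) / 2 * ((2 * t - 3 * t ^ 2) * ((1 + t) * Rr t) - t ^ 2 * (1 - t) * (Rr
    t + (1 + t) * (2 * t - 2 * c))) / ((1 + t) * Rr t) ^ 2).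
  assert (PR : forall t, 0 <= t < 1 -> 0 < Rr t).
  { intros t Ht. apply (test_coef_pointwise eps z t Hz He Ht). }
  assert (M := derive_nonneg_le (fun t => (a - t) * U t + W t - (a - t) * G t)
     (fun t => (a - t) * PSeries A t - (- G t + (a - t) * G' t)) 0 a).
  cbv beta in M.
  replace ((a - 0) * U 0 + W 0 - (a - 0) * G 0) with 0 in M.
  2:{ unfold U, W. rewrite !PS_Int_0. unfold G. specialize (PR 0 ltac:(lra)). field. lra. }
  replace ((a - a) * U a + W a - (a - a) * G a) with (W a) in M by ring.
  apply M; [lra| |].
  - intros t Ht. assert (At : Rabs t < 1) by (rewrite Rabs_pos_eq; lra).
    assert (DU : is_derive U t (PSeries A t)) by (apply PS_Int_deriv; auto).
    assert (DW : is_derive W t (U t)) by (apply PS_Int_deriv; auto).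
    assert (DG : is_derive G t (G' t)).
    { unfold G, G', Rr. specialize (PR t ltac:(lra)). unfold Rr in PR. auto_derive.
      - apply Rgt_not_eq. apply Rmult_lt_0_compat; lra.
      - field. split; lra. }
    assert (DL : is_derive (fun x => a - x) t (-1)) by (auto_derive; auto; ring).
    assert (D1 := is_derive_mult (fun x => a - x) U t _ _ DL DU Rmult_comm).
    assert (D2 := is_derive_mult (fun x => a - x) G t _ _ DL DG Rmult_comm).
    assert (D3 := is_derive_minus (V := R_NormedModule) _ _ _ _ _ (is_derive_plus (V :=
      R_NormedModule) _ _ _ _ _ D1 DW) D2).
    eapply is_derive_ext; [|replace ((a - t) * PSeries A t - (- G t + (a - t) * G' t)) with
       ((-1 * U t + (a - t) * PSeries A t + U t) - (-1 * G t + (a - t) * G' t)) by ring; exact D3].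
    intros x. reflexivity.
  - intros t Ht.
    destruct (test_coef_pointwise eps z t Hz He ltac:(lra)) as [_ B]. fold c in B. fold (Rr t) in B.
    assert (EA := test_coef_sum eps z t ltac:(lra) ltac:(lra)). fold A in EA.
    specialize (PR t ltac:(lra)).
    set (D := (1 - t * c) / (2 * Rr t) + (1 - t * c) ^ 2 / Rr t ^ 2 - 1 / (2 * Rr t) - t / (2 * Rr
      t)) in *.
    assert (LB : D - / (1 + t) ^ 2 <= PSeries A t) by lra.
    (* The difference between (a-t) D and the derivative of (a-t) G. *)
    assert (ID : (a - t) * (D - / (1 + t) ^ 2) - (- G t + (a - t) * G' t) =
       (1 + c) * t / (2 * (1 + t) ^ 2 * Rr t) * (a * (1 - t ^ 2) - 2 * t * (a - t))).
    { unfold D, G, G', Rr. unfold Rr in PR. field. split; lra. }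
    assert (NN : 0 <= (1 + c) * t / (2 * (1 + t) ^ 2 * Rr t) * (a * (1 - t ^ 2) - 2 * t * (a - t))).
    { apply Rmult_le_pos.
      - apply Rmult_le_pos; [nra|]. left. apply Rinv_0_lt_compat. apply Rmult_lt_0_compat; auto.
          assert (0 < (1 + t) ^ 2) by (apply pow_lt; lra). lra.
      - nra. }
    assert ((a - t) * (D - / (1 + t) ^ 2) <= (a - t) * PSeries A t) by (apply Rmult_le_compat_l;
      lra).
    lra.
Qed.

(** * The extremal series and its decrease *)

(** Coefficients of the derivative (1-t)/(1+t)^3 of t/(1+t)^2; dividing them by (1 + mu n)(1 + nu
    n) gives q. *)
Definition dkoebe_coef (n : nat) : R := (-1) ^ n * INR (S n) ^ 2.

Lemma rsummable_derive c : rsummable c -> rsummable (PS_derive c).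
Proof.
  intros H r Hr. assert (K : disc_summable 1 (fun n => RtoC (c n))).
  { intros x Hx. eapply ex_series_ext; [|apply (H x Hx)]. intros n. cbv beta. now rewrite Cmod_R. }
  apply disc_summable_derive_coef in K. eapply ex_series_ext; [|apply (K r Hr)].
  intros n. unfold derive_coef, PS_derive. now rewrite <- RtoC_mult, Cmod_R.
Qed.

(** Coefficients of t/(1+t)^2, a rotation of the Koebe function; the form as a real part lets its
    convergence be read off from the complex series. *)
Definition koebe_coef (n : nat) : R := - (Re (RtoC (INR n) * RtoC (-1) ^ n)%C).
Lemma koebe_coef_eq n : koebe_coef n = - (INR n * (-1) ^ n).
Proof. unfold koebe_coef. rewrite <- RtoC_pow, re_scal_l. reflexivity. Qed.

Lemma koebe_coef_rsummable : rsummable koebe_coef.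
Proof.
  assert (H := rsummable_Re _ _ disc_summable_nat Cmod_minus1_le).
  intros r Hr. eapply ex_series_ext; [|apply (H r Hr)]. intros n. unfold koebe_coef.
    now rewrite Rabs_Ropp.
Qed.

Lemma koebe_coef_sum t : Rabs t < 1 -> PSeries koebe_coef t = t / (1 + t) ^ 2.
Proof.
  intros Ht. apply is_series_unique.
  assert (K := is_series_Re_CPSeries _ _ t disc_summable_nat Cmod_minus1_le Ht).
  assert (Ht' := Rabs_def2 _ _ Ht).
  rewrite CPSeries_nat in K.
  2:{ rewrite <- RtoC_mult, Cmod_R. replace (t * -1) with (- t) by ring. now rewrite Rabs_Ropp. }
  assert (E : (RtoC t * RtoC (-1) / (1 - RtoC t * RtoC (-1)) ^ 2)%C = RtoC (- (t / (1 + t) ^ 2))).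
  { replace (1 - RtoC t * RtoC (-1))%C with (RtoC (1 + t)) by (rewrite <- RtoC_mult, <- RtoC_minus;
      f_equal; ring).
    rewrite <- RtoC_pow, <- RtoC_mult, <- RtoC_div; [f_equal; field; lra|apply pow_nonzero; lra]. }
  rewrite E in K. change (Re (RtoC (- (t / (1 + t) ^ 2)))) with (- (t / (1 + t) ^ 2)) in K.
  replace (t / (1 + t) ^ 2) with (- - (t / (1 + t) ^ 2)) by ring.
  eapply is_series_ext; [|exact (is_series_opp (V := R_NormedModule) _ _ K)].
  intros n. unfold koebe_coef. change (@eq R (- (Re (RtoC (INR n) * RtoC (-1) ^ n)%C * t ^ n)) (-
    Re (RtoC (INR n) * RtoC (-1) ^ n)%C * t ^ n)). ring.
Qed.

Lemma dkoebe_coef_derive n : dkoebe_coef n = PS_derive koebe_coef n.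
Proof. unfold PS_derive, dkoebe_coef. rewrite koebe_coef_eq.
  change ((-1) ^ S n) with (-1 * (-1) ^ n). ring. Qed.

Lemma dkoebe_coef_rsummable : rsummable dkoebe_coef.
Proof.
  assert (H := rsummable_derive _ koebe_coef_rsummable). intros r Hr. eapply ex_series_ext;
    [|apply (H r Hr)].
  intros n. cbv beta. now rewrite dkoebe_coef_derive.
Qed.

Lemma locally_abs1 t : Rabs t < 1 -> locally t (fun y => Rabs y < 1).
Proof.
  intros H. exists (mkposreal (1 - Rabs t) ltac:(lra)). intros y Hy.
    change (Rabs (y - t) < 1 - Rabs t) in Hy.
  replace y with ((y - t) + t) by ring. eapply Rle_lt_trans; [apply Rabs_triang|lra].
Qed.

Lemma PS_deriv c t : rsummable c -> Rabs t < 1 -> is_derive (PSeries c) t (PSeries (PS_derive c) t).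
Proof. intros H Ht. apply is_derive_PSeries. now apply rsummable_CV. Qed.

Lemma dkoebe_coef_sum t : Rabs t < 1 -> PSeries dkoebe_coef t = (1 - t) / (1 + t) ^ 3.
Proof.
  intros Ht. assert (Ht' := Rabs_def2 _ _ Ht).
  rewrite (PSeries_ext dkoebe_coef (PS_derive koebe_coef) t dkoebe_coef_derive).
  rewrite <- (is_derive_unique _ _ _ (PS_deriv koebe_coef t koebe_coef_rsummable Ht)).
  apply is_derive_unique. apply (is_derive_ext_loc (fun t => t / (1 + t) ^ 2)).
  - generalize (locally_abs1 t Ht). apply filter_imp. intros y Hy. symmetry.
      now apply koebe_coef_sum.
  - auto_derive; [|field; lra]. apply Rgt_not_eq. simpl. repeat apply Rmult_lt_0_compat; lra.
Qed.

Lemma dkoebe_coef_sum' t : Rabs t < 1 -> PSeries (PS_derive dkoebe_coef) t = (2 * t - 4) / (1 + t)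
  ^ 4.
Proof.
  intros Ht. assert (Ht' := Rabs_def2 _ _ Ht).
  rewrite <- (is_derive_unique _ _ _ (PS_deriv dkoebe_coef t dkoebe_coef_rsummable Ht)).
  apply is_derive_unique. apply (is_derive_ext_loc (fun t => (1 - t) / (1 + t) ^ 3)).
  - generalize (locally_abs1 t Ht). apply filter_imp. intros y Hy. symmetry.
      now apply dkoebe_coef_sum.
  - auto_derive; [|field; lra]. apply Rgt_not_eq. simpl. repeat apply Rmult_lt_0_compat; lra.
Qed.

Lemma euler_rsummable c : rsummable c -> rsummable (fun n => INR n * c n).
Proof.
  intros H. assert (K := rsummable_derive _ H). intros r Hr. apply ex_series_incr_1.
  apply ex_series_dom with (fun n => Rabs (PS_derive c n) * r ^ n); auto.
  intros n. unfold PS_derive. assert (0 <= r ^ n) by (apply pow_le; lra). simpl pow.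
  pose proof (Rabs_pos (INR (S n) * c (S n))).
  split; [apply Rmult_le_pos; auto; apply Rmult_le_pos; lra|]. apply Rmult_le_compat_l; auto. nra.
Qed.

Lemma euler_sum c t : rsummable c -> Rabs t < 1 -> PSeries (fun n => INR n * c n) t = t * PSeries
  (PS_derive c) t.
Proof.
  intros H Ht. rewrite PSeries_decr_1.
  - simpl INR. rewrite Rmult_0_l, Rplus_0_l. reflexivity.
  - apply CV_radius_inside, rsummable_CV; auto. now apply euler_rsummable.
Qed.

(** Coefficients of -t K'(t) for K (t) = (1-t)/(1+t)^3: its nonnegativity expresses that K
    decreases, in a form to which positive multipliers apply. *)
Definition dkoebe_drop (n : nat) : R := - (INR n * dkoebe_coef n).
Lemma dkoebe_drop_bound t : 0 < t < 1 -> t / 8 <= PSeries dkoebe_drop t.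
Proof.
  intros Ht. unfold dkoebe_drop. rewrite (PSeries_ext _ (fun n => (-1) * (INR n * dkoebe_coef n)))
    by (intros; ring).
  rewrite PS_scal_eq, euler_sum, dkoebe_coef_sum' by auto using dkoebe_coef_rsummable, abs01.
  apply (Rmult_le_reg_r ((1 + t) ^ 4)); [apply pow_lt; lra|].
  replace (-1 * (t * ((2 * t - 4) / (1 + t) ^ 4)) * (1 + t) ^ 4) with (t * (4 - 2 * t)) by (field;
    lra).
  assert ((1 + t) ^ 4 <= 16). { replace 16 with (2 ^ 4) by ring. apply pow_incr. lra. }
  unfold Rdiv. rewrite Rmult_assoc. apply Rmult_le_compat_l; lra.
Qed.

Lemma dkoebe_drop_rsummable : rsummable dkoebe_drop.
Proof.
  assert (H := euler_rsummable _ dkoebe_coef_rsummable). intros r Hr. eapply ex_series_ext;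
    [|apply (H r Hr)].
  intros n. unfold dkoebe_drop. now rewrite Rabs_Ropp.
Qed.

Lemma dkoebe_drop_nonneg : nonneg01 dkoebe_drop.
Proof. split; [apply dkoebe_drop_rsummable|]. intros t Ht. pose proof (dkoebe_drop_bound t Ht).
  lra. Qed.

Lemma dkoebe_coef_nonneg : nonneg01 dkoebe_coef.
Proof.
  split; [apply dkoebe_coef_rsummable|]. intros t Ht. rewrite dkoebe_coef_sum by (apply abs01;
    auto).
  apply Rmult_le_pos; [lra|]. left. apply Rinv_0_lt_compat, pow_lt. lra.
Qed.

(** Apply the multiplier to the nonnegative function -t K'(t) - t/8, where K (t) = (1-t)/(1+t)^3;
    multiplication of coefficients commutes with t d/dt. *)
Lemma PosMult_euler m t : PosMult m -> 0 < t < 1 ->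
  PSeries (PS_derive (fun n => m n * dkoebe_coef n)) t <= - (m 1%nat / 8) /\ rsummable (fun n => m
    n * dkoebe_coef n).
Proof.
  intros Hm Ht. destruct (Hm dkoebe_coef dkoebe_coef_nonneg) as [R1 _]. split; auto.
  (* The coefficients of -t K'(t) - t/8, see [dkoebe_drop_bound]. *)
  set (d := fun n => dkoebe_drop n + (match n with 1%nat => - (1/8) | _ => 0 end)).
  set (one := fun n : nat => match n with 1%nat => - (1/8) | _ => 0 end).
  assert (Rk : forall k : nat -> R, rsummable (fun n => k n * one n)).
  { intros k r Hr. do 2 apply ex_series_incr_1. apply ex_series_dom with (fun n => r ^ n).
    - intros n. unfold one. rewrite Rmult_0_r, Rabs_R0, Rmult_0_l. split; [lra|apply pow_le; lra].
    - apply ex_series_geom. rewrite Rabs_pos_eq; lra. }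
  assert (Rone : rsummable one).
  { intros r Hr. eapply ex_series_ext; [|apply (Rk (fun _ => 1) r Hr)]. intros n. cbv beta.
      now rewrite Rmult_1_l. }
  assert (S1 : forall k x, Rabs x < 1 -> PSeries (fun n => k n * one n) x = - (k 1%nat / 8) * x).
  { intros k x Hx.
    rewrite PSeries_decr_1 by (apply CV_radius_inside, rsummable_CV; auto).
    rewrite PSeries_decr_1.
    2:{ apply CV_radius_inside, rsummable_CV; auto. intros r Hr.
      apply ex_series_dom with (fun n => Rabs (PS_derive (fun n => k n * one n) n) * r ^ n).
      - intros n. unfold PS_decr_1, PS_derive. split; [apply Rmult_le_pos;
          [apply Rabs_pos|apply pow_le; lra]|].
        apply Rmult_le_compat_r; [apply pow_le; lra|].
          rewrite (Rabs_mult (INR (S n))), (Rabs_pos_eq (INR (S n))) by apply pos_INR.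
        assert (1 <= INR (S n)) by (apply (le_INR 1); lia).
          pose proof (Rabs_pos (k (S n) * one (S n))). nra.
      - apply (rsummable_derive _ (Rk k) r Hr). }
    rewrite (PSeries_ext _ (fun n => 0 * 0)) by (intros n; unfold PS_decr_1, one; ring).
    rewrite PS_scal_eq. unfold PS_decr_1, one. field. }
  assert (Hd : nonneg01 d).
  { split; [apply rsummable_plus; [apply dkoebe_drop_rsummable|exact Rone]|].
    intros x Hx. unfold d. rewrite (PS_plus_eq dkoebe_drop one) by auto using
      dkoebe_drop_rsummable, abs01.
    rewrite (PSeries_ext one (fun n => 1 * one n)) by (intros; ring). rewrite S1 by now apply abs01.
    pose proof (dkoebe_drop_bound x Hx). lra. }
  destruct (Hm d Hd) as [R2 P2]. specialize (P2 t Ht).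
  assert (At := abs01 t Ht).
  rewrite (PSeries_ext _ (fun n => (-1) * (INR n * (m n * dkoebe_coef n)) + m n * one n)) in P2.
  2:{ intros n. unfold d, one, dkoebe_drop. ring. }
  assert (Re' := euler_rsummable _ R1).
  rewrite PS_plus_eq, PS_scal_eq, euler_sum, S1 in P2; auto.
  2:{ apply rsummable_mult with 1; auto. intros; rewrite Rabs_left; lra. }
  apply (Rmult_le_reg_l t); [lra|]. lra.
Qed.

Lemma PosMult_decr m x y : PosMult m -> 0 < x -> x <= y -> y < 1 ->
  PSeries (fun n => m n * dkoebe_coef n) y + m 1%nat / 8 * (y - x) <= PSeries (fun n => m n *
    dkoebe_coef n) x.
Proof.
  intros Hm Hx Hxy Hy.
  assert (R1 : rsummable (fun n => m n * dkoebe_coef n)) by apply (Hm dkoebe_coef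
    dkoebe_coef_nonneg).
  assert (N := derive_nonneg_le (fun t => - PSeries (fun n => m n * dkoebe_coef n) t - m 1%nat / 8
    * t)
    (fun t => - PSeries (PS_derive (fun n => m n * dkoebe_coef n)) t - m 1%nat / 8) x y Hxy).
  cbv beta in N. 
  assert (- PSeries (fun n => m n * dkoebe_coef n) x - m 1%nat / 8 * x <= - PSeries (fun n => m n *
    dkoebe_coef n) y - m 1%nat / 8 * y); [|lra].
  apply N.
  - intros t Ht. assert (At : Rabs t < 1) by (rewrite Rabs_pos_eq; lra).
    assert (D := PS_deriv _ t R1 At).
    apply (is_derive_minus (V := R_NormedModule)).
    + apply (is_derive_opp (V := R_NormedModule)). exact D.
    + auto_derive; auto. ring.
  - intros t Ht. destruct (PosMult_euler m t Hm ltac:(lra)) as [K _]. lra.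
Qed.

(** * The function q and the constant in the definition of beta *)

(** The weight with a = s = 1 is constant. *)
Lemma Gamma_1 : Gamma 1 = 1.
Proof.
  assert (H := log_weight_int 1 1 Rlt_0_1 Rlt_0_1).
  assert (K : is_RInt_gen (fun _ => 1) (at_right 0) (at_left 1) 1).
  { apply is_RInt_gen_eps. intros eps He. exists (fun t => 0 < t <= eps / 3), (fun t => 1 - eps / 3
      <= t < 1).
    split; [apply at_right_le; lra|split; [apply at_left_ge; lra|]].
    intros a b Ha Hb. exists ((b - a) * 1). split; [exact (is_RInt_const (V := R_NormedModule) a b
      1)|].
    apply Rabs_def1; lra. }
  assert (E : int01 (log_weight 1 1) = 1).
  { apply int01_unique. eapply int01_ext; [|exact K]. intros t Ht. unfold log_weight.
      rewrite Rminus_diag.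
    rewrite !Rpower_O; [ring|lra|now apply ln_inv_pos]. }
  rewrite (int01_unique _ _ H) in E. rewrite Rpower_O in E || rewrite Rpower_1 in E by lra. lra.
Qed.

Definition quad_factor (mu nu : R) (n : nat) : R := (1 + mu * INR n) * (1 + nu * INR n).
Lemma quad_factor_pos mu nu n : 0 < mu -> 0 < nu -> 0 < quad_factor mu nu n.
Proof. intros. pose proof (pos_INR n). unfold quad_factor. apply Rmult_lt_0_compat; nra. Qed.

Lemma PosMult_lin mu : 0 < mu -> PosMult (fun n => / (1 + mu * INR n)).
Proof.
  intros H. apply PosMult_ext with (fun n => / mu * / (/ mu + INR n)).
  - intros n. pose proof (pos_INR n). assert (0 < / mu) by now apply Rinv_0_lt_compat.
    rewrite <- Rinv_mult. f_equal. field. lra.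
  - apply PosMult_mult; [apply PosMult_const; left; now apply Rinv_0_lt_compat|].
    apply PosMult_inv. now apply Rinv_0_lt_compat.
Qed.

Lemma PosMult_quad_factor mu nu : 0 < mu -> 0 < nu -> PosMult (fun n => / quad_factor mu nu n).
Proof.
  intros. apply PosMult_ext with (fun n => / (1 + mu * INR n) * / (1 + nu * INR n)).
  - intros n. unfold quad_factor. now rewrite Rinv_mult.
  - apply PosMult_mult; now apply PosMult_lin.
Qed.

Definition q_sum (mu nu : R) : R -> R := PSeries (fun n => / quad_factor mu nu n * dkoebe_coef n).

Lemma q_inner_integral mu t : 0 < mu -> 0 < t < 1 ->
  int01 (fun s => Rpower s (1 / mu - 1) * ((1 - s * t) / (1 + s * t) ^ 3)) =
  mu * PSeries (fun n => / (1 + mu * INR n) * dkoebe_coef n) t.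
Proof.
  intros Hm Ht. apply int01_unique.
  assert (Hi : 0 < 1 / mu) by (apply Rdiv_lt_0_compat; lra).
  assert (H := log_weight_series (1 / mu) 1 dkoebe_coef t Hi Rlt_0_1 dkoebe_coef_rsummable Ht).
  rewrite Gamma_1, Rmult_1_l in H.
  replace (mu * PSeries (fun n => / (1 + mu * INR n) * dkoebe_coef n) t) with (PSeries (fun n => /
    Rpower (1 / mu + INR n) 1 * dkoebe_coef n) t).
  - eapply int01_ext; [|exact H]. intros s Hs. unfold log_weight.
      rewrite Rminus_diag, Rpower_O by now apply ln_inv_pos.
    rewrite dkoebe_coef_sum by (rewrite Rabs_pos_eq; nra). rewrite (Rmult_comm t s). ring.
  - rewrite <- PS_scal_eq. apply PSeries_ext. intros n. pose proof (pos_INR n).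
    rewrite Rpower_1 by lra. rewrite <- Rmult_assoc. f_equal. field. split; nra.
Qed.

Lemma at_right_ex x (P : R -> Prop) : at_right x P -> exists y, P y.
Proof. apply (filter_ex (F := at_right x)). Qed.

Lemma at_left_ex x (P : R -> Prop) : at_left x P -> exists y, P y.
Proof. apply (filter_ex (F := at_left x)). Qed.

Lemma at_right_cont (f : R -> R) x e : continuous f x -> 0 < e -> at_right x (fun s => Rabs (f s -
  f x) < e).
Proof.
  intros Hf He. assert (K := proj1 (filterlim_locally (U := R_UniformSpace) f (f x)) Hf (mkposreal
    e He)).
  unfold at_right, within. revert K. apply filter_imp. intros s Hs _. exact Hs.
Qed.

(** Termwise integration turns the differential equation into one solved by the power series
    [q_sum]. The difference of two solutions is a constant multiple of t^(-1/nu), and boundedness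
    near 0 forces the constant to vanish. *)
Lemma q_series mu nu q : 0 < mu -> 0 < nu -> is_q mu nu q -> forall t, 0 < t < 1 -> q t = q_sum mu
  nu t.
Proof.
  intros Hm Hn [Hode [Hq0 Hq1]].
  assert (RQ : rsummable (fun n => / quad_factor mu nu n * dkoebe_coef n)) by apply
    (PosMult_quad_factor mu nu Hm Hn dkoebe_coef dkoebe_coef_nonneg).
  assert (Hi : 0 < 1 / nu) by (apply Rdiv_lt_0_compat; lra).
  set (d := fun t => Rpower t (1 / nu) * q t - Rpower t (1 / nu) * q_sum mu nu t).
  assert (D0 : forall t, 0 < t < 1 -> is_derive d t 0).
  { intros t Ht. assert (At := abs01 t Ht).
    assert (D1 := Hode t Ht). rewrite q_inner_integral in D1 by auto.
    assert (D2 := is_derive_mult (fun x => Rpower x (1 / nu)) (q_sum mu nu) t _ _ (Rpower_deriv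
      (1/nu) t ltac:(lra)) (PS_deriv _ t RQ At) Rmult_comm).
    assert (D3 := is_derive_minus (V := R_NormedModule) _ _ _ _ _ D1 D2).
    assert (E : 1 / (mu * nu) * Rpower t (1 / nu - 1) * (mu * PSeries (fun n => / (1 + mu * INR n)
      * dkoebe_coef n) t) =
      1 / nu * Rpower t (1 / nu - 1) * q_sum mu nu t + Rpower t (1 / nu) * PSeries (PS_derive (fun
        n => / quad_factor mu nu n * dkoebe_coef n)) t).
    { replace (Rpower t (1 / nu)) with (Rpower t (1 / nu - 1) * t).
      2:{ rewrite <- (Rpower_1 t) at 2 by lra. rewrite <- Rpower_plus. f_equal. ring. }
      rewrite (Rmult_assoc (Rpower t (1/nu - 1)) t), <- (euler_sum _ t RQ At).
      rewrite (PSeries_ext (fun n => / (1 + mu * INR n) * dkoebe_coef n) (fun n => / quad_factor mu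
        nu n * dkoebe_coef n + nu * (INR n * (/ quad_factor mu nu n * dkoebe_coef n)))).
      - rewrite PS_plus_eq, PS_scal_eq; auto.
        + unfold q_sum. field. lra.
        + apply rsummable_mult with (Rabs nu); [intros; lra|]. now apply euler_rsummable.
      - intros n. pose proof (pos_INR n). unfold quad_factor. field. split; nra. }
    match type of D3 with is_derive _ _ ?l => replace 0 with l end; [exact D3|].
    change (@eq R (1 / (mu * nu) * Rpower t (1 / nu - 1) * (mu * PSeries (fun n => / (1 + mu * INR
      n) * dkoebe_coef n) t) -
      (1 / nu * Rpower t (1 / nu - 1) * q_sum mu nu t + Rpower t (1 / nu) * PSeries (PS_derive (fun
        n => / quad_factor mu nu n * dkoebe_coef n)) t)) 0).
    lra. }
  assert (Dc : forall s t, 0 < s < 1 -> 0 < t < 1 -> s <= t -> d s = d t).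
  { intros s t Hs Ht Hst. apply Rle_antisym.
    - apply (derive_nonneg_le d (fun _ => 0) s t Hst); [intros x Hx; apply D0; lra|intros; lra].
    - assert (K := derive_nonneg_le (fun x => - d x) (fun _ => - 0) s t Hst). cbv beta in K.
      assert (- d s <= - d t); [|lra]. apply K; [|intros; lra].
      intros x Hx. apply (is_derive_opp (V := R_NormedModule)). apply D0. lra. }
  assert (C0 : continuous (q_sum mu nu) 0) by (apply rsummable_cont; [exact RQ|rewrite Rabs_R0;
    lra]).
  assert (Q0 : q_sum mu nu 0 = 1).
  { unfold q_sum. rewrite PSeries_0. unfold quad_factor, dkoebe_coef. simpl. field. }
  assert (small : forall eta, 0 < eta -> forall t, 0 < t < 1 -> Rabs (d t) <= eta).
  { intros eta He t Ht.
    assert (F1 : at_right 0 (fun s => Rabs (q s - 1) < 1)).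
    { apply (Hq1 (fun y => Rabs (y - 1) < 1)). exists (mkposreal 1 Rlt_0_1). intros y Hy. exact Hy.
        }
    assert (F2 : at_right 0 (fun s => Rabs (q_sum mu nu s - 1) < 1)).
    { rewrite <- Q0. apply at_right_cont; auto. lra. }
    assert (F3 := at_right_le (Rmin t (Rpower (eta / 2) nu)) ltac:(apply Rmin_case;
      [lra|apply Rpower_pos])).
    destruct (at_right_ex _ _ (filter_and _ _ F1 (filter_and _ _ F2 F3))) as [s [H1 [H2 [H3 H4]]]].
    pose proof (Rmin_l t (Rpower (eta / 2) nu)). pose proof (Rmin_r t (Rpower (eta / 2) nu)).
    rewrite <- (Dc s t) by lra. unfold d.
    rewrite <- Rmult_minus_distr_l, Rabs_mult, Rabs_pos_eq by (left; apply Rpower_pos).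
    assert (P1 : Rpower s (1 / nu) <= eta / 2).
    { apply Rle_trans with (Rpower (Rpower (eta / 2) nu) (1 / nu)); [apply Rle_Rpower_l; lra|].
      rewrite Rpower_mult. replace (nu * (1 / nu)) with 1 by (field; lra). rewrite Rpower_1; lra. }
    apply Rabs_def2 in H1. apply Rabs_def2 in H2.
    assert (Rabs (q s - q_sum mu nu s) <= 2) by (apply Rabs_le; lra).
    pose proof (Rpower_pos s (1/nu)). pose proof (Rabs_pos (q s - q_sum mu nu s)). nra. }
  intros t Ht.
  assert (Z : d t = 0).
  { destruct (Req_dec (d t) 0) as [E|E]; auto. exfalso.
    pose proof (Rabs_pos_lt _ E). specialize (small (Rabs (d t) / 2) ltac:(lra) t Ht). lra. }
  unfold d in Z. pose proof (Rpower_pos t (1 / nu)).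
  rewrite <- Rmult_minus_distr_l in Z. apply Rmult_integral in Z. destruct Z; lra.
Qed.

Lemma q_sum_bounds mu nu : 0 < mu -> 0 < nu ->
  (forall t, 0 < t < 1 -> 0 <= q_sum mu nu t <= 1) /\ (forall x y, 0 < x -> x <= y -> y < 1 ->
    q_sum mu nu y <= q_sum mu nu x).
Proof.
  intros Hm Hn.
  assert (RQ : rsummable (fun n => / quad_factor mu nu n * dkoebe_coef n)) by apply
    (PosMult_quad_factor mu nu Hm Hn dkoebe_coef dkoebe_coef_nonneg).
  assert (Hd : forall x y, 0 < x -> x <= y -> y < 1 -> q_sum mu nu y <= q_sum mu nu x).
  { intros x y Hx Hxy Hy. pose proof (PosMult_decr _ x y (PosMult_quad_factor mu nu Hm Hn) Hx Hxy
      Hy) as K. cbv beta in K. fold (q_sum mu nu) in K.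
    assert (0 < / quad_factor mu nu 1) by (apply Rinv_0_lt_compat, quad_factor_pos; auto). nra. }
  split; auto. intros t Ht. split; [apply (PosMult_quad_factor mu nu Hm Hn dkoebe_coef
    dkoebe_coef_nonneg); auto|].
  assert (C0 : continuous (q_sum mu nu) 0) by (apply rsummable_cont; [exact RQ|rewrite Rabs_R0;
    lra]).
  assert (Q0 : q_sum mu nu 0 = 1) by (unfold q_sum; rewrite PSeries_0;
    unfold quad_factor, dkoebe_coef; simpl; field).
  apply Rnot_lt_le. intros L.
  assert (F2 := at_right_cont (q_sum mu nu) 0 (q_sum mu nu t - 1) C0 ltac:(lra)). rewrite Q0 in F2.
  destruct (at_right_ex _ _ (filter_and _ _ F2 (at_right_le t ltac:(lra)))) as [s [H1 H2]].
  apply Rabs_def2 in H1. specialize (Hd s t ltac:(lra) ltac:(lra) ltac:(lra)). lra.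
Qed.

Definition V_mult (c p : R) (m : nat) : R := Rpower (1 + c) p * / Rpower (1 + c + INR m) p.
(** The coefficients of F relative to those of the constrained expression: lam_n / D_n in the
    notation of the introduction. *)
Definition kappa (c p mu nu : R) (n : nat) : R := V_mult c p n * / quad_factor mu nu n.

Lemma partial_le_total (f : R -> R) l a b : (forall t, 0 < t < 1 -> 0 <= f t) -> (forall t, 0 < t <
  1 -> continuous f t) ->
  is_RInt_gen f (at_right 0) (at_left 1) l -> 0 < a -> a <= b -> b < 1 -> RInt f a b <= l.
Proof.
  intros Hp Hc Hf Ha Hab Hb. apply Rnot_lt_le. intros L. rewrite is_RInt_gen_eps in Hf.
  destruct (Hf (RInt f a b - l) ltac:(lra)) as [Q [S [HQ [HS H]]]].
  destruct (at_right_ex _ _ (filter_and _ _ HQ (at_right_le a Ha))) as [x [X1 X2]].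
  destruct (at_left_ex _ _ (filter_and _ _ HS (at_left_ge b Hb))) as [y [Y1 Y2]].
  destruct (H x y X1 Y1) as [I [HI HIl]].
  assert (EX : forall u v, 0 < u < 1 -> 0 < v < 1 -> ex_RInt f u v).
  { intros u v Hu Hv. apply (ex_RInt_pos f (fun t => 0 < t < 1)); auto. intros; lra. }
  assert (C1 := RInt_Chasles (V := R_CompleteNormedModule) f x a y (EX x a ltac:(lra) ltac:(lra))
    (EX a y ltac:(lra) ltac:(lra))).
  assert (C2 := RInt_Chasles (V := R_CompleteNormedModule) f a b y (EX a b ltac:(lra) ltac:(lra))
    (EX b y ltac:(lra) ltac:(lra))).
  assert (C1' : RInt f x a + RInt f a y = RInt f x y) by exact C1.
  assert (C2' : RInt f a b + RInt f b y = RInt f a y) by exact C2.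
  assert (0 <= RInt f x a) by (apply RInt_ge_0; [lra|apply EX; lra|intros; apply Hp; lra]).
  assert (0 <= RInt f b y) by (apply RInt_ge_0; [lra|apply EX; lra|intros; apply Hp; lra]).
  apply (is_RInt_unique (V := R_CompleteNormedModule)) in HI. apply Rabs_def2 in HIl.
    rewrite <- HI in HIl. lra.
Qed.

(** Termwise integration gives the right-hand side as the weighted integral of q (y t), and q is
    decreasing. Taking y < 1 avoids the series of q at the boundary of its disc. *)
Lemma q_integral_le c p mu nu q y : -1 < c -> 0 < p -> 0 < mu -> 0 < nu -> is_q mu nu q -> 0 < y <
  1 ->
  Rpower (1 + c) p / Gamma p * int01 (fun t => Rpower t c * Rpower (ln (1 / t)) (p - 1) * q t)
  <= PSeries (fun n => kappa c p mu nu n * dkoebe_coef n) y.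
Proof.
  intros Hc Hp Hm Hn Hq Hy.
  destruct (Gamma_correct p Hp) as [_ G].
  assert (RQ : rsummable (fun n => / quad_factor mu nu n * dkoebe_coef n)) by apply
    (PosMult_quad_factor mu nu Hm Hn dkoebe_coef dkoebe_coef_nonneg).
  destruct (q_sum_bounds mu nu Hm Hn) as [QB QD].
  assert (H1 := log_weight_series (1 + c) p _ y ltac:(lra) Hp RQ Hy). fold (q_sum mu nu) in H1.
  assert (W0 := log_weight_int (1 + c) p ltac:(lra) Hp).
  assert (WC : forall t, 0 < t < 1 -> continuous (fun t => log_weight (1 + c) p t * q_sum mu nu t)
    t).
  { intros t Ht. apply (continuous_mult (K := R_AbsRing)); [now apply log_weight_cont|].
      apply rsummable_cont; auto using abs01. }
  destruct (is_RInt_gen_of_bounded (fun t => log_weight (1 + c) p t * q_sum mu nu t) (fun t => 0 <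
    t < 1) (at_right 0) (at_left 1) (Gamma p / Rpower (1 + c) p) (1/2)) as [l [Hl _]]; auto.
  - intros; lra.
  - lra.
  - intros x Hx. generalize (at_right_le x ltac:(lra)). apply filter_imp. intros; lra.
  - intros x Hx. generalize (at_left_ge x ltac:(lra)). apply filter_imp. intros; lra.
  - intros x Hx. apply Rmult_le_pos; [left; apply log_weight_pos|]. now apply QB.
  - intros a b Ha Hb Hab. apply Rle_trans with (RInt (log_weight (1 + c) p) a b).
    + apply RInt_le; auto.
      * apply (ex_RInt_pos _ (fun t => 0 < t < 1)); auto. intros; lra.
      * apply (ex_RInt_pos _ (fun t => 0 < t < 1)); auto; [intros; lra|apply log_weight_cont].
      * intros x Hx. specialize (QB x ltac:(lra)). pose proof (log_weight_pos (1 + c) p x). nra.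
    + apply partial_le_total; auto; try lra. intros; left; apply log_weight_pos. intros;
        now apply log_weight_cont.
  - assert (EI : int01 (fun t => Rpower t c * Rpower (ln (1 / t)) (p - 1) * q t) = l).
    { apply int01_unique. eapply int01_ext; [|exact Hl]. intros t Ht.
        rewrite (q_series mu nu q Hm Hn Hq t Ht).
      unfold log_weight. replace (1 + c - 1) with c by ring. ring. }
    rewrite EI.
    assert (L : l <= Gamma p * PSeries (fun n => / Rpower (1 + c + INR n) p * (/ quad_factor mu nu
      n * dkoebe_coef n)) y).
    { refine (int01_le _ _ _ _ _ Hl H1). intros t Ht. apply Rmult_le_compat_l; [left;
        apply log_weight_pos|].
      apply QD; nra. }
    rewrite (PSeries_ext _ (fun n => Rpower (1 + c) p * (/ Rpower (1 + c + INR n) p * (/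
      quad_factor mu nu n * dkoebe_coef n)))) by (intros n; unfold kappa, V_mult; ring).
    rewrite PS_scal_eq. pose proof (Rpower_pos (1 + c) p).
    unfold Rdiv. rewrite Rmult_assoc. apply Rmult_le_compat_l; [lra|].
    apply (Rmult_le_reg_l (Gamma p)); auto. rewrite <- Rmult_assoc, Rinv_r; lra.
Qed.

(** * Lower bound for the test multipliers *)

(** (1 + xi n)/(1 + n), a mean of the multipliers 1 and 1/(1+n). *)
Definition pascu_mean (xi : R) (n : nat) : R := xi + (1 - xi) * / (1 + INR n).

Lemma PosMult_pascu_mean xi : 0 <= xi <= 1 -> PosMult (pascu_mean xi).
Proof.
  intros H. apply PosMult_plus; [apply PosMult_const; lra|].
  apply PosMult_mult; [apply PosMult_const; lra|apply PosMult_inv; lra].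
Qed.

Lemma PosMult_kappa c p mu nu : -1 < c -> 0 < p -> 0 < mu -> 0 < nu -> PosMult (kappa c p mu nu).
Proof.
  intros. unfold kappa, V_mult. apply PosMult_mult; [apply PosMult_mult|now apply
    PosMult_quad_factor].
  - apply PosMult_const. left. apply Rpower_pos.
  - apply PosMult_power; lra.
Qed.

(** Up to a constant this is (1+n)/(1+c+n) (2+n)/(1+c+n) (1+n)/(1/mu+n) times (1+c+n)^(2-p),
    1/(1+nu n) and [pascu_mean]. The three ratios are positive multipliers since c <= 0 and mu >=
    1, and the power is one since p > 2. *)
Lemma PosMult_residual c p mu nu xi : -1 < c < 0 -> 2 < p -> 1 <= mu -> 0 < nu -> 0 <= xi <= 1 ->
  PosMult (fun n => (1 + INR n) ^ 2 * (2 + INR n) * (kappa c p mu nu n * pascu_mean xi n)).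
Proof.
  intros Hc Hp Hm Hn Hx.
  assert (H1 := PosMult_ratio (1 + c) 1 ltac:(lra)).
  assert (H2 := PosMult_ratio (1 + c) 2 ltac:(lra)).
  assert (Hi : 0 < / mu <= 1) by (split; [apply Rinv_0_lt_compat; lra|rewrite <- Rinv_1;
    apply Rinv_le_contravar; lra]).
  assert (H3 := PosMult_ratio (/ mu) 1 Hi).
  assert (H4 := PosMult_power (1 + c) (p - 2) ltac:(lra) ltac:(lra)).
  assert (H5 := PosMult_lin nu Hn).
  assert (H6 := PosMult_const (Rpower (1 + c) p * / mu) ltac:(apply Rmult_le_pos; [left;
    apply Rpower_pos|lra])).
  assert (H7 := PosMult_pascu_mean xi Hx).
  eapply PosMult_ext; [|exact (PosMult_mult _ _ H6 (PosMult_mult _ _ H1 (PosMult_mult _ _ H2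
    (PosMult_mult _ _ H3 (PosMult_mult _ _ H4 (PosMult_mult _ _ H5 H7))))))].
  intros n. cbv beta. unfold kappa, V_mult, quad_factor. pose proof (pos_INR n).
  assert (E : Rpower (1 + c + INR n) p = Rpower (1 + c + INR n) (p - 2) * (1 + c + INR n) ^ 2).
  { rewrite <- Rpower_pow by lra. rewrite <- Rpower_plus. f_equal. simpl. ring. }
  rewrite E. pose proof (Rpower_pos (1 + c + INR n) (p - 2)).
  field. repeat split; try lra; try nra.
Qed.

(** Dividing the coefficients by (n+1)(n+2) is, up to the factor t^2, taking two primitives. *)
Lemma nonneg_test_base eps z : Cmod z = 1 -> Cmod (eps - RtoC (1/2)) <= 1/2 ->
  nonneg01 (fun n => test_coef eps z n / ((1 + INR n) * (2 + INR n))).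
Proof.
  intros Hz He. set (A := test_coef eps z).
  assert (HA : rsummable A) by (apply test_coef_rsummable; lra).
  assert (RB : rsummable (fun n => A n / ((1 + INR n) * (2 + INR n)))).
  { assert (HB : rsummable (fun n => / ((1 + INR n) * (2 + INR n)) * A n)).
    { apply rsummable_mult with 1; auto.
      intros n. pose proof (pos_INR n). assert (1 <= (1 + INR n) * (2 + INR n)) by nra.
      rewrite Rabs_pos_eq by (left; apply Rinv_0_lt_compat; lra). rewrite <- Rinv_1.
        apply Rinv_le_contravar; lra. }
    intros r Hr. eapply ex_series_ext; [|apply (HB r Hr)]. intros n. cbv beta. do 2 f_equal.
      apply Rmult_comm. }
  split; auto.
  intros t Ht. assert (At := abs01 t Ht).
  assert (K := double_primitive_nonneg eps z t Hz He Ht). fold A in K.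
  assert (E : PSeries (PS_Int (PS_Int A)) t = t ^ 2 * PSeries (fun n => A n / ((1 + INR n) * (2 +
    INR n))) t).
  { assert (E0 : forall n, PS_incr_n (fun n => A n / ((1 + INR n) * (2 + INR n))) 2 n = PS_Int
      (PS_Int A) n).
    { intros n. destruct n as [|[|n]]; [reflexivity|unfold PS_incr_n, PS_incr_1, PS_Int; simpl;
        unfold Rdiv; now rewrite Rmult_0_l|].
      change (A n / ((1 + INR n) * (2 + INR n)) = A n / INR (S n) / INR (S (S n))).
      rewrite !S_INR. pose proof (pos_INR n). field. lra. }
    rewrite <- (PSeries_ext _ _ t E0). apply PSeries_incr_n. }
  rewrite E in K. apply (Rmult_le_reg_l (t ^ 2)); [apply pow_lt; lra|]. lra.
Qed.

Definition test_mult (c p mu nu xi : R) (eps : C) (n : nat) : C :=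
  ((1 + RtoC (INR n) * eps) * RtoC ((1 + xi * INR n) * kappa c p mu nu n))%C.

Lemma kappa_bounds c p mu nu n : -1 < c -> 0 < p -> 0 < mu -> 0 < nu ->
  0 < kappa c p mu nu n <= / quad_factor mu nu n.
Proof.
  intros Hc Hp Hm Hn. unfold kappa, V_mult. pose proof (quad_factor_pos mu nu n Hm Hn).
  pose proof (Rpower_pos (1 + c) p). pose proof (Rpower_pos (1 + c + INR n) p).
  assert (0 < / quad_factor mu nu n) by now apply Rinv_0_lt_compat.
  assert (0 < / Rpower (1 + c + INR n) p) by now apply Rinv_0_lt_compat.
  split; [repeat apply Rmult_lt_0_compat; auto|].
  rewrite <- (Rmult_1_l (/ quad_factor mu nu n)) at 2. apply Rmult_le_compat_r; [lra|].
  pose proof (Rpower_shift_le (1 + c) p n ltac:(lra) Hp).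
  apply (Rmult_le_reg_r (Rpower (1 + c + INR n) p)); auto. rewrite Rmult_assoc, Rinv_l; lra.
Qed.

Lemma kappa_0 c p mu nu : -1 < c -> kappa c p mu nu 0 = 1.
Proof.
  intros. unfold kappa, V_mult, quad_factor. simpl INR. rewrite Rplus_0_r.
    pose proof (Rpower_pos (1 + c) p). field. lra.
Qed.

Lemma test_mult_bound c p mu nu xi n : -1 < c -> 0 < p -> 1 <= mu -> 0 < nu -> 0 <= xi <= 1 ->
  Rabs ((1 + xi * INR n) * kappa c p mu nu n) <= 1.
Proof.
  intros Hc Hp Hm Hn Hx. destruct (kappa_bounds c p mu nu n ltac:(lra) Hp ltac:(lra) Hn) as [B1 B2].
  pose proof (pos_INR n).
  rewrite Rabs_pos_eq by (apply Rmult_le_pos; nra).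
  apply Rle_trans with ((1 + xi * INR n) * / quad_factor mu nu n); [apply Rmult_le_compat_l; nra|].
  pose proof (quad_factor_pos mu nu n ltac:(lra) Hn).
  apply (Rmult_le_reg_r (quad_factor mu nu n)); auto.
    rewrite Rmult_assoc, Rinv_l, Rmult_1_r, Rmult_1_l by lra.
  unfold quad_factor. assert (0 <= (mu - xi) * INR n) by (apply Rmult_le_pos; lra).
  assert (0 <= nu * INR n) by (apply Rmult_le_pos; lra).
    assert (0 <= mu * INR n) by (apply Rmult_le_pos; lra).
  apply Rle_trans with ((1 + mu * INR n) * 1); [lra|]. apply Rmult_le_compat_l; lra.
Qed.

Lemma disc_summable_test_mult c p mu nu xi eps : -1 < c -> 0 < p -> 1 <= mu -> 0 < nu -> 0 <= xi <=
  1 ->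
  disc_summable 1 (test_mult c p mu nu xi eps).
Proof.
  intros. intros r Hr. apply ex_series_dom with (fun n => Cmod (1 + RtoC (INR n) * eps) * r ^ n).
  2: now apply disc_summable_test.
  intros n. assert (0 <= r ^ n) by (apply pow_le; lra). split; [apply Rmult_le_pos; auto;
    apply Cmod_ge_0|].
  apply Rmult_le_compat_r; auto. unfold test_mult. rewrite Cmod_mult, Cmod_R.
  pose proof (test_mult_bound c p mu nu xi n). pose proof (Cmod_ge_0 (1 + RtoC (INR n) * eps)).
  rewrite <- (Rmult_1_r (Cmod (1 + RtoC (INR n) * eps))) at 2. apply Rmult_le_compat_l; auto.
Qed.

(** The coefficients split into three parts: a positive multiplier applied to [nonneg_test_base], the
    alternating series of kappa, and a positive multiplier applied to [dkoebe_drop] that accounts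
    for the change of xi into 1. The first and the last are nonnegative, and the middle one exceeds Q
    by the strict decrease between rho and y. *)
Lemma test_mult_lower_bound c p mu nu xi q rho : -1 < c < 0 -> 2 < p -> 1 <= mu -> 0 < nu -> 0 <=
  xi <= 1 -> is_q mu nu q -> 0 < rho < 1 ->
  exists d, 0 < d /\ forall eps z, Cmod z = 1 -> Cmod (eps - RtoC (1/2)) <= 1/2 ->
    Rpower (1 + c) p / Gamma p * int01 (fun t => Rpower t c * Rpower (ln (1 / t)) (p - 1) * q t) + d
    <= Re (CPSeries (test_mult c p mu nu xi eps) (RtoC rho * z)).
Proof.
  intros Hc Hp Hm Hn Hx Hq Hr.
  set (Q := Rpower (1 + c) p / Gamma p * int01 (fun t => Rpower t c * Rpower (ln (1 / t)) (p - 1) *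
    q t)).
  set (kp := kappa c p mu nu).
  assert (PK : PosMult kp) by (apply PosMult_kappa; lra).
  assert (K1 : 0 < kp 1%nat) by (apply kappa_bounds; lra).
  (* Any y strictly between rho and 1 serves; the gap y - rho provides the margin d. *)
  set (y := (1 + rho) / 2). assert (Hy : rho < y < 1) by (unfold y; lra).
  exists (kp 1%nat / 8 * (y - rho)). split; [apply Rmult_lt_0_compat; lra|].
  intros eps z Hz He.
  assert (SQ : Q + kp 1%nat / 8 * (y - rho) <= PSeries (fun n => kp n * dkoebe_coef n) rho).
  { pose proof (q_integral_le c p mu nu q y ltac:(lra) ltac:(lra) ltac:(lra) Hn Hq ltac:(lra)) as
      L1. fold Q in L1. fold kp in L1.
    pose proof (PosMult_decr kp rho y PK ltac:(lra) ltac:(lra) ltac:(lra)). lra. }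
  assert (At := abs01 rho Hr).
  assert (R1 : rsummable (fun n => kp n * dkoebe_coef n)) by apply (PK dkoebe_coef
    dkoebe_coef_nonneg).
  assert (PM : PosMult (fun n => kp n * ((1 - xi) * / (1 + INR n)))).
  { apply PosMult_mult; auto. apply PosMult_mult; [apply PosMult_const; lra|apply PosMult_inv;
      lra]. }
  destruct (PM _ dkoebe_drop_nonneg) as [R2 P2]. specialize (P2 rho Hr).
  destruct (PosMult_residual c p mu nu xi Hc Hp Hm Hn Hx _ (nonneg_test_base eps z Hz He)) as [R3
    P3].
  specialize (P3 rho Hr). fold kp in R3, P3.
  eapply Rle_trans; [exact SQ|].
  (* With k_n = (-1)^n (n+1)^2: Re ((1 + n eps) z^n) (1 + xi n) = test_coef (1 + xi n) + k_n + k_n (pascu_mean - 1). *)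
  assert (E : Re (CPSeries (test_mult c p mu nu xi eps) (RtoC rho * z)) =
     PSeries (fun n => (1 + INR n) ^ 2 * (2 + INR n) * (kp n * pascu_mean xi n) * (test_coef eps z
       n / ((1 + INR n) * (2 + INR n)))) rho +
     (PSeries (fun n => kp n * dkoebe_coef n) rho + PSeries (fun n => kp n * ((1 - xi) * / (1 + INR
       n)) * dkoebe_drop n) rho)).
  2: lra.
  rewrite <- (PS_plus_eq _ _ rho R1 R2 At).
  rewrite <- (PS_plus_eq _ _ rho R3 (rsummable_plus _ _ R1 R2) At).
  symmetry. apply is_series_unique.
  assert (CB := disc_summable_test_mult c p mu nu xi eps ltac:(lra) ltac:(lra) Hm Hn Hx).
  eapply is_series_ext; [|exact (is_series_Re_CPSeries _ z rho CB ltac:(lra) At)].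
  intros n. cbv beta. apply (f_equal (fun x => x * rho ^ n)).
  unfold test_mult. fold kp.
  replace ((1 + RtoC (INR n) * eps) * RtoC ((1 + xi * INR n) * kp n) * z ^ n)%C with
    (RtoC ((1 + xi * INR n) * kp n) * ((1 + RtoC (INR n) * eps) * z ^ n))%C by ring.
  rewrite re_scal_l. unfold test_coef, pascu_mean, dkoebe_drop, dkoebe_coef. rewrite S_INR.
    pose proof (pos_INR n).
  field. lra.
Qed.

(** * Convolution with a function of real part greater than 1/2 *)

Lemma recenter_at_0 Rd a n : 0 < Rd -> disc_summable Rd a -> recenter a 0%C n = a n.
Proof.
  intros HR Ha. apply (is_Cpseries_unique Rd (recenter a 0%C) a (CPSeries a)); auto.
  - intros z Hz. replace z with (0 + z)%C at 2 by ring. apply (recenter_is_Cpseries Rd); auto.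
      rewrite Cmod_0. lra.
  - intros z Hz. now apply (CPSeries_correct Rd).
Qed.

(** [recenter_bound] at the centre 0 bounds the tail geometrically. *)
Lemma CPSeries_uniform_tail a rho eta : disc_summable 1 a -> 0 < rho < 1 -> 0 < eta ->
  exists N0, forall N w, (N0 <= N)%nat -> Cmod w <= rho -> Cmod (CPSeries a w - Csum (fun n => a n
    * w ^ n)%C N) <= eta.
Proof.
  intros Ha Hr He. set (x := (1 + rho) / 2).
  destruct (recenter_bound 1 a 0%C x Ha ltac:(unfold x; lra)) as [M [M0 HM]]; [rewrite Cmod_0;
    unfold x; lra|].
  assert (Q : 0 <= rho / x < 1) by (apply ratio_lt_1; unfold x; lra).
  destruct (geom_small (rho / x) M eta Q M0 He) as [N0 HN].
  exists N0. intros N w HNN Hw. left. eapply Rle_lt_trans; [|apply (HN N HNN)].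
  specialize (HM w N ltac:(unfold x; lra)). rewrite Cplus_0_l in HM.
  rewrite (Csum_ext _ (fun n => a n * w ^ n)%C) in HM by (intros; rewrite (recenter_at_0 1); auto;
    lra).
  eapply Rle_trans; [exact HM|]. apply Rmult_le_compat_r; auto. apply pow_incr.
  assert (0 < / x) by (apply Rinv_0_lt_compat; unfold x; lra). pose proof (Cmod_ge_0 w).
  split; [apply Rmult_le_pos; lra|apply Rmult_le_compat_r; lra].
Qed.

Lemma Csum_plus u v N : Csum (fun n => u n + v n)%C N = (Csum u N + Csum v N)%C.
Proof. induction N as [|N IH]; simpl; [ring|rewrite IH; ring]. Qed.

Lemma Csum_0 N : Csum (fun _ => 0%C) N = 0%C.
Proof. induction N as [|N IH]; simpl; [reflexivity|rewrite IH; ring]. Qed.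

Lemma Csum_swap (F : nat -> nat -> C) M N :
  Csum (fun j => Csum (fun m => F m j) N) M = Csum (fun m => Csum (F m) M) N.
Proof.
  induction N as [|N IH]; simpl; [apply Csum_0|]. rewrite Csum_plus, IH. reflexivity.
Qed.

Lemma Csum_delta (u : nat -> C) m N : (m < N)%nat -> (forall n, (n < N)%nat -> n <> m -> u n = 0%C)
  -> Csum u N = u m.
Proof.
  induction N as [|N IH]; intros Hm H; [lia|]. simpl. destruct (Nat.eq_dec m N) as [->|E].
  - rewrite (Csum_ext u (fun _ => 0%C)), Csum_0; [ring|]. intros n Hn. apply H; lia.
  - rewrite IH, (H N); [ring|lia|lia|lia|]. intros; apply H; lia.
Qed.

Lemma Csum_const c N : Csum (fun _ => c) N = (RtoC (INR N) * c)%C.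
Proof. induction N as [|N IH]; [simpl; ring|]. rewrite S_INR, RtoC_plus. simpl Csum. rewrite IH.
  ring. Qed.

Lemma Re_csum_le u v N : (forall n, (n < N)%nat -> Re (u n) <= Re (v n)) -> Re (Csum u N) <= Re
  (Csum v N).
Proof.
  induction N as [|N IH]; intros H; [simpl; lra|].
  change (Re (Csum u N) + Re (u N) <= Re (Csum v N) + Re (v N)). apply Rplus_le_compat; [apply IH;
    intros; apply H; lia|apply H; lia].
Qed.

Lemma Cpow_swap (a : C) m n : ((a ^ m) ^ n)%C = ((a ^ n) ^ m)%C.
Proof.
  assert (E : forall k l, ((a ^ k) ^ l)%C = (a ^ (k * l)%nat)%C).
  { intros k. induction l as [|l IH]; [rewrite Nat.mul_0_r; reflexivity|].
    simpl. rewrite IH, Nat.mul_succ_r, Nat.add_comm. clear. generalize (k * l)%nat. intros j.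
    induction k as [|k IH]; simpl; [ring|]. rewrite <- IH. ring. }
  rewrite !E. f_equal. lia.
Qed.

Lemma root_sum (q : C) M : (q ^ M)%C = 1%C -> q <> 1%C -> Csum (fun j => q ^ j)%C M = 0%C.
Proof.
  intros H1 H2.
  assert (N : (1 - q)%C <> 0%C) by (intro E; apply H2; replace q with (1 - (1 - q))%C by ring;
    rewrite E; ring).
  assert (G := geom_split q M N). rewrite H1 in G.
  replace (Csum (fun j => q ^ j)%C M) with ((Csum (fun j => q ^ j)%C M + 1 / (1 - q)) - 1 / (1 -
    q))%C by ring.
  rewrite <- G. field. auto.
Qed.

Lemma cis_neq1 x : 0 < x < 2 * PI -> cis x <> 1%C.
Proof.
  intros Hx E. assert (E1 : cos x = 1) by (injection E; auto).
  assert (S : 0 < sin (x / 2)) by (apply sin_gt_0; lra).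
  replace x with (2 * (x / 2)) in E1 by field. rewrite cos_2a_sin in E1. nra.
Qed.

Section Roots.
Variable N : nat.
Hypothesis HN : (0 < N)%nat.
Let om := cis (PI / INR N).
Let omi := cis (- (PI / INR N)).
Let NR : 0 < INR N. Proof. now apply lt_0_INR. Qed.

Lemma root_mul_inv : (om * omi)%C = 1%C.
Proof. unfold om, omi. now rewrite <- cis_plus, Rplus_opp_r, cis_0. Qed.

Lemma root_pow : (om ^ (2 * N))%C = 1%C.
Proof. unfold om. rewrite cis_pow, mult_INR. simpl (INR 2).
  replace ((1 + 1) * INR N * (PI / INR N)) with (2 * PI) by (field; lra). apply cis_2PI. Qed.

Lemma root_inv_pow : (omi ^ (2 * N))%C = 1%C.
Proof.
  assert (E : ((om * omi) ^ (2 * N))%C = 1%C) by (rewrite root_mul_inv; apply Cpow_1_l).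
  rewrite Cpow_mult_l, root_pow in E. rewrite <- E. ring.
Qed.

Lemma root_pow_neq1 k : (0 < k < 2 * N)%nat -> (om ^ k)%C <> 1%C.
Proof.
  intros Hk. unfold om. rewrite cis_pow. apply cis_neq1. pose proof PI_RGT_0.
  assert (K1 : 0 < INR k) by (apply lt_0_INR; lia).
  assert (K2 : INR k < 2 * INR N) by (rewrite <- (mult_INR 2); apply lt_INR; lia).
  assert (P : 0 < PI / INR N) by (apply Rdiv_lt_0_compat; auto).
  split; [now apply Rmult_lt_0_compat|].
  replace (2 * PI) with (2 * INR N * (PI / INR N)) by (field; lra). now apply Rmult_lt_compat_r.
Qed.

(** The two orthogonality relations need 2N roots of unity for polynomials with N terms, since
    then m - n and m + n stay strictly between -2N and 2N. *)
Lemma roots_orth_minus m n : (m < N)%nat -> (n < N)%nat -> n <> m ->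
  Csum (fun j => (om ^ j) ^ m * (omi ^ j) ^ n)%C (2 * N) = 0%C.
Proof.
  intros Hm Hn Hmn. rewrite (Csum_ext _ (fun j => (om ^ m * omi ^ n) ^ j)%C).
  2:{ intros j _. rewrite Cpow_mult_l, (Cpow_swap om), (Cpow_swap omi). reflexivity. }
  apply root_sum.
  - rewrite Cpow_mult_l, (Cpow_swap om), (Cpow_swap omi), root_pow, root_inv_pow, !Cpow_1_l. ring.
  - destruct (Nat.lt_ge_cases n m) as [L|L].
    + replace m with (m - n + n)%nat by lia. rewrite Cpow_add_r.
      replace (om ^ (m - n) * om ^ n * omi ^ n)%C with (om ^ (m - n) * (om * omi) ^ n)%C by
        (rewrite Cpow_mult_l; ring).
      rewrite root_mul_inv, Cpow_1_l. replace (om ^ (m - n) * 1)%C with (om ^ (m - n))%C by ring.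
        apply root_pow_neq1. lia.
    + intro E. apply (root_pow_neq1 (n - m)); [lia|].
      replace (om ^ (n - m))%C with (om ^ (n - m) * (om ^ m * omi ^ n))%C by (rewrite E; ring).
      rewrite Cmult_assoc, <- Cpow_add_r. replace (n - m + m)%nat with n by lia.
      rewrite <- Cpow_mult_l, root_mul_inv. apply Cpow_1_l.
Qed.

Lemma roots_orth_eq m : Csum (fun j => (om ^ j) ^ m * (omi ^ j) ^ m)%C (2 * N) = RtoC (INR (2 * N)).
Proof.
  rewrite (Csum_ext _ (fun j => 1%C)).
  - rewrite Csum_const. ring.
  - intros j _. rewrite <- Cpow_mult_l, <- Cpow_mult_l, root_mul_inv. now rewrite !Cpow_1_l.
Qed.

Lemma roots_orth_plus m n : (m < N)%nat -> (n < N)%nat -> (0 < m + n)%nat ->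
  Csum (fun j => (om ^ j) ^ m * (om ^ j) ^ n)%C (2 * N) = 0%C.
Proof.
  intros Hm Hn Hmn. rewrite (Csum_ext _ (fun j => (om ^ (m + n)) ^ j)%C).
  2:{ intros j _. rewrite <- Cpow_add_r. apply Cpow_swap. }
  apply root_sum.
  - rewrite Cpow_swap, root_pow. apply Cpow_1_l.
  - apply root_pow_neq1. lia.
Qed.

(** Expands the mean of a product of two polynomials into means of products of monomials. *)
Lemma Csum_bilinear (a b : nat -> C) (f g : nat -> nat -> C) M :
  Csum (fun j => Csum (fun m => a m * f m j) N * Csum (fun n => b n * g n j) N)%C M =
  Csum (fun m => Csum (fun n => (a m * b n) * Csum (fun j => f m j * g n j) M)%C N) N.
Proof.
  rewrite (Csum_ext _ (fun j => Csum (fun m => Csum (fun n => (a m * b n) * (f m j * g n j)) N)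
    N)%C).
  - rewrite Csum_swap. apply Csum_ext. intros m _. rewrite Csum_swap. apply Csum_ext. intros n _.
    apply Csum_mult_l.
  - intros j _. rewrite Cmult_comm, <- Csum_mult_l. apply Csum_ext. intros m _.
    rewrite Cmult_comm, <- Csum_mult_l. apply Csum_ext. intros n _. ring.
Qed.

Lemma mean_minus (a b : nat -> C) :
  Csum (fun j => Csum (fun m => a m * (om ^ j) ^ m) N * Csum (fun n => b n * (omi ^ j) ^ n) N)%C (2
    * N) =
  (RtoC (INR (2 * N)) * Csum (fun n => a n * b n) N)%C.
Proof.
  rewrite (Csum_bilinear a b (fun m j => (om ^ j) ^ m)%C (fun n j => (omi ^ j) ^ n)%C).
  rewrite <- Csum_mult_l. apply Csum_ext. intros m Hm. rewrite (Csum_delta _ m); auto.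
  - rewrite roots_orth_eq. ring.
  - intros n Hn Hnm. rewrite roots_orth_minus; auto. ring.
Qed.

Lemma mean_plus (a b : nat -> C) :
  Csum (fun j => Csum (fun m => a m * (om ^ j) ^ m) N * Csum (fun n => b n * (om ^ j) ^ n) N)%C (2
    * N) =
  (RtoC (INR (2 * N)) * (a O * b O))%C.
Proof.
  rewrite (Csum_bilinear a b (fun m j => (om ^ j) ^ m)%C (fun n j => (om ^ j) ^ n)%C).
  rewrite (Csum_delta _ O); auto.
  - rewrite (Csum_delta _ O); auto.
    + rewrite (Csum_ext _ (fun _ => 1%C)) by (intros; simpl; ring). rewrite Csum_const. ring.
    + intros n Hn Hn0. rewrite roots_orth_plus; [ring|lia|lia|lia].
  - intros m Hm Hm0. rewrite (Csum_ext _ (fun _ => 0%C)); [apply Csum_0|].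
    intros n Hn. rewrite roots_orth_plus; [ring|lia|lia|lia].
Qed.

Lemma mean_one (a : nat -> C) :
  Csum (fun j => Csum (fun m => a m * (om ^ j) ^ m) N)%C (2 * N) = (RtoC (INR (2 * N)) * a O)%C.
Proof.
  rewrite Csum_swap, (Csum_delta _ O); auto.
  - rewrite (Csum_ext _ (fun _ => a O)) by (intros; simpl; ring). rewrite Csum_const. ring.
  - intros n Hn Hn0. rewrite Csum_mult_l.
    rewrite (Csum_ext _ (fun j => (om ^ j) ^ n * (om ^ j) ^ 0)%C) by (intros; simpl; ring).
    rewrite roots_orth_plus; [ring|lia|lia|lia].
Qed.

End Roots.

Lemma twice_Re w : (w + Cconj w - 1)%C = RtoC (2 * Re w - 1).
Proof. destruct w as [a b]. apply injective_projections; simpl; ring. Qed.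

Lemma Cconj_Csum u N : Cconj (Csum u N) = Csum (fun n => Cconj (u n)) N.
Proof.
  induction N as [|N IH]; simpl; [unfold Cconj, RtoC; simpl; f_equal; ring|].
  rewrite <- IH. destruct (Csum u N), (u N). unfold Cconj, Cplus; simpl. f_equal. ring.
Qed.

Lemma Cconj_cis t : Cconj (cis t) = cis (- t).
Proof. unfold Cconj, cis; simpl. now rewrite cos_neg, sin_neg. Qed.

Lemma Cconj_R x : Cconj (RtoC x) = RtoC x.
Proof. unfold Cconj, RtoC; simpl. f_equal. ring. Qed.

Lemma disc_summable_mult g h : disc_summable 1 g -> disc_summable 1 h -> disc_summable 1 (fun n =>
  g n * h n)%C.
Proof.
  intros Hg Hh r Hr. set (x := (r + 1) / 2). assert (Hx : 0 < x < 1) by (unfold x; lra).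
  destruct (Hg x ltac:(lra)) as [G HG]. destruct (Hh x ltac:(lra)) as [H HH].
  assert (P : forall (a : nat -> C) n, 0 <= Cmod (a n) * x ^ n)
    by (intros; apply Rmult_le_pos; [apply Cmod_ge_0|apply pow_le; lra]).
  apply (geom_summable _ (x * x)); [unfold x; split; [lra|nra]|].
  exists (G * H). intros n. rewrite Cmod_mult, Rpow_mult_distr.
  replace (Cmod (g n) * Cmod (h n) * (x ^ n * x ^ n)) with (Cmod (g n) * x ^ n * (Cmod (h n) * x ^
    n)) by ring.
  apply Rmult_le_compat; auto.
  - exact (term_le_Series _ _ n (P g) HG).
  - exact (term_le_Series _ _ n (P h) HH).
Qed.

(** For polynomials h and g with N terms, the mean over the 2N-th roots of unity w of
      h (u w) (2 Re g (rho / w) - 1)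
    is the value of the convolution at rho u: adding conj g - 1 to g changes only the constant term,
    where it adds nothing. The second factor is at least delta and the first has positive real part
    after multiplication by e, so the real part of the mean is at least delta Re (e h_0). For series, both
    factors are perturbed by the tails. *)
Lemma convolution_half_plane (g h : nat -> C) (e u : C) rho delta :
  disc_summable 1 g -> disc_summable 1 h -> 0 < rho < 1 -> Cmod u = rho -> g O = 1%C -> 0 < delta ->
  (forall w, Cmod w < 1 -> 0 < Re (e * CPSeries h w)%C) ->
  (forall y, Cmod y = 1 -> 1 / 2 + delta <= Re (CPSeries g (RtoC rho * y))) ->
  0 < Re (e * CPSeries (fun n => g n * h n) (RtoC rho * u))%C.
Proof.
  intros Hg Hh Hr Hu Hg0 Hd Hhp Hgp.
  set (A := Re (e * h O)%C).
  assert (HA : 0 < A).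
  { unfold A. rewrite <- CPSeries_0. apply Hhp. rewrite Cmod_0. lra. }
  destruct (Hg rho ltac:(lra)) as [G HG].
  assert (PG : forall n, 0 <= Cmod (g n) * rho ^ n) by (intros; apply Rmult_le_pos;
    [apply Cmod_ge_0|apply pow_le; lra]).
  assert (G0 : 0 <= G).
  { exact (Rle_trans _ _ _ (PG O) (term_le_Series _ _ O PG HG)). }
  set (B := 2 * G + 1).
  set (ce := Cmod e). assert (Ce0 : 0 <= ce) by apply Cmod_ge_0.
  assert (Hgh : disc_summable 1 (fun n => g n * h n)%C).
  { now apply disc_summable_mult. }
  (* With this eta the perturbations cost at most A delta / 4 each, out of A delta. *)
  set (eta := A * delta / (4 * (B + 1) * (ce + 1))).
  assert (He : 0 < eta).
  { unfold eta. apply Rdiv_lt_0_compat; [now apply Rmult_lt_0_compat|].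
      repeat apply Rmult_lt_0_compat; unfold B; lra. }
  destruct (CPSeries_uniform_tail h rho eta Hh Hr He) as [N1 T1].
  destruct (CPSeries_uniform_tail g rho (delta / 2) Hg Hr ltac:(lra)) as [N2 T2].
  assert (Ru : Cmod (RtoC rho * u) <= rho) by (rewrite Cmod_mult, Cmod_R, Hu, Rabs_pos_eq; nra).
  destruct (CPSeries_uniform_tail (fun n => g n * h n)%C rho (A * delta / (4 * (ce + 1))) Hgh Hr)
    as [N3 T3].
  { apply Rdiv_lt_0_compat; [now apply Rmult_lt_0_compat|]. lra. }
  set (N := S (N1 + N2 + N3)).
  assert (HN : (0 < N)%nat) by (unfold N; lia).
  set (om := cis (PI / INR N)). set (omi := cis (- (PI / INR N))).
  set (hN := fun j => Csum (fun m => (h m * u ^ m) * (om ^ j) ^ m)%C N).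
  set (gN := fun j => Csum (fun n => (g n * RtoC rho ^ n) * (omi ^ j) ^ n)%C N).
  set (gC := fun j => Csum (fun n => (Cconj (g n) * RtoC rho ^ n) * (om ^ j) ^ n)%C N).
  set (SN := Csum (fun n => g n * h n * (RtoC rho * u) ^ n)%C N).
  assert (EC : forall j, gC j = Cconj (gN j)).
  { intros j. unfold gC, gN. rewrite Cconj_Csum. apply Csum_ext. intros n _.
    rewrite !Cmult_conj, !Cpow_conj, Cconj_R. unfold om, omi. rewrite Cconj_cis, Ropp_involutive.
      reflexivity. }
  assert (MS : Csum (fun j => (e * hN j) * (gN j + gC j - 1))%C (2 * N) = (RtoC (INR (2 * N)) * (e
    * SN))%C).
  { rewrite (Csum_ext _ (fun j => e * (hN j * gN j) + (e * (hN j * gC j) + (- e) * hN j))%C) by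
      (intros; ring).
    rewrite !Csum_plus, !Csum_mult_l.
    unfold hN at 1, gN. unfold om, omi. rewrite (mean_minus N HN). fold om omi.
    unfold hN at 1, gC. unfold om. rewrite (mean_plus N HN). fold om.
    unfold hN, om. rewrite (mean_one N HN).
    rewrite Hg0. replace (Cconj 1) with (RtoC 1) by (unfold Cconj, RtoC; simpl; f_equal; ring).
    unfold SN. rewrite (Csum_ext (fun n => h n * u ^ n * (g n * RtoC rho ^ n))%C (fun n => g n * h
      n * (RtoC rho * u) ^ n)%C).
    - simpl Cpow. ring.
    - intros n _. rewrite Cpow_mult_l. ring. }
  assert (Mom : forall j, Cmod (om ^ j)%C = 1) by (intros; rewrite Cmod_pow; unfold om;
    rewrite Cmod_cis; apply pow1).
  assert (Momi : forall j, Cmod (omi ^ j)%C = 1) by (intros; rewrite Cmod_pow; unfold omi;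
    rewrite Cmod_cis; apply pow1).
  assert (HX : forall j, - (ce * eta) <= Re (e * hN j)%C).
  { intros j. set (w := (u * om ^ j)%C).
    assert (Hw : Cmod w = rho) by (unfold w; rewrite Cmod_mult, Mom, Hu; ring).
    assert (E : hN j = Csum (fun n => h n * w ^ n)%C N).
    { unfold hN. apply Csum_ext. intros n _. unfold w. rewrite Cpow_mult_l. ring. }
    pose proof (T1 N w ltac:(unfold N; lia) ltac:(lra)) as K. rewrite <- E in K.
    pose proof (Hhp w ltac:(lra)) as P.
    replace (e * hN j)%C with (e * CPSeries h w - e * (CPSeries h w - hN j))%C by ring.
    change (- (ce * eta) <= Re (e * CPSeries h w)%C - Re (e * (CPSeries h w - hN j))%C).
    assert (Re (e * (CPSeries h w - hN j))%C <= ce * eta); [|lra].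
    eapply Rle_trans; [apply Rle_abs|]. eapply Rle_trans; [apply re_le_Cmod|].
    rewrite Cmod_mult. apply Rmult_le_compat_l; auto. }
  assert (HY : forall j, delta <= 2 * Re (gN j) - 1 <= B).
  { intros j. set (w := (RtoC rho * omi ^ j)%C).
    assert (Hw : Cmod w = rho) by (unfold w; rewrite Cmod_mult, Momi, Cmod_R, Rabs_pos_eq; lra).
    assert (E : gN j = Csum (fun n => g n * w ^ n)%C N).
    { unfold gN. apply Csum_ext. intros n _. unfold w. rewrite Cpow_mult_l. ring. }
    pose proof (T2 N w ltac:(unfold N; lia) ltac:(lra)) as K. rewrite <- E in K.
    pose proof (Hgp (omi ^ j)%C (Momi j)) as P. fold w in P.
    pose proof (re_le_Cmod (CPSeries g w - gN j)%C) as K2.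
    change (Re (CPSeries g w - gN j)%C) with (Re (CPSeries g w) - Re (gN j)) in K2.
    pose proof (Rle_abs (Re (CPSeries g w) - Re (gN j))).
    split; [lra|]. unfold B. assert (Re (gN j) <= G); [|lra].
    eapply Rle_trans; [apply Rle_abs|]. eapply Rle_trans; [apply re_le_Cmod|].
    rewrite E. unfold N. eapply Rle_trans; [apply Csum_Cmod|].
    rewrite (rsum_ext _ (fun n => Cmod (g n) * rho ^ n)); [apply (sum_n_le_Series _ _ _ PG HG)|].
    intros n. now rewrite Cmod_mult, Cmod_pow, Hw. }
  assert (HS : A * delta - ce * eta * (B + 1) <= Re (e * SN)%C).
  { assert (P2 : 0 < INR (2 * N)) by (apply lt_0_INR; lia).
    apply (Rmult_le_reg_l (INR (2 * N))); auto.
    rewrite <- re_scal_l, <- MS.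
    replace (INR (2 * N) * (A * delta - ce * eta * (B + 1))) with
      (Re (Csum (fun j => RtoC delta * (e * hN j) + RtoC (- (ce * eta * (B + 1))))%C (2 * N))).
    - apply Re_csum_le. intros j _.
      specialize (HX j). specialize (HY j).
      rewrite EC.
      replace ((e * hN j) * (gN j + Cconj (gN j) - 1))%C with (RtoC (2 * Re (gN j) - 1) * (e * hN
        j))%C.
      2:{ rewrite <- twice_Re. ring. }
      rewrite re_plus, !re_scal_l. change (Re (RtoC (- (ce * eta * (B + 1))))) with (- (ce * eta *
        (B + 1))).
      assert (0 <= ce * eta) by (apply Rmult_le_pos; lra).
      assert (0 <= (Re (e * hN j)%C + ce * eta) * (2 * Re (gN j) - 1 - delta)) by (apply
        Rmult_le_pos; lra).
      nra.
    - rewrite Csum_plus, Csum_mult_l, Csum_mult_l, Csum_const. unfold hN, om.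
        rewrite (mean_one N HN). fold om.
      rewrite <- RtoC_mult. simpl Cpow.
      replace (RtoC delta * (e * (RtoC (INR (2 * N)) * (h 0%nat * 1))))%C with (RtoC (delta * INR
        (2 * N)) * (e * h 0%nat))%C by (rewrite RtoC_mult; ring).
      rewrite re_plus, re_scal_l. fold A. change (Re (RtoC ?x)) with x. unfold Re, RtoC; simpl fst.
        ring. }
  assert (Hlim : Rabs (Re (e * CPSeries (fun n => g n * h n)%C (RtoC rho * u))%C - Re (e * SN)%C)
    <= ce * (A * delta / (4 * (ce + 1)))).
  { pose proof (T3 N (RtoC rho * u)%C ltac:(unfold N; lia) Ru) as K. fold SN in K.
    replace (Re (e * CPSeries (fun n => g n * h n)%C (RtoC rho * u))%C - Re (e * SN)%C) with
      (Re (e * (CPSeries (fun n => g n * h n)%C (RtoC rho * u) - SN))%C).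
    - eapply Rle_trans; [apply re_le_Cmod|]. rewrite Cmod_mult. apply Rmult_le_compat_l; auto.
    - replace (e * (CPSeries (fun n => g n * h n)%C (RtoC rho * u) - SN))%C with (e * CPSeries (fun
        n => g n * h n)%C (RtoC rho * u) - e * SN)%C by ring.
      reflexivity. }
  assert (AD : 0 < A * delta) by now apply Rmult_lt_0_compat.
  assert (F1 : ce * (A * delta / (4 * (ce + 1))) <= A * delta / 4).
  { apply (Rmult_le_reg_r (4 * (ce + 1))); [lra|].
    replace (ce * (A * delta / (4 * (ce + 1))) * (4 * (ce + 1))) with (ce * (A * delta)) by (field;
      lra). nra. }
  assert (F2 : ce * eta * (B + 1) <= A * delta / 4).
  { assert (0 < B + 1) by (unfold B; lra).
    replace (ce * eta * (B + 1)) with (ce * (A * delta / (4 * (ce + 1)))) by (unfold eta; field;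
      lra). exact F1. }
  pose proof (Rabs_maj2 (Re (e * CPSeries (fun n => g n * h n)%C (RtoC rho * u))%C - Re (e *
    SN)%C)).
  lra.
Qed.

(** * The transform as a power series, and a test for starlikeness *)

Lemma CPSeries_euler Rd b z : disc_summable Rd b -> Cmod z < Rd -> (z * CPSeries (derive_coef b)
  z)%C = CPSeries (fun n => RtoC (INR n) * b n)%C z.
Proof.
  intros Hb Hz. symmetry. apply Cseries_unique. apply is_Cseries_shift_1; [|simpl; ring].
  eapply is_Cseries_ext; [|apply (is_Cseries_scal z);
    apply (CPSeries_correct Rd (derive_coef b) z); auto using disc_summable_derive_coef].
  intros n. unfold derive_coef. change (z ^ S n)%C with (z * z ^ n)%C. ring.
Qed.

Lemma disc_summable_euler Rd b : 0 < Rd <= 1 -> disc_summable Rd b -> disc_summable Rd (fun n =>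
  RtoC (INR n) * b n)%C.
Proof.
  intros HR H r Hr. apply disc_summable_derive_coef in H. apply ex_series_incr_1.
  apply ex_series_dom with (fun n => Cmod (derive_coef b n) * r ^ n); auto.
  intros n. assert (P : 0 <= r ^ n) by (apply pow_le; lra).
    pose proof (Cmod_ge_0 (derive_coef b n)).
  change (RtoC (INR (S n)) * b (S n))%C with (derive_coef b n). simpl pow.
  split; [apply Rmult_le_pos; auto; apply Rmult_le_pos; lra|]. apply Rmult_le_compat_l; auto. nra.
Qed.

Lemma C_derive_CPSeries f b z : (forall w, Cmod w < 1 -> f w = CPSeries b w) -> disc_summable 1 b
  -> Cmod z < 1 ->
  C_derive f z = CPSeries (derive_coef b) z.
Proof.
  intros Hf Hb Hz. apply is_Cderive_unique. apply is_Cderive_ext_loc with (CPSeries b) (1 - Cmod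
    z); [lra| |].
  - intros y Hy. symmetry. apply Hf. replace y with ((y - z) + z)%C by ring.
    eapply Rle_lt_trans; [apply Cmod_triangle|lra].
  - apply (CPSeries_derive 1); auto.
Qed.

Lemma analytic_ext_disc f b z : (forall w, Cmod w < 1 -> f w = CPSeries b w) -> disc_summable 1 b
  -> Cmod z < 1 -> analytic_at f z.
Proof.
  intros Hf Hb Hz. destruct (CPSeries_analytic 1 b z Hb Hz) as [a Ha]. exists a.
  assert (L : locally (T := C_UniformSpace) z (fun y : C => Cmod y < 1)).
  { assert (K : forall y : C, Cmod (y - z) < 1 - Cmod z -> Cmod y < 1).
    { intros y Hy. assert (T := Cmod_triangle (y - z)%C z).
        replace (y - z + z)%C with y in T by ring. lra. }
    apply locally_C. exists (mkposreal (1 - Cmod z) ltac:(lra)). exact K. }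
  generalize (filter_and _ _ Ha L). apply filter_imp. intros y [H1 H2]. rewrite (Hf y H2). exact H1.
Qed.

(** Improper complex integrals can be computed by components. *)
Lemma int01_C_comp (g : R -> C) l1 l2 :
  is_RInt_gen (fun t => Re (g t)) (at_right 0) (at_left 1) l1 ->
  is_RInt_gen (fun t => Im (g t)) (at_right 0) (at_left 1) l2 -> int01_C g = (l1, l2).
Proof.
  intros H1 H2. unfold int01_C.
  refine (is_RInt_gen_unique (V := C_R_CompleteNormedModule) (Fa := at_right 0) (Fb := at_left 1) g
    (l1, l2) _).
  rewrite is_RInt_gen_eps in H1, H2. intros P [eps HP].
  destruct (H1 eps (cond_pos eps)) as [Q1 [S1 [HQ1 [HS1 K1]]]].
  destruct (H2 eps (cond_pos eps)) as [Q2 [S2 [HQ2 [HS2 K2]]]].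
  apply Filter_prod with (fun a => Q1 a /\ Q2 a) (fun b => S1 b /\ S2 b);
    [now apply filter_and|now apply filter_and|].
  intros a b [A1 A2] [B1 B2]. destruct (K1 a b A1 B1) as [I1 [D1 E1]].
    destruct (K2 a b A2 B2) as [I2 [D2 E2]].
  exists (I1, I2). split.
  - apply (is_RInt_fct_extend_pair (U := R_NormedModule) (V := R_NormedModule) g a b I1 I2);
      [exact D1|exact D2].
  - apply HP. split; [exact E1|exact E2].
Qed.

Definition V_coef (c p : R) (a : nat -> C) (n : nat) : C :=
  match n with O => 0%C | S m => (RtoC (V_mult c p m) * a (S m))%C end.

Lemma disc_summable_tail a : disc_summable 1 a -> disc_summable 1 (fun n => a (S n)).
Proof.
  intros H r Hr. set (x := (r + 1) / 2). assert (Hx : r < x < 1) by (unfold x; lra).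
  destruct (H x ltac:(lra)) as [l Hl]. apply (geom_summable _ x); [lra|]. exists (l / x). intros n.
  assert (P : forall n, 0 <= Cmod (a n) * x ^ n) by (intros; apply Rmult_le_pos;
    [apply Cmod_ge_0|apply pow_le; lra]).
  apply (Rmult_le_reg_r x); [lra|]. unfold Rdiv. rewrite (Rmult_assoc l), Rinv_l, Rmult_1_r by lra.
  eapply Rle_trans; [|apply (term_le_Series _ _ (S n) P Hl)]. right. simpl. ring.
Qed.

Lemma V_mult_bounds c p m : -1 < c -> 0 < p -> 0 < V_mult c p m <= 1.
Proof.
  intros Hc Hp. unfold V_mult. pose proof (Rpower_pos (1 + c) p).
    pose proof (Rpower_pos (1 + c + INR m) p).
  assert (0 < / Rpower (1 + c + INR m) p) by now apply Rinv_0_lt_compat.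
  split; [now apply Rmult_lt_0_compat|]. pose proof (Rpower_shift_le (1 + c) p m ltac:(lra) Hp).
  apply (Rmult_le_reg_r (Rpower (1 + c + INR m) p)); auto. rewrite Rmult_assoc, Rinv_l; lra.
Qed.

Lemma disc_summable_bdd (m : nat -> R) a : (forall n, Rabs (m n) <= 1) -> disc_summable 1 a ->
  disc_summable 1 (fun n => RtoC (m n) * a n)%C.
Proof.
  intros Hm H r Hr. apply ex_series_dom with (fun n => Cmod (a n) * r ^ n); auto.
  intros n. assert (0 <= r ^ n) by (apply pow_le; lra). split; [apply Rmult_le_pos; auto;
    apply Cmod_ge_0|].
  apply Rmult_le_compat_r; auto. rewrite Cmod_mult, Cmod_R. pose proof (Cmod_ge_0 (a n)).
    specialize (Hm n). nra.
Qed.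

Lemma disc_summable_V_coef c p a : -1 < c -> 0 < p -> disc_summable 1 a -> disc_summable 1 (V_coef
  c p a).
Proof.
  intros Hc Hp Ha. apply disc_summable_ext with (fun n => RtoC (match n with O => 0 | S m => V_mult
    c p m end) * a n)%C.
  - intros [|n]; simpl; [ring|reflexivity].
  - apply disc_summable_bdd; auto. intros [|n]; [rewrite Rabs_R0; lra|].
    destruct (V_mult_bounds c p n Hc Hp). rewrite Rabs_pos_eq; lra.
Qed.

(** Since f (t z) is t times a series in t, the weight t^(c-1) of the transform becomes t^c, which
    is integrable, and the integration is termwise. *)
Lemma V_series c p f a z : -1 < c -> 0 < p -> disc_summable 1 a -> a O = 0%C ->
  (forall w, Cmod w < 1 -> f w = CPSeries a w) -> Cmod z < 1 -> V_lambda c p f z = CPSeries (V_coef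
    c p a) z.
Proof.
  intros Hc Hp Ha Ha0 Hf Hz.
  destruct (Gamma_correct p Hp) as [_ G].
  assert (Hs := disc_summable_tail a Ha).
  assert (AS : ex_series (fun n => Cmod (a (S n) * z ^ S n)%C)).
  { apply (ex_series_incr_1 (fun n => Cmod (a n * z ^ n)%C)). apply (disc_summable_term 1); auto. }
  set (gr := fun n => Re (a (S n) * z ^ S n)%C). set (gi := fun n => Im (a (S n) * z ^ S n)%C).
  assert (Agr : ex_series (fun n => Rabs (gr n))).
  { eapply ex_series_dom; [|exact AS]. intros n. split; [apply Rabs_pos|apply re_le_Cmod]. }
  assert (Agi : ex_series (fun n => Rabs (gi n))).
  { eapply ex_series_dom; [|exact AS]. intros n. split; [apply Rabs_pos|apply im_le_Cmod]. }
  assert (W : forall g, ex_series (fun n => Rabs (g n)) ->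
    is_RInt_gen (fun t => log_weight (1 + c) p t * PSeries g t) (at_right 0) (at_left 1) (Series
      (fun n => g n * log_moment (1 + c) p n))).
  { intros g Hg. apply weight_series; auto.
    - intros t Ht. now apply log_weight_cont.
    - intros t Ht. left. apply log_weight_pos.
    - intros n. apply log_weight_moment; lra.
    - intros n. apply log_moment_bounds; lra. }
  assert (FT : forall t, 0 < t < 1 -> f (RtoC t * z)%C = (RtoC t * (PSeries gr t, PSeries gi t))%C).
  { intros t Ht. assert (Ht' := abs01 t Ht).
    assert (Hw : Cmod (RtoC t * z) < 1).
    { rewrite Cmod_mult, Cmod_R, Rabs_pos_eq by lra. pose proof (Cmod_ge_0 z). nra. }
    rewrite Hf by auto.
    assert (K := CPSeries_correct 1 a _ Ha Hw). apply is_Cseries_incr_1 in K. rewrite Ha0 in K.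
    replace (CPSeries a (RtoC t * z) - 0 * (RtoC t * z) ^ 0)%C with (CPSeries a (RtoC t * z)) in K
      by ring.
    eapply is_Cseries_unique; [exact K|].
    eapply is_Cseries_ext; [|apply (is_Cseries_scal (RtoC t) (fun n => (gr n * t ^ n, gi n * t ^
      n)))].
    - intros n. cbv beta. rewrite (Cpow_mult_l (RtoC t)).
      replace (a (S n) * (RtoC t ^ S n * z ^ S n))%C with (RtoC t ^ S n * (a (S n) * z ^ S n))%C by
        ring.
      rewrite <- RtoC_pow. unfold gr, gi. destruct (a (S n) * z ^ S n)%C as [x y].
      apply injective_projections; simpl; ring.
    - apply is_Cseries_comp. simpl. split; apply rsummable_is; auto; now apply rsummable_of_abs. }
  unfold V_lambda.
  rewrite (int01_C_comp _ (Series (fun n => gr n * log_moment (1 + c) p n)) (Series (fun n => gi n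
    * log_moment (1 + c) p n))).
  - symmetry. apply Cseries_unique. apply is_Cseries_shift_1; [|simpl; ring].
    eapply is_Cseries_ext; [|apply (is_Cseries_scal _ (fun n => (gr n * log_moment (1 + c) p n, gi
      n * log_moment (1 + c) p n)))].
    + intros n. cbv beta. unfold V_coef, gr, gi, V_mult, log_moment.
      replace (RtoC (Rpower (1 + c) p * / Rpower (1 + c + INR n) p) * a (S n) * z ^ S n)%C with
        (RtoC (Rpower (1 + c) p * / Rpower (1 + c + INR n) p) * (a (S n) * z ^ S n))%C by ring.
      destruct (a (S n) * z ^ S n)%C as [x y]. pose proof (Rpower_pos (1 + c + INR n) p).
      apply injective_projections; simpl; field; lra.
    + assert (SS : forall g, ex_series (fun n => Rabs (g n)) -> is_series (fun n => g n *
        log_moment (1 + c) p n) (Series (fun n => g n * log_moment (1 + c) p n))).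
      { intros g Hg. apply Series_correct, ex_series_Rabs.
          apply ex_series_dom with (fun n => log_moment (1 + c) p 0 * Rabs (g n)).
        - intros n. split; [apply Rabs_pos|]. destruct (log_moment_bounds (1 + c) p n ltac:(lra)
            Hp) as [M1 M2].
          rewrite Rabs_mult, (Rabs_pos_eq (log_moment _ _ _)) by auto. pose proof (Rabs_pos (g n)).
            nra.
        - now apply (ex_series_scal (V := R_NormedModule)). }
      apply is_Cseries_comp. simpl. split; apply SS; auto.
  - eapply int01_ext; [|apply (W gr Agr)]. intros t Ht. cbv beta. rewrite FT by auto.
    unfold log_weight. replace (1 + c - 1) with (c - 1 + 1) by ring.
      rewrite Rpower_plus, Rpower_1 by lra.
    unfold Re, Cmult, RtoC; simpl. ring.
  - eapply int01_ext; [|apply (W gi Agi)]. intros t Ht. cbv beta. rewrite FT by auto.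
    unfold log_weight. replace (1 + c - 1) with (c - 1 + 1) by ring.
      rewrite Rpower_plus, Rpower_1 by lra.
    unfold Im, Cmult, RtoC; simpl. ring.
Qed.

(** If Re (Z/P) <= 0, then v = Z/P - 1 has real part at most -1, so eps = -1/v lies in the disc
    and annihilates P + eps (Z - P) = P (1 + eps v). The value eps = 0 excludes P = 0. *)
Lemma starlike_test (P Z : C) :
  (forall eps, Cmod (eps - RtoC (1/2)) <= 1/2 -> (P + eps * (Z - P))%C <> 0%C) -> 0 < Re (Z / P)%C.
Proof.
  intros H.
  assert (P0 : P <> 0%C).
  { intro E. apply (H 0%C).
    - replace (0 - RtoC (1/2))%C with (RtoC (- (1/2))) by (rewrite RtoC_opp; ring).
        rewrite Cmod_R, Rabs_left; lra.
    - rewrite E. ring. }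
  apply Rnot_le_lt. intros L.
  set (v := (Z / P - 1)%C).
  assert (Rv : Re v <= -1) by (unfold v; change (Re (Z / P)%C - 1 <= -1); lra).
  assert (V0 : v <> 0%C) by (intro E; rewrite E in Rv; simpl in Rv; lra).
  apply (H (- / v)%C).
  - replace (- / v - RtoC (1/2))%C with (- ((2 + v) / (2 * v)))%C.
    2:{ replace (RtoC (1/2)) with (/ 2)%C by (rewrite <- RtoC_inv by lra; f_equal; field). field.
      exact V0. }
    rewrite Cmod_opp, Cmod_div by (apply Cmult_neq_0; auto; apply RtoC_neq; lra).
    rewrite Cmod_mult, Cmod_R, Rabs_pos_eq by lra.
    apply Cmod_gt_0 in V0.
    assert (M : Cmod (2 + v) <= Cmod v).
    { apply Rsqr_incr_0_var; [|lra]. rewrite !Rsqr_pow2, !Cmod2_alt.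
      change (Re (2 + v)%C) with (2 + Re v). change (Im (2 + v)%C) with (0 + Im v). nra. }
    apply (Rmult_le_reg_r (2 * Cmod v)); [lra|]. unfold Rdiv. rewrite Rmult_assoc, Rinv_l; lra.
  - unfold v. field_simplify_eq; [|split; auto].
    + ring.
    + intro E. apply V0. unfold v. replace (Z / P - 1)%C with ((Z - P) / P)%C by (field; auto).
      rewrite E. field. auto.
Qed.

(** * Membership in the Pascu class *)

Definition W_coef (mu nu : R) (a : nat -> C) (n : nat) : C := (RtoC (quad_factor mu nu n) * a (S
  n))%C.

Lemma disc_summable_W_coef mu nu a : disc_summable 1 a -> disc_summable 1 (W_coef mu nu a).
Proof.
  intros Ha. assert (Hs := disc_summable_tail a Ha).
  assert (H1 := disc_summable_euler 1 _ ltac:(lra) Hs).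
    assert (H2 := disc_summable_euler 1 _ ltac:(lra) H1).
  apply disc_summable_ext with (fun n => a (S n) + (RtoC (mu + nu) * (RtoC (INR n) * a (S n)) +
    RtoC (mu * nu) * (RtoC (INR n) * (RtoC (INR n) * a (S n)))))%C.
  - intros n. unfold W_coef, quad_factor. rewrite !RtoC_mult, !RtoC_plus, !RtoC_mult. ring.
  - apply disc_summable_plus; auto. apply disc_summable_plus; now apply disc_summable_scal.
Qed.

(** The coefficient of z^n is ((1 - alpha + 2 gamma) + (alpha - 2 gamma)(n+1) + gamma n (n+1))
    a_(n+1), and the factor equals (1 + mu n)(1 + nu n). *)
Lemma W_series alpha gamma mu nu f a w : mu + nu = alpha - gamma -> mu * nu = gamma ->
  disc_summable 1 a -> a O = 0%C -> (forall w, Cmod w < 1 -> f w = CPSeries a w) -> Cmod w < 1 ->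
  ((1 - alpha + 2 * gamma) * quot_z f w + (alpha - 2 * gamma) * C_derive f w
     + gamma * w * C_derive (C_derive f) w)%C = CPSeries (W_coef mu nu a) w.
Proof.
  intros Hs Hpr Ha Ha0 Hf Hw.
  assert (Hd : forall y, Cmod y < 1 -> C_derive f y = CPSeries (derive_coef a) y) by (intros;
    now apply C_derive_CPSeries).
  assert (Ca := disc_summable_derive_coef 1 a Ha).
  rewrite Hd, (C_derive_CPSeries _ (derive_coef a) w Hd Ca Hw) by auto.
  rewrite <- (Cmult_assoc (RtoC gamma) w), (CPSeries_euler 1) by auto.
  assert (EQ : quot_z f w = CPSeries (fun n => a (S n)) w).
  { unfold quot_z. destruct (ClassicalEpsilon.excluded_middle_informative (w = 0%C)) as [->|E].
    - rewrite Hd, !CPSeries_0 by (rewrite Cmod_0; lra). unfold derive_coef. simpl. ring.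
    - rewrite Hf, (CPSeries_step a w) by auto. rewrite Ha0. field. auto. }
  rewrite EQ. assert (Hsh := disc_summable_tail a Ha).
  assert (Ce := disc_summable_euler 1 _ ltac:(lra) Ca).
  rewrite <- (CPSeries_scal 1 _ (fun n => a (S n)) w Hsh Hw), <- (CPSeries_scal 1 _ (derive_coef a)
    w Ca Hw), <- (CPSeries_scal 1 _ _ w Ce Hw).
  rewrite <- (CPSeries_plus 1) by (auto using disc_summable_scal).
  rewrite <- (CPSeries_plus 1) by (auto using disc_summable_scal, disc_summable_plus).
  apply CPSeries_ext. intros n. unfold W_coef, derive_coef, quad_factor.
  rewrite S_INR. rewrite !RtoC_mult, !RtoC_plus, !RtoC_mult.
  assert (Eal : RtoC alpha = (RtoC mu + RtoC nu + RtoC mu * RtoC nu)%C).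
  { rewrite <- RtoC_mult, <- !RtoC_plus. f_equal. lra. }
  assert (Ega : RtoC gamma = (RtoC mu * RtoC nu)%C) by (rewrite <- RtoC_mult; now f_equal).
  rewrite Eal, Ega. ring.
Qed.

Definition set_const (x : C) (a : nat -> C) (n : nat) : C := match n with O => x | _ => a n end.
Lemma disc_summable_set_const x a : disc_summable 1 a -> disc_summable 1 (set_const x a).
Proof. intros H r Hr. apply ex_series_incr_1. apply (ex_series_incr_1 (fun n => Cmod (a n) * r ^
  n)). now apply H. Qed.

Lemma CPSeries_set_const x a w : disc_summable 1 a -> Cmod w < 1 -> CPSeries (set_const x a) w =
  (CPSeries a w - a O + x)%C.
Proof.
  intros H Hw. rewrite (CPSeries_step a w H Hw), (CPSeries_step (set_const x a) w
    (disc_summable_set_const x a H) Hw).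
  rewrite (CPSeries_ext (fun n => set_const x a (S n)) (fun n => a (S n))) by reflexivity. simpl.
    ring.
Qed.

(** Apply [convolution_half_plane] to g = 1 + (1-beta)(t_1 y + ...) and h = H - beta. The relation
    defining beta reads 1/2 = (1-beta)(1-Q), which turns the lower bound Q + d for the test series
    into 1/2 + (1-beta) d for g. *)
Lemma test_convolution_nonzero c p mu nu xi beta q a (e : C) z eps :
  -1 < c < 0 -> 2 < p -> 1 <= mu -> 0 < nu -> 0 <= xi <= 1 -> is_q mu nu q -> beta < 1 ->
  (beta - 1 / 2) / (1 - beta) =
     - (Rpower (1 + c) p / Gamma p * int01 (fun t : R => Rpower t c * Rpower (ln (1 / t)) (p - 1) *
         q t)) ->
  disc_summable 1 a -> a 1%nat = 1%C ->
  (forall w, Cmod w < 1 -> 0 < Re (e * (CPSeries (W_coef mu nu a) w - RtoC beta))%C) ->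
  Cmod z < 1 -> z <> 0%C -> Cmod (eps - RtoC (1/2)) <= 1/2 ->
  CPSeries (fun n => test_mult c p mu nu xi eps n * W_coef mu nu a n)%C z <> 0%C.
Proof.
  intros Hc Hp Hm Hn Hx Hq Hb1 Hb Ha Ha1 HW Hz Hz0 He.
  set (Q := Rpower (1 + c) p / Gamma p * int01 (fun t : R => Rpower t c * Rpower (ln (1 / t)) (p -
    1) * q t)) in *.
  assert (CH := disc_summable_W_coef mu nu a Ha).
  assert (CC := disc_summable_test_mult c p mu nu xi eps ltac:(lra) ltac:(lra) Hm Hn Hx).
  assert (H0 : W_coef mu nu a O = 1%C) by (unfold W_coef, quad_factor; rewrite Ha1; simpl INR;
    rewrite !Rmult_0_r, !Rplus_0_r, Rmult_1_r; ring).
  assert (C0 : test_mult c p mu nu xi eps O = 1%C) by (unfold test_mult; rewrite kappa_0 by lra;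
    simpl INR; rewrite Rmult_0_r, Rplus_0_r, Rmult_1_r; ring).
  set (h := set_const (RtoC (1 - beta)) (W_coef mu nu a)).
  set (g := set_const 1%C (fun n => RtoC (1 - beta) * test_mult c p mu nu xi eps n)%C).
  (* Half of the modulus of z goes to the argument of each factor, so both stay inside the disc. *)
  set (rho := sqrt (Cmod z)).
  assert (Z0 : 0 < Cmod z) by now apply Cmod_gt_0.
  assert (Hr2 : rho * rho = Cmod z) by (apply sqrt_def; lra).
  assert (Hr : 0 < rho < 1).
  { split; [now apply sqrt_lt_R0|]. rewrite <- sqrt_1. apply sqrt_lt_1; lra. }
  destruct (test_mult_lower_bound c p mu nu xi q rho Hc Hp Hm Hn Hx Hq Hr) as [d [Hd HL]].
    fold Q in HL.
  set (u := (z / RtoC rho)%C).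
  assert (Nr : RtoC rho <> 0%C) by (apply RtoC_neq; lra).
  assert (Hu : Cmod u = rho).
  { unfold u. rewrite Cmod_div, Cmod_R, (Rabs_pos_eq rho) by (auto; lra). rewrite <- Hr2. field.
      lra. }
  assert (Ez : (RtoC rho * u)%C = z) by (unfold u; field; auto).
  assert (K : 0 < Re (e * CPSeries (fun n => g n * h n) (RtoC rho * u))%C).
  { apply (convolution_half_plane g h e u rho ((1 - beta) * d)); auto.
    - apply disc_summable_set_const. now apply disc_summable_scal.
    - now apply disc_summable_set_const.
    - apply Rmult_lt_0_compat; lra.
    - intros w Hw. unfold h. rewrite CPSeries_set_const, H0 by auto.
      replace (CPSeries (W_coef mu nu a) w - 1 + RtoC (1 - beta))%C with (CPSeries (W_coef mu nu a)
        w - RtoC beta)%C by (rewrite RtoC_minus; ring).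
      now apply HW.
    - intros y Hy. unfold g.
      assert (Hry : Cmod (RtoC rho * y) < 1) by (rewrite Cmod_mult, Cmod_R, Hy, Rabs_pos_eq; lra).
      rewrite CPSeries_set_const, C0, (CPSeries_scal 1) by (auto using disc_summable_scal).
      specialize (HL eps y Hy He).
      replace (RtoC (1 - beta) * CPSeries (test_mult c p mu nu xi eps) (RtoC rho * y) - RtoC (1 -
        beta) * 1 + 1)%C with
        (RtoC (1 - beta) * CPSeries (test_mult c p mu nu xi eps) (RtoC rho * y) + RtoC beta)%C by
          (rewrite RtoC_minus; ring).
      rewrite re_plus, re_scal_l. change (Re (RtoC beta)) with beta.
      assert (EB : beta - 1/2 = - Q * (1 - beta)) by (rewrite <- Hb; field; lra).
      assert (0 <= (1 - beta) * (Re (CPSeries (test_mult c p mu nu xi eps) (RtoC rho * y)) - (Q +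
        d))) by (apply Rmult_le_pos; lra).
      nra. }
  rewrite Ez in K.
  assert (EE : CPSeries (fun n => g n * h n)%C z = (RtoC (1 - beta) * CPSeries (fun n => test_mult
    c p mu nu xi eps n * W_coef mu nu a n) z)%C).
  { rewrite <- (CPSeries_scal 1) by (auto using disc_summable_mult). apply CPSeries_ext.
      intros [|n].
    - unfold g, h, set_const. rewrite C0, H0. ring.
    - unfold g, h, set_const. ring. }
  intro E. rewrite EE, E in K. replace (e * (RtoC (1 - beta) * 0))%C with (RtoC 0) in K by ring.
    simpl in K. lra.
Qed.

Theorem theorem3p6 (alpha gamma xi mu nu c p beta : R) (q : R -> R)
  (Halpha : 0 <= alpha) (Hgamma : 0 < gamma) (Hxi : 0 <= xi <= 1)
  (Hmu : 1 <= mu) (Hnu : 0 < nu)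
  (Hsum : mu + nu = alpha - gamma) (Hprod : mu * nu = gamma)
  (Hc : -1 < c < 0) (Hp : 2 < p)
  (Hq : is_q mu nu q)
  (Hbeta1 : beta < 1)
  (Hbeta : (beta - 1 / 2) / (1 - beta) =
     - (Rpower (1 + c) p / Gamma p *
        int01 (fun t : R => Rpower t c * Rpower (ln (1 / t)) (p - 1) * q t))) :
  forall f : C -> C, class_W beta alpha gamma f -> pascu xi (V_lambda c p f).
Proof.
  intros f [[Han [Hf0 Hf1]] [phi HW]].
  destruct (taylor_disc f Han) as [a [Ha Hf]].
  assert (Z0 : Cmod 0 < 1) by (rewrite Cmod_0; lra).
  assert (Ha0 : a O = 0%C) by (rewrite <- CPSeries_0, <- Hf; auto).
  assert (Ha1 : a 1%nat = 1%C).
  { rewrite (C_derive_CPSeries f a 0%C Hf Ha Z0), CPSeries_0 in Hf1. unfold derive_coef in Hf1.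
      simpl in Hf1. rewrite <- Hf1. ring. }
  set (b := V_coef c p a).
  assert (Hb : disc_summable 1 b) by (apply disc_summable_V_coef; auto; lra).
  assert (HF : forall w, Cmod w < 1 -> V_lambda c p f w = CPSeries b w) by (intros w Hw;
    apply V_series; auto; lra).
  assert (HF' : forall w, Cmod w < 1 -> C_derive (V_lambda c p f) w = CPSeries (derive_coef b) w)
    by (intros; now apply C_derive_CPSeries).
  assert (Hnb := disc_summable_euler 1 b ltac:(lra) Hb).
  set (F := V_lambda c p f) in *.
  split.
  - split; [|split].
    + intros z Hz. now apply (analytic_ext_disc F b z HF Hb).
    + rewrite HF by auto. apply CPSeries_0.
    + rewrite HF', CPSeries_0 by auto. unfold derive_coef, b, V_coef, V_mult. rewrite Ha1.
        simpl INR. rewrite Rplus_0_r.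
      pose proof (Rpower_pos (1 + c) p). rewrite Rinv_r by lra. ring.
  - intros z Hz Hz0. unfold unit_disc in Hz.
    assert (HZ : forall w, Cmod w < 1 -> z_deriv F w = CPSeries (fun n => RtoC (INR n) * b n)%C w).
    { intros w Hw. unfold z_deriv. rewrite HF' by auto. now apply (CPSeries_euler 1). }
    rewrite (C_derive_CPSeries _ _ z HZ Hnb Hz), (CPSeries_euler 1 _ z Hnb Hz), HF', HF by auto.
    rewrite (CPSeries_euler 1 b z Hb Hz).
    set (w := fun n => ((RtoC xi * RtoC (INR n) + (1 - RtoC xi)) * b n)%C).
    assert (Hnnb := disc_summable_euler 1 _ ltac:(lra) Hnb).
    assert (Hw : disc_summable 1 w).
    { apply disc_summable_ext with (fun n => RtoC xi * (RtoC (INR n) * b n) + (1 - RtoC xi) * b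
        n)%C; [intros; unfold w; ring|].
      apply disc_summable_plus; now apply disc_summable_scal. }
    assert (Hnw := disc_summable_euler 1 w ltac:(lra) Hw).
    assert (EP : (RtoC xi * CPSeries (fun n => RtoC (INR n) * b n) z + (1 - RtoC xi) * CPSeries b
      z)%C = CPSeries w z).
    { rewrite <- !(CPSeries_scal 1), <- (CPSeries_plus 1) by auto using disc_summable_scal.
        apply CPSeries_ext. intros n. unfold w. ring. }
    assert (EZ : (RtoC xi * CPSeries (fun n => RtoC (INR n) * (RtoC (INR n) * b n)) z + (1 - RtoC
      xi) * CPSeries (fun n => RtoC (INR n) * b n) z)%C
        = CPSeries (fun n => RtoC (INR n) * w n)%C z).
    { rewrite <- !(CPSeries_scal 1), <- (CPSeries_plus 1) by auto using disc_summable_scal.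
        apply CPSeries_ext. intros n. unfold w. ring. }
    rewrite EP, EZ. apply starlike_test. intros eps He.
    assert (HT : (CPSeries w z + eps * (CPSeries (fun n => RtoC (INR n) * w n)%C z - CPSeries w
      z))%C =
      (z * CPSeries (fun n => test_mult c p mu nu xi eps n * W_coef mu nu a n) z)%C).
    { replace (CPSeries w z + eps * (CPSeries (fun n => RtoC (INR n) * w n)%C z - CPSeries w z))%C
        with
        ((1 - eps) * CPSeries w z + eps * CPSeries (fun n => RtoC (INR n) * w n)%C z)%C by ring.
      rewrite <- !(CPSeries_scal 1), <- (CPSeries_plus 1) by auto using disc_summable_scal.
      rewrite CPSeries_step by (auto using disc_summable_scal, disc_summable_plus).
      unfold w at 1 2. change (b O) with (RtoC 0).
      replace ((1 - eps) * ((RtoC xi * RtoC (INR 0) + (1 - RtoC xi)) * 0) + eps * (RtoC (INR 0) *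
        ((RtoC xi * RtoC (INR 0) + (1 - RtoC xi)) * 0)))%C with (RtoC 0) by ring.
      rewrite Cplus_0_l. f_equal. apply CPSeries_ext. intros n.
      unfold w, test_mult, W_coef, b, V_coef, kappa, V_mult.
      pose proof (quad_factor_pos mu nu n ltac:(lra) Hnu).
      rewrite S_INR, RtoC_plus.
      replace (RtoC ((1 + xi * INR n) * (Rpower (1 + c) p * / Rpower (1 + c + INR n) p * /
        quad_factor mu nu n))) with
        ((1 + RtoC xi * RtoC (INR n)) * RtoC (Rpower (1 + c) p * / Rpower (1 + c + INR n) p) * /
          RtoC (quad_factor mu nu n))%C.
      2:{ rewrite !RtoC_mult, RtoC_plus, RtoC_mult, (RtoC_inv (quad_factor mu nu n)) by lra. ring. }
      assert (ND : RtoC (quad_factor mu nu n) <> 0%C) by (apply RtoC_neq; lra).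
      field. exact ND. }
    rewrite HT. apply Cmult_neq_0; auto.
    apply (test_convolution_nonzero c p mu nu xi beta q a (cis phi)); auto.
    intros y Hy. specialize (HW y Hy).
    rewrite <- (W_series alpha gamma mu nu f a y); auto.
Qed.
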